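(* Let $K$ be a field. The following assertions are equivalent: (1) For any integer $n\ge1$ and any monomial ideal $I\subset S=K[x_1,\ldots,x_n]$, one has $\operatorname{sdepth}_S(S/I)\ge\operatorname{depth}_S(S/I)$ and $\operatorname{sdepth}_S(I)\ge\operatorname{depth}_S(I)$. (2) For any integer $n\ge1$ and any monomial ideals $I,J\subset S=K[x_1,\ldots,x_n]$ with $\operatorname{supp}(I)\cap\operatorname{supp}(J)=\emptyset$: if $\operatorname{sdepth}_S((I+J)/I)=\operatorname{depth}_S((I+J)/I)$, then $\operatorname{sdepth}_S(S/I)=\operatorname{depth}_S(S/I)$ and $\operatorname{sdepth}_S(J)\ge\operatorname{depth}_S(J)$.
   Context: For a monomial $u$, $\operatorname{supp}(u)=\{x_i: x_i\mid u\}$; for a monomial ideal $I$ with set of minimal monomial generators $G(I)$, $\operatorname{supp}(I)=\bigcup_{u\in G(I)}\operatorname{supp}(u)$. Let $S=K[x_1,\ldots,x_n]$ with its $\mathbb Z^n$-grading, and let $M\neq 0$ be a finitely generated $\mathbb Z^n$-graded $S$-module. A Stanley decomposition of $M$ is a finite direct sum decomposition of $K$-vector spaces $\mathcal D: M=\bigoplus_{i=1}^t m_iK[Z_i]$, where the $m_i\in M$ are homogeneous, $Z_i\subset\{x_1,\ldots,x_n\}$, and each $m_iK[Z_i]$ is a free $K[Z_i]$-module. Put $\operatorname{sdepth}(\mathcal D)=\min_i|Z_i|$, and let $\operatorname{sdepth}_S(M)$ be the maximum of $\operatorname{sdepth}(\mathcal D)$ over all Stanley decompositions of $M$. The depth $\operatorname{depth}_S(M)$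 is taken with respect to the ideal $(x_1,\ldots,x_n)$. Both invariants are considered only for nonzero modules; monomial ideals in the assertions are nonzero and proper. *)

(* Defs.v *)
From HB Require Import structures.
From mathcomp Require Import all_boot all_order all_algebra.
From mathcomp Require Import boolp mpoly.

Set Implicit Arguments.
Unset Strict Implicit.
Unset Printing Implicit Defensive.

Import GRing.Theory.
Local Open Scope ring_scope.

(* The maximum of a set of natural numbers; the junk value 0 is used only if
   the set is empty or unbounded. *)
Definition is_nat_max (P : nat -> Prop) (d : nat) : Prop :=
  P d /\ forall e, P e -> (e <= d)%N.

Definition nat_max (P : nat -> Prop) : nat :=
  if pselect (exists d, is_nat_max P d) is left exP then projT1 (cid exP)
  else 0%N.

Lemma nat_maxP (P : nat -> Prop) (d : nat) : is_nat_max P d -> nat_max P = d.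
Proof.
move=> [Pd le_d]; rewrite /nat_max; case: pselect => [exP|]; last first.
  by case; exists d.
case: (cid exP) => e [/= Pe le_e].
by apply/eqP; rewrite eqn_leq le_d // le_e.
Qed.

Section SubQuotientModules.
Variables (R : nzRingType) (M : lmodType R).

Definition submod (N : submodClosed M) : Type := {x : M | x \in N}.

HB.instance Definition _ (N : submodClosed M) := SubChoice.on (submod N).
HB.instance Definition _ (N : submodClosed M) :=
  [SubChoice_isSubLmodule of submod N by <:].

Section Quotient.
Local Open Scope quotient_scope.
Variable N : submodClosed M.

Definition submod_pred : {pred M} := fun x => x \in N.

Fact submod_zmod_closed : zmod_closed submod_pred.
Proof.
split=> [|x y xN yN]; rewrite unfold_in /submod_pred; first exact: rpred0.
by rewrite rpredD // -scaleN1r rpredZ.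
Qed.

HB.instance Definition _ :=
  GRing.isZmodClosed.Build M submod_pred submod_zmod_closed.

(* submodClosed does not inherit from zmodClosed, which Quotient.quot expects *)
Definition submod_zmod : zmodClosed M := submod_pred.

(* The underlying additive group is mathcomp's quotient of M by N. *)
Definition quotmod : Type := Quotient.quot submod_zmod.

HB.instance Definition _ := GRing.Zmodule.on quotmod.

Definition quotmod_pi (x : M) : quotmod := \pi_(Quotient.quot submod_zmod) x.

Definition quotmod_scale (a : R) (q : quotmod) : quotmod :=
  quotmod_pi (a *: repr (q : Quotient.quot submod_zmod)).

Lemma quotmod_piP (x y : M) : quotmod_pi x = quotmod_pi y <-> x - y \in N.
Proof.
change (x - y \in N) with (x - y \in submod_zmod); rewrite Quotient.idealrBE.
by split=> [xy|/eqP //]; apply/eqP.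
Qed.

Lemma quotmod_reprK (q : quotmod) :
  quotmod_pi (repr (q : Quotient.quot submod_zmod)) = q.
Proof. exact: reprK. Qed.

Lemma quotmod_piD (x y : M) :
  quotmod_pi (x + y) = quotmod_pi x + quotmod_pi y.
Proof. exact: (@Quotient.pi_add M submod_zmod). Qed.

Lemma quotmod_pi0 : quotmod_pi 0 = 0.
Proof.
by apply: (addrI (quotmod_pi 0)); rewrite -quotmod_piD !addr0.
Qed.

Lemma quotmod_piZ (a : R) (x : M) :
  quotmod_pi (a *: x) = quotmod_scale a (quotmod_pi x).
Proof.
apply/quotmod_piP; rewrite -scalerBr rpredZ //.
by apply/quotmod_piP; rewrite quotmod_reprK.
Qed.

Lemma quotmod_scaleA a b q :
  quotmod_scale a (quotmod_scale b q) = quotmod_scale (a * b) q.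
Proof. by rewrite -[q]quotmod_reprK -!quotmod_piZ scalerA. Qed.

Lemma quotmod_scale1 : left_id 1 quotmod_scale.
Proof. by move=> q; rewrite -[q]quotmod_reprK -!quotmod_piZ scale1r. Qed.

Lemma quotmod_scaleDr : right_distributive quotmod_scale +%R.
Proof.
move=> a p q; rewrite -[q]quotmod_reprK -[p]quotmod_reprK -quotmod_piD.
by rewrite -!quotmod_piZ -quotmod_piD scalerDr.
Qed.

Lemma quotmod_scaleDl q : {morph quotmod_scale^~ q : a b / a + b}.
Proof.
by move=> a b; rewrite -[q]quotmod_reprK -!quotmod_piZ -quotmod_piD scalerDl.
Qed.

HB.instance Definition _ := GRing.Zmodule_isLmodule.Build R quotmod
  quotmod_scaleA quotmod_scale1 quotmod_scaleDr quotmod_scaleDl.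

Lemma quotmod_piZE (a : R) (x : M) : quotmod_pi (a *: x) = a *: quotmod_pi x.
Proof. exact: quotmod_piZ. Qed.

End Quotient.

(* N, or rather its intersection with U, as a submodule of U. *)
Section Restriction.
Variables U N : submodClosed M.

Definition res_pred : {pred submod U} := fun x => val x \in N.

Fact res_submod_closed : submod_closed res_pred.
Proof.
split=> [|a x y xN yN]; rewrite unfold_in /res_pred.
  by rewrite raddf0 rpred0.
by rewrite linearP rpredD ?rpredZ.
Qed.

HB.instance Definition _ :=
  GRing.isSubmodClosed.Build R (submod U) res_pred res_submod_closed.

Definition res_submod : submodClosed (submod U) := res_pred.

End Restriction.

End SubQuotientModules.

Section Depth.
Variables (n : nat) (K : fieldType) (M : lmodType {mpoly K[n]}).
Implicit Type fs : seq {mpoly K[n]}.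

(* x belongs to the submodule (f_1, ..., f_r) M *)
Definition in_ideal_mul fs (x : M) : Prop :=
  exists y : nat -> M, x = \sum_(i < size fs) fs`_i *: y i.

Definition regular_seq fs : Prop :=
  (forall k, (k < size fs)%N -> forall x : M,
     in_ideal_mul (take k fs) (fs`_k *: x) -> in_ideal_mul (take k fs) x)
  /\ exists x : M, ~ in_ideal_mul fs x.

Definition in_irrelevant (p : {mpoly K[n]}) : Prop :=
  exists q : 'I_n -> {mpoly K[n]}, p = \sum_i q i * 'X_i.

Definition depth : nat := nat_max (fun d => exists fs,
  [/\ forall f, f \in fs -> in_irrelevant f, regular_seq fs & size fs = d]).

End Depth.

Definition mdegZ (n : nat) (m : 'X_{1..n}) : 'rV[int]_n := \row_i (m i)%:Z.

Record Zn_grading (n : nat) (K : fieldType) (M : lmodType {mpoly K[n]}) :=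
  ZnGrading {
    hcomp : 'rV[int]_n -> M -> Prop;
    hcomp0 : forall a, hcomp a 0;
    hcompP : forall a (c : K) x y,
      hcomp a x -> hcomp a y -> hcomp a (c%:MP *: x + y);
    hcompX : forall a m x, hcomp a x -> hcomp (a + mdegZ m) ('X_[m] *: x);
    hcomp_sum : forall x, exists (s : seq 'rV[int]_n) (y : 'rV[int]_n -> M),
      [/\ uniq s, forall a, hcomp a (y a) & x = \sum_(a <- s) y a];
    hcomp_direct : forall (s : seq 'rV[int]_n) (y : 'rV[int]_n -> M),
      uniq s -> (forall a, hcomp a (y a)) -> \sum_(a <- s) y a = 0 ->
      forall a, a \in s -> y a = 0
  }.

Section StanleyDepth.
Variables (n : nat) (K : fieldType) (M : lmodType {mpoly K[n]}).
Variable G : Zn_grading M.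

Definition homogeneous (x : M) : Prop := exists a, hcomp G a x.

Definition in_vars (Z : {set 'I_n}) (p : {mpoly K[n]}) : Prop :=
  forall m, m \in msupp p -> forall i, i \notin Z -> m i = 0%N.

Definition in_stanley_space (m : M) (Z : {set 'I_n}) (x : M) : Prop :=
  exists2 p, in_vars Z p & x = p *: m.

Definition stanley_decomposition (t : nat) (m : 'I_t -> M)
    (Z : 'I_t -> {set 'I_n}) : Prop :=
  [/\ forall i, homogeneous (m i),
      forall i p, in_vars (Z i) p -> p *: m i = 0 -> p = 0,
      forall x, exists y : 'I_t -> M,
        (forall i, in_stanley_space (m i) (Z i) (y i)) /\ x = \sum_i y i
    & forall y : 'I_t -> M,
        (forall i, in_stanley_space (m i) (Z i) (y i)) -> \sum_i y i = 0 ->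
        forall i, y i = 0].

(* Each #|Z i| is at most n, so the value of the empty minimum is immaterial
   unless t = 0, which happens only for the zero module. *)
Definition sdepth_dec (t : nat) (Z : 'I_t -> {set 'I_n}) : nat :=
  \big[minn/n]_(i < t) #|Z i|.

Definition sdepth : nat := nat_max (fun d =>
  exists (t : nat) (m : 'I_t -> M) (Z : 'I_t -> {set 'I_n}),
    stanley_decomposition m Z /\ sdepth_dec Z = d).

End StanleyDepth.

Section InducedGradings.
Variables (n : nat) (K : fieldType) (M : lmodType {mpoly K[n]}).
Variable G : Zn_grading M.

Definition graded_submod (N : submodClosed M) : Prop :=
  forall (s : seq 'rV[int]_n) (y : 'rV[int]_n -> M), uniq s ->
    (forall a, hcomp G a (y a)) -> \sum_(a <- s) y a \in N ->
    forall a, a \in s -> y a \in N.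

Variable N : submodClosed M.
Hypothesis gradedN : graded_submod N.

Definition sub_hcomp (a : 'rV[int]_n) (x : submod N) : Prop :=
  hcomp G a (val x).

Definition quot_hcomp (a : 'rV[int]_n) (q : quotmod N) : Prop :=
  exists2 x, hcomp G a x & q = quotmod_pi N x.

Fact sub_hcomp0 a : sub_hcomp a 0.
Proof. by rewrite /sub_hcomp raddf0; apply: hcomp0. Qed.

Fact sub_hcompP a (c : K) x y :
  sub_hcomp a x -> sub_hcomp a y -> sub_hcomp a (c%:MP *: x + y).
Proof. by move=> ax ay; rewrite /sub_hcomp linearP; apply: hcompP. Qed.

Fact sub_hcompX a m x : sub_hcomp a x -> sub_hcomp (a + mdegZ m) ('X_[m] *: x).
Proof. by move=> ax; rewrite /sub_hcomp linearZ; apply: hcompX. Qed.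

Fact sub_hcomp_sum x : exists (s : seq 'rV[int]_n) (y : 'rV[int]_n -> submod N),
  [/\ uniq s, forall a, sub_hcomp a (y a) & x = \sum_(a <- s) y a].
Proof.
have [s [y [us ay def_x]]] := hcomp_sum G (val x).
have yN a : a \in s -> y a \in N.
  by apply: gradedN => //; rewrite -def_x; apply: valP.
exists s, (fun a => insubd 0 (y a)).
have val_y a : val (insubd (0 : submod N) (y a)) =
               if y a \in N then y a else 0.
  by rewrite val_insubd; case: ifP => // _; rewrite raddf0.
split=> // [a|]; first by rewrite /sub_hcomp val_y; case: ifP => // _; apply: hcomp0.
apply: val_inj; rewrite raddf_sum def_x /=.
by apply: eq_big_seq => a /yN ya; rewrite val_y ya.
Qed.

Fact sub_hcomp_direct (s : seq 'rV[int]_n) (y : 'rV[int]_n -> submod N) :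
  uniq s -> (forall a, sub_hcomp a (y a)) -> \sum_(a <- s) y a = 0 ->
  forall a, a \in s -> y a = 0.
Proof.
move=> us ay sum0 a sa; apply: val_inj; rewrite raddf0.
apply: (hcomp_direct (z := G) (y := fun a => val (y a)) us) => //.
by rewrite -raddf_sum sum0 raddf0.
Qed.

Definition sub_grading : Zn_grading (submod N) :=
  ZnGrading sub_hcomp0 sub_hcompP sub_hcompX sub_hcomp_sum sub_hcomp_direct.

Fact quot_hcomp0 a : quot_hcomp a 0.
Proof. by exists 0; [apply: hcomp0 | rewrite quotmod_pi0]. Qed.

Fact quot_hcompP a (c : K) x y :
  quot_hcomp a x -> quot_hcomp a y -> quot_hcomp a (c%:MP *: x + y).
Proof.
move=> [x' ax ->] [y' ay ->]; exists (c%:MP *: x' + y'); first exact: hcompP.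
by rewrite quotmod_piD quotmod_piZE.
Qed.

Fact quot_hcompX a m x :
  quot_hcomp a x -> quot_hcomp (a + mdegZ m) ('X_[m] *: x).
Proof.
move=> [x' ax ->]; exists ('X_[m] *: x'); first exact: hcompX.
by rewrite quotmod_piZE.
Qed.

Lemma quotmod_pi_sum (I : Type) (s : seq I) (y : I -> M) :
  quotmod_pi N (\sum_(a <- s) y a) = \sum_(a <- s) quotmod_pi N (y a).
Proof. exact: (big_morph _ (@quotmod_piD _ _ N) (quotmod_pi0 N)). Qed.

Fact quot_hcomp_sum x : exists (s : seq 'rV[int]_n) (y : 'rV[int]_n -> quotmod N),
  [/\ uniq s, forall a, quot_hcomp a (y a) & x = \sum_(a <- s) y a].
Proof.
have [s [y [us ay def_x]]] := hcomp_sum G (repr (x : Quotient.quot (submod_zmod N))).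
exists s, (fun a => quotmod_pi N (y a)); split=> // [a|]; first by exists (y a).
by rewrite -quotmod_pi_sum -def_x quotmod_reprK.
Qed.

Fact quot_hcomp_direct (s : seq 'rV[int]_n) (y : 'rV[int]_n -> quotmod N) :
  uniq s -> (forall a, quot_hcomp a (y a)) -> \sum_(a <- s) y a = 0 ->
  forall a, a \in s -> y a = 0.
Proof.
move=> us ay sum0 a sa.
have /choice [z zP] : forall b, exists x, hcomp G b x /\ y b = quotmod_pi N x.
  by move=> b; have [x bx ->] := ay b; exists x.
have [_ ->] := zP a.
rewrite -(quotmod_pi0 N); apply/quotmod_piP; rewrite subr0.
apply: (gradedN us) sa => [b|]; first by have [] := zP b.
rewrite -[\sum_(_ <- _) _]subr0; apply/quotmod_piP.
rewrite quotmod_pi_sum quotmod_pi0; apply: etrans sum0.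
by apply: eq_bigr => b _; have [_ ->] := zP b.
Qed.

Definition quot_grading : Zn_grading (quotmod N) :=
  ZnGrading quot_hcomp0 quot_hcompP quot_hcompX quot_hcomp_sum
    quot_hcomp_direct.

End InducedGradings.

Section RegularGrading.
Variables (n : nat) (K : fieldType).
Local Notation S := {mpoly K[n]}.

Definition poly_hcomp (a : 'rV[int]_n) (p : S^o) : Prop :=
  forall m, m \in msupp (p : S) -> mdegZ m = a.

Lemma mdegZ_inj : injective (@mdegZ n).
Proof.
move=> m1 m2 /rowP eq_m; apply/mnmP=> i.
by have := eq_m i; rewrite !mxE => -[].
Qed.

Lemma mdegZD (m1 m2 : 'X_{1..n}) : mdegZ (m1 + m2)%MM = mdegZ m1 + mdegZ m2.
Proof. by apply/rowP=> i; rewrite !mxE mnmDE. Qed.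

Lemma poly_hcomp_coeff a (p : S) :
  poly_hcomp a p <-> forall m, mdegZ m != a -> p@_m = 0.
Proof.
split=> [ap m ne_a|ap m].
  by apply: memN_msupp_eq0; apply: contra ne_a => /ap ->.
by rewrite mcoeff_msupp => nz; apply/eqP; apply: contraNT nz => /ap ->.
Qed.

Fact poly_hcomp0 a : poly_hcomp a 0.
Proof. by move=> m; rewrite msupp0. Qed.

Fact poly_hcompP a (c : K) (x y : S^o) :
  poly_hcomp a x -> poly_hcomp a y -> poly_hcomp a (c%:MP *: x + y).
Proof.
move=> /poly_hcomp_coeff ax /poly_hcomp_coeff ay; apply/poly_hcomp_coeff => m ne_a.
by rewrite mcoeffD [c%:MP *: x]/(c%:MP * x) mcoeffCM ax // ay // mulr0 addr0.
Qed.

Fact poly_hcompX a m (x : S^o) :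
  poly_hcomp a x -> poly_hcomp (a + mdegZ m) ('X_[m] *: x).
Proof.
move=> ax m'; have -> : 'X_[m] *: x = (x : S) * 'X_[m] by rewrite mulrC.
by rewrite (perm_mem (msuppMX _ _)) => /mapP[u /ax <- ->]; rewrite mdegZD addrC.
Qed.

Fact poly_hcomp_sum (x : S^o) :
  exists (s : seq 'rV[int]_n) (y : 'rV[int]_n -> S^o),
  [/\ uniq s, forall a, poly_hcomp a (y a) & x = \sum_(a <- s) y a].
Proof.
pose y a : S := \sum_(m <- msupp (x : S) | mdegZ m == a) (x : S)@_m *: 'X_[m].
exists (map (@mdegZ n) (msupp (x : S))), y; split=> [|a|].
- by rewrite map_inj_uniq ?msupp_uniq //; apply: mdegZ_inj.
- apply/poly_hcomp_coeff => m ne_a; rewrite /y raddf_sum big1 //= => u /eqP ua.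
  rewrite mcoeffZ mcoeffX; case: eqP => [um|]; last by rewrite mulr0.
  by rewrite -um ua eqxx in ne_a.
- rewrite big_map [LHS](mpolyE (x : S)); apply: eq_big_seq => m mx.
  rewrite /y (eq_bigl (fun u => u == m)); last first.
    by move=> u; rewrite (inj_eq mdegZ_inj).
  by rewrite -big_filter filter_pred1_uniq ?msupp_uniq // big_seq1.
Qed.

Lemma mcoeff_hsum (s : seq 'rV[int]_n) (y : 'rV[int]_n -> S) m :
  uniq s -> (forall a, poly_hcomp a (y a)) -> mdegZ m \in s ->
  (\sum_(a <- s) y a)@_m = (y (mdegZ m))@_m.
Proof.
move=> us ay sm; rewrite raddf_sum (bigD1_seq _ sm us) /= big1 ?addr0 // => b ne.
by have /poly_hcomp_coeff -> := ay b; rewrite // eq_sym.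
Qed.

Fact poly_hcomp_direct (s : seq 'rV[int]_n) (y : 'rV[int]_n -> S^o) :
  uniq s -> (forall a, poly_hcomp a (y a)) -> \sum_(a <- s) y a = 0 ->
  forall a, a \in s -> y a = 0.
Proof.
move=> us ay sum0 a sa; apply/mpolyP=> m; rewrite mcoeff0.
have [ma|ne_a] := eqVneq (mdegZ m) a; last by have /poly_hcomp_coeff -> := ay a.
by rewrite -ma -(mcoeff_hsum us ay) ?ma // sum0 mcoeff0.
Qed.

Definition poly_grading : Zn_grading (S^o : lmodType S) :=
  ZnGrading poly_hcomp0 poly_hcompP poly_hcompX poly_hcomp_sum
    poly_hcomp_direct.

End RegularGrading.

Section MonomialIdeals.
Variables (n : nat) (K : fieldType).
Local Notation S := {mpoly K[n]}.

(* Ideals of S are the submodules of the regular module S^o. *)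
Definition generated_by_monomials (I : submodClosed (S^o : lmodType S)) : Prop :=
  exists A : 'X_{1..n} -> Prop, forall p : S, p \in I <->
    exists s : seq (S * 'X_{1..n}),
      (forall t, t \in s -> A t.2) /\ p = \sum_(t <- s) t.1 * 'X_[t.2].

Record monomial_ideal := MonomialIdeal {
  ideal_of :> submodClosed (S^o : lmodType S);
  ideal_monomial : generated_by_monomials ideal_of
}.

Implicit Types I J : monomial_ideal.

Definition ideal_nonzero I : Prop := exists2 p : S, p \in ideal_of I & p != 0.
Definition ideal_proper I : Prop := (1 : S) \notin ideal_of I.

Lemma ideal_sum_gens I (A : 'X_{1..n} -> Prop) (s : seq (S * 'X_{1..n})) :
  (forall m, A m -> ('X_[m] : S) \in ideal_of I) ->
  (forall t, t \in s -> A t.2) ->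
  (\sum_(t <- s) t.1 * 'X_[t.2] : S) \in ideal_of I.
Proof.
move=> AI sA; rewrite big_seq; apply: rpred_sum => t /sA /AI.
exact: (@rpredZ _ (S^o : lmodType S) (ideal_of I) t.1).
Qed.

Lemma msupp_monomial_ideal I (p : S) m :
  p \in ideal_of I -> m \in msupp p -> ('X_[m] : S) \in ideal_of I.
Proof.
have [A AP] := ideal_monomial I.
have AI u : A u -> ('X_[u] : S) \in ideal_of I.
  move=> Au; apply/AP; exists [:: (1, u)]; rewrite big_seq1 mul1r.
  by split=> // t; rewrite inE => /eqP ->.
move=> /AP [s [sA ->]]; rewrite mcoeff_msupp => nz.
have /hasP [t st] : has (fun t => (t.1 * 'X_[t.2])@_m != 0) s.
  apply: contraNT nz => /hasPn s0; rewrite raddf_sum big_seq big1 // => t /s0.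
  by rewrite negbK => /eqP.
rewrite -mcoeff_msupp (perm_mem (msuppMX _ _)) => /mapP[u _ ->].
rewrite mpolyXD mulrC.
exact: (@rpredZ _ (S^o : lmodType S) (ideal_of I) 'X_[u] _ (AI _ (sA _ st))).
Qed.

Lemma monomial_ideal_graded I : graded_submod (poly_grading n K) (ideal_of I).
Proof.
move=> s y us ay sumI a sa; rewrite [y a](mpolyE (y a : S)) big_seq.
apply: rpred_sum => m my.
have ma : mdegZ m = a := ay a m my.
have: ('X_[m] : S) \in ideal_of I.
  apply: msupp_monomial_ideal sumI _.
  by rewrite mcoeff_msupp (mcoeff_hsum us ay) ?ma // -mcoeff_msupp.
rewrite -mul_mpolyC.
exact: (@rpredZ _ (S^o : lmodType S) (ideal_of I) _%:MP).
Qed.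

Definition min_monomial_gen I (u : 'X_{1..n}) : Prop :=
  ('X_[u] : S) \in ideal_of I /\
  forall v : 'X_{1..n}, ('X_[v] : S) \in ideal_of I -> (v <= u)%MM -> v = u.

Definition mnm_supp (u : 'X_{1..n}) : {set 'I_n} := [set i | (0 < u i)%N].

Definition ideal_supp I : {set 'I_n} :=
  [set i | `[< exists2 u, min_monomial_gen I u & i \in mnm_supp u >]].

Section Sum.
Variables I J : monomial_ideal.

Definition sum_pred : {pred (S^o : lmodType S)} := fun p =>
  `[< exists q r : S^o, [/\ q \in ideal_of I, r \in ideal_of J & p = q + r] >].

Fact sum_submod_closed : submod_closed sum_pred.
Proof.
split=> [|a x y /asboolP[q [r [qI rJ ->]]] /asboolP[q' [r' [qI' rJ' ->]]]].
  by apply/asboolP; exists 0, 0; rewrite !rpred0 addr0.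
apply/asboolP; exists (a *: q + q'), (a *: r + r').
by rewrite !rpredD ?rpredZ // scalerDr addrACA.
Qed.

HB.instance Definition _ :=
  GRing.isSubmodClosed.Build S (S^o : lmodType S) sum_pred sum_submod_closed.

Fact sum_monomial : generated_by_monomials sum_pred.
Proof.
have [A AP] := ideal_monomial I; have [B BP] := ideal_monomial J.
exists (fun m => A m \/ B m) => p; split.
  move=> /asboolP[q [r [/AP [s [sA ->]] /BP [t [tB ->]] ->]]].
  exists (s ++ t); rewrite big_cat; split=> // u.
  by rewrite mem_cat => /orP[/sA|/tB]; [left|right].
move=> [s [sAB ->]]; rewrite big_seq.
apply: (@rpred_sum _ sum_pred) => t /sAB ABt; apply/asboolP.
case: ABt => [At|Bt]; [exists (t.1 * 'X_[t.2]), 0 | exists 0, (t.1 * 'X_[t.2])];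
  rewrite rpred0 ?add0r ?addr0; split=> //; [apply/AP | apply/BP];
  by exists [:: t]; rewrite big_seq1; split=> // u; rewrite inE => /eqP ->.
Qed.

Definition ideal_sum : monomial_ideal :=
  @MonomialIdeal (sum_pred : submodClosed (S^o : lmodType S)) sum_monomial.

End Sum.

Definition quot_ideal I : lmodType S := quotmod (ideal_of I).
Definition quot_ideal_grading I : Zn_grading (quot_ideal I) :=
  quot_grading (@monomial_ideal_graded I).

Definition ideal_mod I : lmodType S := submod (ideal_of I).
Definition ideal_mod_grading I : Zn_grading (ideal_mod I) :=
  sub_grading (@monomial_ideal_graded I).

Fact sum_quot_graded I J :
  graded_submod (ideal_mod_grading (ideal_sum I J))
    (res_submod (ideal_of (ideal_sum I J)) (ideal_of I)).
Proof.
move=> s y us ay sumI a sa.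
apply: (monomial_ideal_graded (y := fun a => val (y a)) us ay) sa.
by rewrite -raddf_sum.
Qed.

Definition sum_quot I J : lmodType S :=
  quotmod (res_submod (ideal_of (ideal_sum I J)) (ideal_of I)).
Definition sum_quot_grading I J : Zn_grading (sum_quot I J) :=
  quot_grading (@sum_quot_graded I J).

End MonomialIdeals.

(* Main.v *)
Require Import Defs.
From HB Require Import structures.
From mathcomp Require Import all_boot all_order all_algebra.
From mathcomp Require Import boolp mpoly zify ring.

(** Everything is reduced to combinatorics of monomials. The modules [S/I], [J]
    and [(I + J)/I] are quotients [U/V] of ideals spanned by up-sets [V <= U] of
    monomials; such a quotient has at most one monomial in each degree, so its
    Stanley decompositions are the partitions of [U \ V] into finitely many cones
    [u K[Z]] ([sdepth_presents]).

    When the supports of [I] and [J] are disjoint, split the variables as [A + B]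
    with [I] in [K[A]] and [J] in [K[B]]. Then [(I + J)/I] is the tensor product
    over [K] of [M = K[A]/I] and [N = J]. Depth is additive for such tensor
    products ([tensor_depth]). Stanley depth is superadditive
    ([has_sdepth_tensor]), and for a free factor [K[B]] it grows by exactly [#|B|]
    because a decomposition can be restricted to the slice of a fixed degree in
    [B] ([has_sdepth_slice]).

    The inequalities imply the second assertion: if [sdepth = depth] for the tensor
    product, then [sdepth M + sdepth N <= depth M + depth N], while each summand on
    the left is at least the one on the right; so [sdepth M = depth M], and this is
    not changed by adding the variables [B].

    Conversely, let [M] (a quotient [S/I] or an ideal) have [sdepth M < depth M].
    Tensor it with a module [N] over the polynomial ring [K[T]] in a fixed set [T]
    of new variables: if [M = S/I], the ideal [(Q)] of a subset [Q] of [T]; if [M] is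
    an ideal, the ring [K[T]/(P)(Q)] for disjoint subsets [P] and [Q] of [T]. Adding
    a variable to [Q] or [P] lowers the depth of [N] by exactly one
    ([depth_variables_ideal], [depth_product_of_variables]), and it cannot raise the
    Stanley depth of the tensor product ([has_sdepth_cylinder]). For singletons the
    Stanley depth is at most the depth; when all of [T] is used it exceeds the depth,
    since the Stanley depth of the ideal of all variables is unbounded
    ([has_sdepth_all_variables]). As the difference moves up by at most one at a
    time, equality occurs on the way, and there the second assertion yields
    [sdepth M >= depth M], a contradiction ([assertion_transfer]).

    The theory of depth needed is the existence of a regular sequence leaving a
    socle element, and that its length is then the depth. Both follow from prime
    avoidance: if no nonzero element of [U/V] is killed by all variables, some element of
    the irrelevant ideal is a nonzerodivisor, even on finitely many quotients at
    once ([common_nonzerodivisor]). Rees's theorem ([regular_size_le]) then follows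
    by exchanging elements. The ascending chain condition comes from Dickson's
    lemma through leading monomials ([ideal_maximal]). *)


Set Implicit Arguments.
Unset Strict Implicit.
Unset Printing Implicit Defensive.

Import Order.TTheory GRing.Theory.
Local Open Scope ring_scope.

(** * Dickson's lemma and maximal up-sets *)

Lemma nat_nondecreasing_subseq (f : nat -> nat) :
  exists2 phi : nat -> nat, (forall i j, (i < j)%N -> (phi i < phi j)%N) &
    forall i j, (i <= j)%N -> (f (phi i) <= f (phi j))%N.
Proof.
have /choice [c cP] : forall N, exists k, (N <= k)%N /\
    forall j, (N <= j)%N -> (f k <= f j)%N.
  move=> N.
  have exv : exists v, `[< exists k, (N <= k)%N /\ f k = v >].
    by exists (f N); apply/asboolP; exists N.
  case: (ex_minnP exv) => v /asboolP[k [Nk <-]] min_v; exists k; split=> // j Nj.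
  by apply: min_v; apply/asboolP; exists j.
pose phi := fix phi i := if i is i'.+1 then c (phi i').+1 else c 0%N.
have phiS i : (phi i < phi i.+1)%N by have [] := cP (phi i).+1.
have phi_lt i j : (i < j)%N -> (phi i < phi j)%N.
  elim: j => // j IHj; rewrite ltnS leq_eqVlt => /orP[/eqP ->|/IHj] //.
  by move/ltn_trans; apply.
exists phi => // i j; rewrite leq_eqVlt => /orP[/eqP -> //|ij].
have phij := phi_lt _ _ ij; case: i {ij} phij => [|i] phij.
  by have [_] := cP 0%N; apply.
by have [_] := cP (phi i).+1; apply; rewrite (leq_trans (phiS _)) // ltnW.
Qed.

(** Thin the sequence out until each exponent in turn is nondecreasing. *)
Lemma dickson n (u : nat -> 'X_{1..n}) : exists i j, (i < j)%N /\ (u i <= u j)%MM.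
Proof.
have thin k : exists2 phi : nat -> nat,
    (forall i j, (i < j)%N -> (phi i < phi j)%N) &
    forall l : 'I_n, (l < k)%N -> forall i j, (i <= j)%N ->
      (u (phi i) l <= u (phi j) l)%N.
  elim: k => [|k [phi phi_lt mono]]; first by exists id.
  have [lt_kn|le_nk] := ltnP k n; last first.
    exists phi => // l _; apply: mono; exact: leq_trans (ltn_ord l) le_nk.
  have [psi psi_lt mono'] :=
    nat_nondecreasing_subseq (fun i => u (phi i) (Ordinal lt_kn)).
  exists (phi \o psi) => [i j /psi_lt /phi_lt //|l].
  rewrite ltnS leq_eqVlt => /orP[/eqP lk|lt_lk] i j ij /=.
    by have -> : l = Ordinal lt_kn by [apply: val_inj]; apply: mono'.
  apply: mono => //; move: ij; rewrite leq_eqVlt => /orP[/eqP -> //|/psi_lt].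
  exact: ltnW.
have [phi phi_lt mono] := thin n; exists (phi 0%N), (phi 1%N).
by split; [apply: phi_lt | apply/mnm_lepP => l; apply: mono].
Qed.

Definition upset n (U : 'X_{1..n} -> Prop) : Prop :=
  forall u v, (u <= v)%MM -> U u -> U v.

(** Noetherianity of monomials: a family without maximal element would provide a
    strictly increasing chain, hence a sequence of monomials contradicting
    Dickson's lemma. *)
Lemma upset_maximal n (F : ('X_{1..n} -> Prop) -> Prop) :
  (forall U, F U -> upset U) -> (exists U, F U) ->
  exists2 U, F U & forall U', F U' -> (forall m, U m -> U' m) ->
    forall m, U' m -> U m.
Proof.
move=> upF [U0 FU0]; apply: contrapT => nomax.
have /choice [nxt nxtP] : forall U : {U | F U}, exists W : {U | F U} * 'X_{1..n},
    [/\ forall m, sval U m -> sval W.1 m, sval W.1 W.2 & ~ sval U W.2].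
  move=> [U FU]; apply: contrapT => noW; apply: nomax; exists U => // U' FU' UU' m U'm.
  apply: contrapT => nUm; apply: noW.
  by exists (exist _ U' FU', m); split.
pose C := fix C i := if i is i'.+1 then (nxt (C i')).1 else exist _ U0 FU0.
pose u i := (nxt (C i)).2.
have Cmono i j : (i <= j)%N -> forall m, sval (C i) m -> sval (C j) m.
  elim: j => [|j IHj]; first by rewrite leqn0 => /eqP ->.
  rewrite leq_eqVlt => /orP[/eqP -> //|/IHj ij] m /ij.
  by have [+ _ _] := nxtP (C j); apply.
have [i [j [ij uij]]] := dickson u.
have [_ Cu _] := nxtP (C i); have [_ _] := nxtP (C j); apply.
apply: (Cmono _ _ ij); exact: (upF _ (svalP (C i.+1)) _ _ uij).
Qed.

(** The largest degree in a finite generating set can serve as [N]. *)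
Lemma upset_bounded n (U : 'X_{1..n} -> Prop) : upset U ->
  exists N, forall u, U u -> U [multinom minn (u i) N | i < n].
Proof.
move=> upU.
pose gen (l : seq 'X_{1..n}) m := exists2 u, u \in l & (u <= m)%MM.
have [_ [l [lU ->]] maxl] : exists2 V, (exists l : seq 'X_{1..n},
      (forall u, u \in l -> U u) /\ V = gen l) &
    forall V', (exists l : seq 'X_{1..n}, (forall u, u \in l -> U u) /\ V' = gen l) ->
      (forall m, V m -> V' m) -> forall m, V' m -> V m.
  apply: upset_maximal => [V [l [_ ->]] u v uv [w wl wu]|].
    by exists w => //; apply: lepm_trans uv.
  by exists (gen [::]), [::].
exists (\max_(u <- l) mdeg u)%N => u Uu.
have [w wl wu] : gen l u.
  apply: (maxl (gen (u :: l))).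
  - exists (u :: l); split=> // v; rewrite inE => /predU1P[->//|]; exact: lU.
  - by move=> m [w wl wm]; exists w => //; rewrite inE wl orbT.
  - by exists u; rewrite ?mem_head ?lepm_refl.
apply: upU (lU _ wl); apply/mnm_lepP => i; rewrite mnmE leq_min.
rewrite (mnm_lepP wu) /=; apply: leq_trans (leq_bigmax_seq _ wl isT).
by rewrite mdegE (bigD1 i) //= leq_addr.
Qed.

(** * Leading monomials: normal forms and the ascending chain condition *)

Section Leading.
Variables (n : nat) (K : fieldType).
Local Notation S := {mpoly K[n]}.
Implicit Types (A B W : S -> Prop) (p q r s : S).

Definition subspace W : Prop :=
  [/\ W 0, forall p q, W p -> W q -> W (p + q)
    & forall (c : K) p, W p -> W (c *: p)].

Definition ideal A : Prop :=
  [/\ A 0, forall p q, A p -> A q -> A (p + q) & forall s p, A p -> A (s * p)].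

Lemma ideal_subspace A : ideal A -> subspace A.
Proof.
by move=> [A0 AD AM]; split=> // c p Ap; rewrite -mul_mpolyC; apply: AM.
Qed.

Lemma subspaceN W p : subspace W -> W p -> W (- p).
Proof. by move=> [_ _ WZ] Wp; rewrite -scaleN1r; apply: WZ. Qed.

Lemma subspaceB W p q : subspace W -> W p -> W q -> W (p - q).
Proof.
by move=> sW Wp Wq; have [_ WD _] := sW; apply: WD => //; apply: subspaceN.
Qed.

Lemma subspace_sum W (I : eqType) (l : seq I) (F : I -> S) : subspace W ->
  (forall i, i \in l -> W (F i)) -> W (\sum_(i <- l) F i).
Proof.
move=> [W0 WD _] WF; rewrite big_seq; elim/big_rec: _ => // i x il Wx.
by apply: WD => //; apply: WF.
Qed.

Lemma idealN A p : ideal A -> A p -> A (- p).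
Proof. by move=> iA; apply: subspaceN; apply: ideal_subspace. Qed.

Lemma idealB A p q : ideal A -> A p -> A q -> A (p - q).
Proof. by move=> iA; apply: subspaceB; apply: ideal_subspace. Qed.

Definition is_lead W m : Prop := exists w, [/\ W w, w != 0 & mlead w = m].

Lemma mlead_cancel p q :
  p != 0 -> q != 0 -> mlead p = mlead q ->
  let r := p - (mleadc p / mleadc q) *: q in r != 0 -> (mlead r < mlead p)%O.
Proof.
move=> nz_p nz_q eq_lead r nz_r; rewrite lt_neqAle; apply/andP; split.
  apply: contra nz_r => /eqP lead_r; rewrite -mleadc_eq0 lead_r mcoeffB mcoeffZ.
  by rewrite eq_lead divfK ?subrr // mleadc_eq0.
apply: le_trans (mleadB_le _ _) _; rewrite leUx lexx /= eq_lead.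
exact: mleadZ_le.
Qed.

(** Induction on the leading monomial in which 0 is the base case, although
    [mlead 0] is not below the leading monomial of a constant. *)
Lemma mlead_ind (P : S -> Prop) :
  P 0 ->
  (forall p, p != 0 ->
    (forall q, (q != 0 -> (mlead q < mlead p)%O) -> P q) -> P p) ->
  forall p, P p.
Proof.
move=> P0 IH; apply: mleadrect => p IHp.
have [-> //|nz_p] := eqVneq p 0; apply: IH => // q lt_qp.
by have [-> //|/lt_qp] := eqVneq q 0; apply: IHp.
Qed.

Lemma lead_incl_eq A B : subspace A -> subspace B ->
  (forall p, A p -> B p) -> (forall m, is_lead B m -> is_lead A m) ->
  forall p, B p -> A p.
Proof.
move=> sA sB AB lead_BA; apply: mlead_ind => [_|p nz_p IH Bp]; first by case: sA.
have [a [Aa nz_a lead_a]] : is_lead A (mlead p) by apply: lead_BA; exists p.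
have [_ AD AZ] := sA; rewrite -(subrK ((mleadc p / mleadc a) *: a) p).
apply: AD; last exact: AZ; apply: IH; first exact: mlead_cancel.
by apply: subspaceB => //; apply/AB/AZ.
Qed.

Lemma ideal_lead_upset A : ideal A -> upset (is_lead A).
Proof.
move=> [_ _ AM] u v uv [w [Aw nz_w lead_w]].
have nz_lc : mleadc w != 0 by rewrite mleadc_eq0.
have nz_lc' : mleadc ('X_[v - u] : S) * mleadc w != 0.
  by rewrite mleadXm mcoeffX eqxx mul1r.
exists ('X_[v - u] * w); split; first exact: AM.
- by rewrite -mleadc_eq0 mleadcM_proper.
- by rewrite mleadM_proper // mleadXm lead_w submK.
Qed.

(** Hilbert's basis theorem in the form of a maximum principle: an ideal cannot
    grow without gaining a leading monomial. *)
Lemma ideal_maximal (F : (S -> Prop) -> Prop) :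
  (forall A, F A -> ideal A) -> (exists A, F A) ->
  exists2 A, F A & forall B, F B -> (forall p, A p -> B p) -> forall p, B p -> A p.
Proof.
move=> idF [A0 FA0].
have [_ [A FA ->] maxA] := @upset_maximal n (fun L => exists2 A, F A & L = is_lead A)
  (fun L '(ex_intro2 A FA e) => eq_ind_r (@upset n) (ideal_lead_upset (idF A FA)) e)
  (ex_intro _ (is_lead A0) (ex_intro2 _ _ A0 FA0 erefl)).
exists A => // B FB AB; apply: lead_incl_eq => //.
- exact/ideal_subspace/idF.
- exact/ideal_subspace/idF.
apply: maxA; first by exists B.
by move=> m [w [Aw nz_w lead_w]]; exists w; split=> //; apply: AB.
Qed.

Definition reduced W q : Prop := forall m, m \in msupp q -> ~ is_lead W m.

Lemma reduce_exists W p : subspace W -> exists2 q, W (p - q) & reduced W q.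
Proof.
move=> sW; have [W0 WD WZ] := sW; elim/mlead_ind: p => [|p nz_p IH].
  by exists 0; rewrite ?subrr // => m; rewrite msupp0.
case: (pselect (is_lead W (mlead p))) => [[w [Ww nz_w lead_w]]|not_lead].
  have [] := IH (p - (mleadc p / mleadc w) *: w).
    by move=> nz; apply: mlead_cancel.
  move=> q Wq red_q; exists q => //.
  rewrite -[p](subrK ((mleadc p / mleadc w) *: w)) addrAC; apply: WD => //.
  exact: WZ.
have [] := IH (p - mleadc p *: 'X_[mlead p]).
  by move=> nz; apply: ltm_mleadD.
move=> q Wq red_q; exists (q + mleadc p *: 'X_[mlead p]).
  by rewrite opprD addrA addrAC.
move=> m /msuppD_le; rewrite mem_cat => /orP[/red_q //|/msuppZ_le].
by rewrite msuppX inE => /eqP ->.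
Qed.

Lemma reduced_eq0 W q : W q -> reduced W q -> q = 0.
Proof.
move=> Wq red_q; apply/eqP/negP => /negP nz_q.
by apply: (red_q (mlead q)); [apply: mlead_supp | exists q].
Qed.

(** The linear projection along [W] onto the span of the monomials that do not
    lead an element of [W]; it replaces the choice of a basis of the quotient. *)
Lemma normal_form W : subspace W -> exists nf : S -> S,
  [/\ forall c p q, nf (c *: p + q) = c *: nf p + nf q,
      forall p, W (p - nf p) & forall p, W p -> nf p = 0].
Proof.
move=> sW; have [W0 WD WZ] := sW.
have /choice [nf nfP] : forall p, exists q, W (p - q) /\ reduced W q.
  by move=> p; have [q] := reduce_exists p sW; exists q.
have redD (c : K) p q : reduced W p -> reduced W q -> reduced W (c *: p + q).
  move=> red_p red_q m /msuppD_le; rewrite mem_cat => /orP[|/red_q //].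
  by move/msuppZ_le/red_p.
have uniq_red p q : reduced W p -> reduced W q -> W (p - q) -> p = q.
  move=> red_p red_q Wpq; apply/subr0_eq/reduced_eq0; first exact: Wpq.
  by rewrite addrC -scaleN1r; apply: redD.
exists nf; split=> [c p q|p|p Wp]; last 2 first.
- by have [] := nfP p.
- have [Wnf red] := nfP p; apply: reduced_eq0 red.
  by rewrite -[nf p](subKr p); apply: subspaceB.
have [[[Wp redp] [Wq redq]] [Wr redr]] := (nfP p, nfP q, nfP (c *: p + q)).
apply: uniq_red => //; first exact: redD.
have -> : nf (c *: p + q) - (c *: nf p + nf q) =
   c *: (p - nf p) + (q - nf q) - (c *: p + q - nf (c *: p + q)).
  rewrite scalerBr; ring.
by apply: subspaceB => //; apply: WD => //; apply: WZ.
Qed.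

End Leading.

(** * Regular sequences on a quotient of ideals *)

Section RegularSequences.
Variables (n : nat) (K : fieldType).
Local Notation S := {mpoly K[n]}.
Local Notation irr := (@in_irrelevant n K).
Implicit Types (U V W P : S -> Prop) (f g p q r s u z : S) (fs gs : seq S).

Definition extend U V f : S -> Prop :=
  fun x => exists v u, [/\ V v, U u & x = v + f * u].

Definition extend_seq U V fs : S -> Prop := foldl (extend U) V fs.

Definition nonzerodivisor U V f : Prop := forall x, U x -> V (f * x) -> V x.

Fixpoint regular U V fs : Prop :=
  if fs is f :: fs' then nonzerodivisor U V f /\ regular U (extend U V f) fs'
  else True.

Definition socle U V u : Prop := [/\ U u, ~ V u & forall i, V ('X_i * u)].

Lemma ideal_extend U V f : ideal U -> ideal V -> ideal (extend U V f).
Proof.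
move=> [U0 UD UM] [V0 VD VM]; split.
- by exists 0, 0; rewrite mulr0 addr0.
- move=> _ _ [v [u [Vv Uu ->]]] [v' [u' [Vv' Uu' ->]]].
  exists (v + v'), (u + u'); split; [exact: VD | exact: UD | ring].
- move=> s _ [v [u [Vv Uu ->]]].
  exists (s * v), (s * u); split; [exact: VM | exact: UM | ring].
Qed.

Lemma sub_extend U V f p : ideal U -> V p -> extend U V f p.
Proof. by move=> [U0 _ _] Vp; exists p, 0; rewrite mulr0 addr0. Qed.

Lemma mul_extend U V f u : ideal V -> U u -> extend U V f (f * u).
Proof. by move=> [V0 _ _] Uu; exists 0, u; rewrite add0r. Qed.

Lemma extendC U V f g : ideal U ->
  extend U (extend U V f) g = extend U (extend U V g) f.
Proof.
move=> iU; apply/predeqP => x.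
split=> -[_ [u' [[v [u [Vv Uu ->]]] Uu' ->]]].
  exists (v + g * u'), u; rewrite addrAC; split=> //.
  by exists v, u'.
by exists (v + f * u'), u; rewrite addrAC; split=> //; exists v, u'.
Qed.

Lemma extend_seq_rcons U V fs f :
  extend_seq U V (rcons fs f) = extend U (extend_seq U V fs) f.
Proof. by rewrite /extend_seq -cats1 foldl_cat. Qed.

Lemma extend_seq_cat U V fs gs :
  extend_seq U V (fs ++ gs) = extend_seq U (extend_seq U V fs) gs.
Proof. by rewrite /extend_seq foldl_cat. Qed.

Lemma ideal_extend_seq U V fs : ideal U -> ideal V -> ideal (extend_seq U V fs).
Proof. by move=> iU; elim: fs V => //= f fs IH V iV; apply/IH/ideal_extend. Qed.

Lemma regular_cat U V fs gs :
  regular U V (fs ++ gs) <-> regular U V fs /\ regular U (extend_seq U V fs) gs.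
Proof.
elim: fs V => [|f fs IH] V /=; first by split=> [|[]].
by split=> [[Vf /IH [rfs rgs]]|[[Vf rfs] rgs]]; split=> //; apply/IH.
Qed.

Lemma regular_rcons U V fs f :
  regular U V (rcons fs f) <->
  regular U V fs /\ nonzerodivisor U (extend_seq U V fs) f.
Proof. by rewrite -cats1 regular_cat /=; split=> [[? []]|[]]. Qed.

Lemma ideal_irr : ideal irr.
Proof.
split.
- by exists (fun _ => 0); rewrite big1 // => i _; rewrite mul0r.
- move=> _ _ [a ->] [b ->]; exists (fun i => a i + b i); rewrite -big_split.
  by apply: eq_bigr => i _; rewrite mulrDl.
- move=> s _ [a ->]; exists (fun i => s * a i); rewrite mulr_sumr.
  by apply: eq_bigr => i _; rewrite mulrA.
Qed.

Lemma irrX i : irr 'X_i.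
Proof.
exists (fun j => (j == i)%:R); rewrite (bigD1 i) //= eqxx mul1r big1 ?addr0 //.
by move=> j /negPf ->; rewrite mul0r.
Qed.

Lemma irr_socle U V u f : ideal V -> socle U V u -> irr f -> V (f * u).
Proof.
move=> iV [_ _ Xu] [a ->]; rewrite mulr_suml; apply: subspace_sum.
  exact: ideal_subspace.
by move=> i _; rewrite -mulrA; have [_ _] := iV; apply.
Qed.

Lemma nonzerodivisor_no_socle U V f u : ideal V -> irr f ->
  nonzerodivisor U V f -> ~ socle U V u.
Proof.
by move=> iV irr_f Vf soc; have [Uu + _] := soc; apply; apply/Vf/(irr_socle iV soc).
Qed.

(** ** Prime avoidance *)

Definition prime_ideal P : Prop :=
  ideal P /\ forall a b, P (a * b) -> P a \/ P b.

(** Start from an element outside [P] and multiply by elements of [Q] outside [P]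
    for those [Q] that have any. *)
Lemma separate_prime (Ps : seq (S -> Prop)) P z : prime_ideal P ->
  (forall Q, Q \in Ps -> ideal Q) -> irr z -> ~ P z ->
  exists g, [/\ irr g, ~ P g
    & forall Q, Q \in Ps -> Q g \/ (forall s, Q s -> P s)].
Proof.
move=> [iP primeP] + irr_z nPz; elim: Ps => [|Q Ps IH] iQ; first by exists z.
have [|g [irr_g nPg gP]] := IH; first by move=> R RPs; apply: iQ; rewrite inE RPs orbT.
case: (pselect (forall s, Q s -> P s)) => [QP|nQP].
  by exists g; split=> // R; rewrite inE => /predU1P[->|/gP //]; right.
have [b Qb nPb] : exists2 b, Q b & ~ P b.
  by apply: contrapT => nb; apply: nQP => s Qs; apply: contrapT => nPs; apply: nb; exists s.
exists (b * g); split.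
- by have [_ _] := ideal_irr; apply.
- by case/primeP.
move=> R; rewrite inE => /predU1P[->|RPs].
  by left; rewrite mulrC; have [_ _] := iQ Q (mem_head _ _); apply.
have [Rg|] := gP R RPs; last by right.
have iR : ideal R by apply: iQ; rewrite inE RPs orbT.
by left; have [_ _] := iR; apply.
Qed.

(** If the element [z] found for [Ps] lies in [P], correct it by an element outside
    [P] that belongs to each member of [Ps]; the members contained in [P] are
    avoided together with it. *)
Lemma prime_avoidance (Ps : seq (S -> Prop)) :
  (forall P, P \in Ps -> prime_ideal P /\ exists i, ~ P 'X_i) ->
  exists z, irr z /\ forall P, P \in Ps -> ~ P z.
Proof.
elim: Ps => [|P Ps IH] PsP; first by exists 0; split=> //; have [] := ideal_irr.
have [Q QPs|z [irr_z zP]] := IH; first by apply: PsP; rewrite inE QPs orbT.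
have [pP [i nPi]] := PsP P (mem_head _ _).
case: (pselect (P z)) => [Pz|nPz]; last first.
  by exists z; split=> // Q; rewrite inE => /predU1P[-> |/zP].
have iPs Q : Q \in Ps -> ideal Q.
  by move=> QPs; have [|[]] := PsP Q; rewrite ?inE ?QPs ?orbT.
have [g [irr_g nPg gP]] := separate_prime pP iPs (irrX i) nPi.
have nPzg : ~ P (z + g).
  by move=> /idealB -/(_ z pP.1 Pz); rewrite addrAC subrr add0r.
exists (z + g); split; first by have [_ + _] := ideal_irr; apply.
move=> Q; rewrite inE => /predU1P[-> //|QPs] Qzg.
have [Qg|/(_ _ Qzg) //] := gP Q QPs.
apply: (zP Q QPs); rewrite -(addrK g z); exact: idealB (iPs Q QPs) Qzg Qg.
Qed.

Definition colon V u : S -> Prop := fun s => V (s * u).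

Lemma ideal_colon V u : ideal V -> ideal (colon V u).
Proof.
move=> [V0 VD VM]; split=> [|p q|s p]; rewrite /colon.
- by rewrite mul0r.
- by rewrite mulrDl; apply: VD.
- by rewrite -mulrA; apply: VM.
Qed.

(** [colon V u] is the annihilator of the class of [u] in [U/V]. *)
Definition maximal_annihilator U V u : Prop :=
  [/\ U u, ~ V u & forall w, U w -> ~ V w ->
     (forall s, colon V u s -> colon V w s) -> forall s, colon V w s -> colon V u s].

Lemma maximal_annihilator_prime U V u : ideal U -> ideal V ->
  maximal_annihilator U V u -> prime_ideal (colon V u).
Proof.
move=> [_ _ UM] iV [Uu nVu max_u]; split; first exact: ideal_colon.
move=> a b; rewrite /colon => Vab; case: (pselect (V (b * u))) => Vb; first by right.
left; apply: (max_u (b * u)) => //; first exact: UM.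
  by move=> s; rewrite /colon mulrCA; have [_ _] := iV; apply.
by rewrite /colon mulrA.
Qed.

(** An annihilator that is maximal among those containing [f] is maximal among
    all. *)
Lemma zerodivisor_annihilator U V f w : ideal V ->
  U w -> ~ V w -> V (f * w) ->
  exists2 u, maximal_annihilator U V u & colon V u f.
Proof.
move=> iV Uw nVw Vfw.
have [||_ [u [Uu nVu Vfu ->]] max_u] := @ideal_maximal n K
    (fun A => exists u, [/\ U u, ~ V u, V (f * u) & A = colon V u]).
- by move=> _ [u [_ _ _ ->]]; apply: ideal_colon.
- by exists (colon V w), w.
exists u => //; split=> // w' Uw' nVw' uw'; apply: max_u => //.
by exists w'; split=> //; apply: uw'.
Qed.

Lemma extend_full_colon V fs s x : ideal V -> (forall f, f \in fs -> V (s * f)) ->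
  extend_seq (fun=> True) V fs x -> V (s * x).
Proof.
move=> [_ VD VM]; suff gen W : (forall v, W v -> V (s * v)) ->
    (forall f, f \in fs -> V (s * f)) -> extend_seq (fun=> True) W fs x -> V (s * x).
  by apply: gen => v; apply: VM.
elim: fs W => [|f fs IH] W WV Vs /=; first exact: WV.
apply: IH => [_ [v [u [Wv _ ->]]]|g gfs]; last by apply: Vs; rewrite inE gfs orbT.
rewrite mulrDr mulrA [_ * u]mulrC; apply: VD; first exact: WV.
by apply/VM/Vs; rewrite mem_head.
Qed.

(** The submodule generated by elements with distinct maximal annihilators
    grows with each of them, so there are finitely many. *)
Lemma finitely_many_annihilators U V : ideal U -> ideal V ->
  exists2 l : seq S, forall u, u \in l -> maximal_annihilator U V u &
    forall w, maximal_annihilator U V w ->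
      exists2 u, u \in l & forall s, colon V w s -> colon V u s.
Proof.
move=> iU iV; pose T := fun _ : S => True.
have iT : ideal T by [].
have [||_ [l [lP ->]] max_l] := @ideal_maximal n K (fun A => exists l : seq S,
    (forall u, u \in l -> maximal_annihilator U V u) /\ A = extend_seq T V l).
- by move=> _ [l [_ ->]]; apply: ideal_extend_seq.
- by exists V, [::].
exists l => // w wP; have [Uw nVw max_w] := wP.
have [_ primeP] := maximal_annihilator_prime iU iV wP.
have lw : extend_seq T V l w.
  apply: (max_l (extend_seq T V (rcons l w))).
  - exists (rcons l w); split=> // u; rewrite mem_rcons inE => /predU1P[->//|].
    exact: lP.
  - by move=> p lp; rewrite extend_seq_rcons; apply: sub_extend.
  - have := @mul_extend T _ w 1 (ideal_extend_seq l iT iV) I.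
    by rewrite extend_seq_rcons mulr1.
apply: contrapT => no_u.
have [s [nVs Vs]] : exists s, ~ V (s * w) /\ forall u, u \in l -> V (s * u).
  have: {subset l <= l} by [].
  elim: {1 3}l => [|u l' IH] sub_l; first by exists 1; rewrite mul1r.
  have [u' l'u'|s [nVs Vs]] := IH; first by apply: sub_l; rewrite inE l'u' orbT.
  have lu : u \in l by apply: sub_l; rewrite mem_head.
  have [Uu nVu max_u] := lP u lu.
  have [b Vb nVb] : exists2 b, V (b * u) & ~ V (b * w).
    apply: contrapT => nob; apply: no_u; exists u => // t wt.
    apply: (max_u w) => // t' ut'; apply: contrapT => nw; apply: nob.
    by exists t'.
  exists (b * s); split; first by case/primeP.
  have [_ _ VM] := iV.
  move=> u'; rewrite inE => /predU1P[->|/Vs]; last by rewrite -mulrA; apply: VM.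
  by rewrite mulrAC mulrC; apply: VM.
by apply: nVs; apply: extend_full_colon lw.
Qed.

(** The zerodivisors on [U/V] are covered by finitely many primes, namely the
    maximal annihilators; one containing all variables would give a socle
    element. *)
Lemma common_nonzerodivisor U (Vs : seq (S -> Prop)) : ideal U ->
  (forall V, V \in Vs -> ideal V /\ forall u, ~ socle U V u) ->
  exists z, irr z /\ forall V, V \in Vs -> nonzerodivisor U V z.
Proof.
move=> iU VsP.
suff [Ps PsP avoid] : exists2 Ps : seq (S -> Prop),
    forall P, P \in Ps -> prime_ideal P /\ exists i, ~ P 'X_i &
    forall z, (forall P, P \in Ps -> ~ P z) ->
      forall V, V \in Vs -> nonzerodivisor U V z.
  by have [z [irr_z /avoid zP]] := prime_avoidance PsP; exists z.
elim: Vs VsP => [|V Vs IH] VsP; first by exists [::].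
have [W WVs|Ps PsP avoid] := IH; first by apply: VsP; rewrite inE WVs orbT.
have [iV no_socle] := VsP V (mem_head _ _).
have [l lP max_l] := finitely_many_annihilators iU iV.
exists ([seq colon V u | u <- l] ++ Ps) => [P|z zP W].
  rewrite mem_cat => /orP[/mapP[u lu ->]|/PsP //]; split.
    exact: maximal_annihilator_prime (lP u lu).
  apply: contrapT => noi; have [Uu nVu _] := lP u lu; apply: (no_socle u).
  by split=> // i; apply: contrapT => nVi; apply: noi; exists i.
rewrite inE => /predU1P[->|]; last first.
  by apply: avoid => P PPs; apply: zP; rewrite mem_cat PPs orbT.
move=> x Ux Vzx; apply: contrapT => nVx.
have [w wmax Vzw] := zerodivisor_annihilator iV Ux nVx Vzx.
have [u lu wu] := max_l w wmax.
apply: (zP (colon V u)); last exact: wu.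
by rewrite mem_cat map_f.
Qed.

(** ** Rees's theorem *)

(** If [z u] and [f u'] agree modulo [W], then [u] is a socle element for [f]
    exactly when [u'] is one for [z]. *)
Lemma socle_exchange U W f z : ideal U -> ideal W -> irr z ->
  nonzerodivisor U W f -> nonzerodivisor U W z ->
  (exists u, socle U (extend U W f) u) -> exists u, socle U (extend U W z) u.
Proof.
move=> iU iW irr_z Wf Wz [u soc].
have [_ UD UM] := iU; have [_ WD WM] := iW.
have [w [u' [Ww Uu' def_zu]]] : extend U W f (z * u).
  by apply: irr_socle soc irr_z; apply: ideal_extend.
have [Uu nu Xu] := soc; exists u'; split=> // [[w' [u'' [Ww' Uu'' def_u']]]|i].
  apply: nu; exists (u - f * u''), u''; split=> //; last by rewrite subrK.
  apply: Wz; first by apply: idealB => //; apply: UM.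
  have -> : z * (u - f * u'') = w + f * w'.
    by rewrite mulrBr def_zu def_u'; ring.
  by apply: WD => //; apply: WM.
have [wi [ui [Wwi Uui def_xu]]] := Xu i.
exists ('X_i * u' - z * ui), ui; split=> //; last by rewrite subrK.
apply: Wf; first by apply: idealB => //; apply: UM.
have -> : f * ('X_i * u' - z * ui) = z * wi - 'X_i * w.
  have -> : f * ('X_i * u' - z * ui) = 'X_i * (z * u) - 'X_i * w - z * (f * ui).
    rewrite def_zu; ring.
  have -> : f * ui = 'X_i * u - wi by rewrite def_xu; ring.
  ring.
by apply: idealB => //; apply: WM.
Qed.

Lemma nonzerodivisor_swap U V f z : ideal U -> ideal V ->
  nonzerodivisor U V f -> nonzerodivisor U V z ->
  nonzerodivisor U (extend U V f) z -> nonzerodivisor U (extend U V z) f.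
Proof.
move=> iU iV Vf Vz Vfz x Ux [v [u [Vv Uu def_fx]]]; have [_ UD UM] := iU.
have [v' [u' [Vv' Uu' def_u]]] : extend U V f u.
  apply: Vfz => //; exists (- v), x; split=> //; first exact: idealN.
  by rewrite def_fx; ring.
exists (x - z * u'), u'; split=> //; last by rewrite subrK.
apply: Vf; first by apply: idealB => //; apply: UM.
have -> : f * (x - z * u') = v + z * v' by rewrite mulrBr def_fx def_u; ring.
by have [_ VD VM] := iV; apply: VD => //; apply: VM.
Qed.

Lemma regular_move_front U V fs z : ideal U -> ideal V ->
  (forall W, W \in V :: scanl (extend U) V fs -> nonzerodivisor U W z) ->
  regular U V fs ->
  regular U (extend U V z) fs /\
  extend_seq U (extend U V z) fs = extend U (extend_seq U V fs) z.
Proof.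
move=> iU; elim: fs V => [|f fs IH] V iV //= zP [Vf reg_fs].
have [||reg_fs' eq_ext] := IH (extend U V f) _ _ reg_fs; first exact: ideal_extend.
  by move=> W Wfs; apply: zP; rewrite inE Wfs orbT.
rewrite extendC // in reg_fs' eq_ext; split=> //; split=> //.
apply: nonzerodivisor_swap => //; apply: zP; rewrite ?mem_head //.
by rewrite !inE eqxx orbT.
Qed.

Lemma regular_prefix_no_socle U V fs f W : ideal U -> ideal V ->
  (forall g, g \in rcons fs f -> irr g) -> regular U V (rcons fs f) ->
  W \in V :: scanl (extend U) V fs -> ideal W /\ forall u, ~ socle U W u.
Proof.
move=> iU; elim: fs V => [|g fs IH] V iV irr_fs /= [Vg reg_fs].
  rewrite inE => /eqP ->; split=> // u.
  by apply: nonzerodivisor_no_socle Vg => //; apply: irr_fs; rewrite inE.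
rewrite inE => /predU1P[->|].
  split=> // u; apply: nonzerodivisor_no_socle Vg => //; apply: irr_fs.
  by rewrite mem_head.
apply: IH => //; first exact: ideal_extend.
by move=> h hfs; apply: irr_fs; rewrite inE hfs orbT.
Qed.

(** Exchange argument: one nonzerodivisor [z] on all the partial quotients of
    both sequences can replace the last element of each and then be moved to the
    front, which reduces the claim to shorter sequences on [U/(V+zU)]. *)
Theorem regular_size_le U V fs gs : ideal U -> ideal V ->
  (forall f, f \in fs -> irr f) -> (forall g, g \in gs -> irr g) ->
  regular U V fs -> (exists u, socle U (extend_seq U V fs) u) ->
  regular U V gs -> (size gs <= size fs)%N.
Proof.
move=> iU; move def_r: (size fs) => r.
elim: r V fs gs def_r => [|r IH] V fs gs def_r iV irr_fs irr_gs.
  case: fs def_r {irr_fs} => // _ _ [u soc]; case: gs irr_gs => //= g gs irr_gs [Vg _].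
  case: (nonzerodivisor_no_socle iV _ Vg soc); apply: irr_gs; exact: mem_head.
case/lastP: fs def_r irr_fs => // fs f; rewrite size_rcons => -[def_r] irr_fs.
move=> reg_fs soc reg_gs.
case/lastP: gs irr_gs reg_gs => // gs g irr_gs reg_gs; rewrite size_rcons ltnS.
have [W|z [irr_z zP]] := @common_nonzerodivisor U
    ((V :: scanl (extend U) V fs) ++ (V :: scanl (extend U) V gs)) iU.
  by rewrite mem_cat => /orP[]; apply: regular_prefix_no_socle; eassumption.
have [reg_fs' Wf] := (regular_rcons U V fs f).1 reg_fs.
have [reg_gs' _] := (regular_rcons U V gs g).1 reg_gs.
have [|reg_fsz eq_ext] := regular_move_front iU iV (z := z) _ reg_fs'.
  by move=> W Wfs; apply: zP; rewrite mem_cat Wfs.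
have [|reg_gsz _] := regular_move_front iU iV (z := z) _ reg_gs'.
  by move=> W Wgs; apply: zP; rewrite mem_cat Wgs orbT.
apply: (IH (extend U V z) fs) => //.
- exact: ideal_extend.
- by move=> h hfs; apply: irr_fs; rewrite mem_rcons inE hfs orbT.
- by move=> h hgs; apply: irr_gs; rewrite mem_rcons inE hgs orbT.
rewrite eq_ext; apply: socle_exchange irr_z Wf _ _ => //.
- exact: ideal_extend_seq.
- apply: zP; rewrite mem_cat /extend_seq; apply/orP; left.
  have: last V (scanl (extend U) V fs) = foldl (extend U) V fs.
    by elim: (fs) (V) => //= h hs IHh X; rewrite IHh.
  by move=> <-; apply: mem_last.
by rewrite -extend_seq_rcons.
Qed.

(** A regular sequence that leaves a socle element cannot be prolonged; by
    [regular_size_le], no other regular sequence is longer. *)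
Definition has_depth U V d : Prop := exists fs,
  [/\ forall f, f \in fs -> irr f, regular U V fs, size fs = d
    & exists u, socle U (extend_seq U V fs) u].

Lemma has_depth_inj U V d e : ideal U -> ideal V ->
  has_depth U V d -> has_depth U V e -> d = e.
Proof.
move=> iU iV [fs [irr_fs reg_fs <- soc_fs]] [gs [irr_gs reg_gs <- soc_gs]].
by apply/eqP; rewrite eqn_leq !(regular_size_le (U := U) (V := V)).
Qed.

(** Take a regular sequence [fs] for which [V + (fs)U] is maximal. *)
Lemma has_depth_exists U V : ideal U -> ideal V ->
  (forall fs, (forall f, f \in fs -> irr f) ->
     exists2 x, U x & ~ extend_seq U V fs x) ->
  exists d, has_depth U V d.
Proof.
move=> iU iV proper.
have [||_ [fs [irr_fs reg_fs ->]] max_fs] := @ideal_maximal n K (fun A => exists fs,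
    [/\ forall f, f \in fs -> irr f, regular U V fs & A = extend_seq U V fs]).
- by move=> _ [fs [_ _ ->]]; apply: ideal_extend_seq.
- by exists V, [::].
exists (size fs), fs; split=> //; apply: contrapT => no_soc.
have iW := ideal_extend_seq fs iU iV.
have [V'|z [irr_z zP]] := @common_nonzerodivisor U [:: extend_seq U V fs] iU.
  by rewrite inE => /eqP ->; split=> // u soc; apply: no_soc; exists u.
have Wz := zP _ (mem_head _ _).
have [x Ux nWx] := proper fs irr_fs; apply/nWx/Wz => //.
apply: (max_fs (extend_seq U V (rcons fs z))).
- exists (rcons fs z); split=> //; last exact/regular_rcons.
  by move=> f; rewrite mem_rcons inE => /predU1P[-> //|]; apply: irr_fs.
- by move=> p Wp; rewrite extend_seq_rcons; apply: sub_extend.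
- by rewrite extend_seq_rcons; apply: mul_extend.
Qed.

End RegularSequences.

(** * Tensor products over disjoint sets of variables *)

(** ** Splitting the variables *)

(** Explicit injections rather than a decomposition [n = a + b], so that the
    variables of an arbitrary subset can form one of the two groups. *)
Record splitting n a b := Splitting {
  inL : 'I_a -> 'I_n;
  inR : 'I_b -> 'I_n;
  side : 'I_n -> 'I_a + 'I_b;
  side_inL : forall i, side (inL i) = inl i;
  side_inR : forall j, side (inR j) = inr j;
  sideK : forall k, match side k with inl i => inL i | inr j => inR j end = k
}.

Definition swap_splitting n a b (s : splitting n a b) : splitting n b a.
Proof.
exists (inR s) (inL s) (fun k => match side s k with inl i => inr i | inr j => inl j end).
- by move=> i; rewrite side_inR.
- by move=> i; rewrite side_inL.
- by move=> k; have := sideK s k; case: (side s k).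
Defined.

Definition ord_splitting a b : splitting (a + b) a b.
Proof.
exists (@lshift a b) (@rshift a b) (@split a b) => [i|j|k].
- exact: (unsplitK (inl i)).
- exact: (unsplitK (inr j)).
- exact: splitK.
Defined.

Lemma set_splitting n (A : {set 'I_n}) :
  exists s : splitting n #|A| #|~: A|,
    (forall i, inL s i \in A) /\ (forall j, inR s j \notin A).
Proof.
pose vA : 'I_#|A| -> 'I_n := enum_val; pose vC : 'I_#|~: A| -> 'I_n := enum_val.
have inA i : vA i \in A by apply: enum_valP.
have notinA j : vC j \notin A by have := enum_valP j; rewrite inE.
have sideP k : {x : 'I_#|A| + 'I_#|~: A| |
    match x with inl i => vA i | inr j => vC j end = k}.
  case: (boolP (k \in A)) => kA.
    by exists (inl (enum_rank_in kA k)); rewrite /vA enum_rankK_in.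
  have kA' : k \in ~: A by rewrite inE.
  by exists (inr (enum_rank_in kA' k)); rewrite /vC enum_rankK_in.
have sideL i : sval (sideP (vA i)) = inl i.
  case: (sideP _) => -[i' /= /enum_val_inj -> //|j /= ej].
  by have := notinA j; rewrite ej inA.
have sideR j : sval (sideP (vC j)) = inr j.
  case: (sideP _) => -[i /= ei|j' /= /enum_val_inj -> //].
  by have := notinA j; rewrite -ei inA.
by exists (Splitting sideL sideR (fun k => svalP (sideP k))).
Qed.

Section MonomialSplitting.
Variables (n a b : nat) (s : splitting n a b).
Implicit Types (m : 'X_{1..n}) (x : 'X_{1..a}) (y : 'X_{1..b}).

Definition resL m : 'X_{1..a} := [multinom m (inL s i) | i < a].
Definition resR m : 'X_{1..b} := [multinom m (inR s j) | j < b].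
Definition join x y : 'X_{1..n} :=
  [multinom match side s k with inl i => x i | inr j => y j end | k < n].

Lemma joinKL x y : resL (join x y) = x.
Proof. by apply/mnmP=> i; rewrite !mnmE side_inL. Qed.

Lemma joinKR x y : resR (join x y) = y.
Proof. by apply/mnmP=> i; rewrite !mnmE side_inR. Qed.

Lemma resK m : join (resL m) (resR m) = m.
Proof.
apply/mnmP=> k; rewrite mnmE -[in RHS](sideK s k).
by case: (side s k) => i; rewrite mnmE.
Qed.

Lemma joinD x y x' y' : (join x y + join x' y')%MM = join (x + x') (y + y').
Proof.
by apply/mnmP=> k; rewrite mnmDE !mnmE; case: (side s k) => i; rewrite mnmDE.
Qed.

Lemma resL_le m m' : (m <= m')%MM -> (resL m <= resL m')%MM.
Proof. by move/mnm_lepP=> mm'; apply/mnm_lepP=> i; rewrite !mnmE. Qed.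

Lemma resR_le m m' : (m <= m')%MM -> (resR m <= resR m')%MM.
Proof. by move/mnm_lepP=> mm'; apply/mnm_lepP=> i; rewrite !mnmE. Qed.

(** Monomials of a tensor product [(U1/V1) * (U2/V2)], seen as a quotient of
    [tensorU U1 U2] by [tensorV U1 V1 U2 V2]. *)
Definition tensorU (U1 : 'X_{1..a} -> Prop) (U2 : 'X_{1..b} -> Prop) m : Prop :=
  U1 (resL m) /\ U2 (resR m).

Definition tensorV (U1 V1 : 'X_{1..a} -> Prop) (U2 V2 : 'X_{1..b} -> Prop) m : Prop :=
  tensorU U1 U2 m /\ (V1 (resL m) \/ V2 (resR m)).

End MonomialSplitting.

(** ** Monomial ideals as up-sets *)

Definition mono_ideal n (K : fieldType) (U : 'X_{1..n} -> Prop) (p : {mpoly K[n]}) : Prop :=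
  forall m, m \in msupp p -> U m.

Lemma mono_idealX n (K : fieldType) (U : 'X_{1..n} -> Prop) m :
  mono_ideal U ('X_[m] : {mpoly K[n]}) <-> U m.
Proof.
split=> [|Um k]; first by apply; rewrite msuppX mem_head.
by rewrite msuppX inE => /eqP ->.
Qed.

Lemma mono_ideal_coeff n (K : fieldType) (U : 'X_{1..n} -> Prop) (p : {mpoly K[n]}) m :
  mono_ideal U p -> ~ U m -> p@_m = 0.
Proof. by move=> Up nUm; apply: memN_msupp_eq0; apply/negP => /Up. Qed.

Lemma mono_ideal_subspace n (K : fieldType) (U : 'X_{1..n} -> Prop) :
  subspace (@mono_ideal n K U).
Proof.
split=> [m|p q Up Uq m|c p Up m]; first by rewrite msupp0.
- by move=> /msuppD_le; rewrite mem_cat => /orP[/Up|/Uq].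
- by move/msuppZ_le/Up.
Qed.

Lemma mono_ideal_ideal n (K : fieldType) (U : 'X_{1..n} -> Prop) :
  upset U -> ideal (@mono_ideal n K U).
Proof.
move=> upU; have [U0 UD UZ] := mono_ideal_subspace K U; split=> // t p Up m.
move=> /msuppM_le/allpairsP[[k l] /= [_ /Up Ul ->]].
by apply: upU Ul; rewrite lem_addl.
Qed.

(** The last condition says that the quotient of the two ideals is nonzero. *)
Definition mono_module n (U V : 'X_{1..n} -> Prop) : Prop :=
  [/\ upset U, upset V, forall m, V m -> U m & exists2 m, U m & ~ V m].

Lemma tensor_mono_module n a b (s : splitting n a b) U1 V1 U2 V2 :
  mono_module U1 V1 -> mono_module U2 V2 ->
  mono_module (tensorU s U1 U2) (tensorV s U1 V1 U2 V2).
Proof.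
move=> [upU1 upV1 VU1 [m1 Um1 nVm1]] [upU2 upV2 VU2 [m2 Um2 nVm2]].
have upU : upset (tensorU s U1 U2).
  move=> u v uv [Uu1 Uu2].
  by split; [apply: upU1 Uu1; apply: resL_le | apply: upU2 Uu2; apply: resR_le].
split=> // [u v uv [Uu Vu]|m [] //|].
  split; first exact: upU uv Uu.
  case: Vu => [V1u|V2u]; [left; apply: upV1 V1u | right; apply: upV2 V2u].
    exact: resL_le.
  exact: resR_le.
by exists (join s m1 m2); rewrite /tensorV /tensorU joinKL joinKR //; case=> _ [].
Qed.

Section Linext.
Variables (n : nat) (K : fieldType) (V : lmodType K) (h : 'X_{1..n} -> V).
Local Notation S := {mpoly K[n]}.

Definition linext (p : S) : V := \sum_(m <- msupp p) p@_m *: h m.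

Lemma linextE (l : seq 'X_{1..n}) (p : S) : uniq l -> {subset msupp p <= l} ->
  linext p = \sum_(m <- l) p@_m *: h m.
Proof.
move=> uniq_l sub_l; rewrite /linext [RHS](bigID (fun m => m \in msupp p)) /=.
rewrite [X in _ + X]big1 ?addr0 => [|m /memN_msupp_eq0 ->]; last by rewrite scale0r.
rewrite -[RHS]big_filter; apply: perm_big; apply: uniq_perm.
- exact: msupp_uniq.
- exact: filter_uniq.
- by move=> m; rewrite mem_filter; case: (boolP (m \in msupp p)) => //= /sub_l ->.
Qed.

Fact linext_linear : linear linext.
Proof.
move=> c p q; pose l := undup (msupp p ++ msupp q).
have lu : uniq l by apply: undup_uniq.
rewrite (@linextE l p) // ?(@linextE l q) // ?(@linextE l (c *: p + q)) //.
- rewrite scaler_sumr -big_split; apply: eq_bigr => m _ /=.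
  by rewrite mcoeffD mcoeffZ scalerDl scalerA.
- move=> m /msuppD_le; rewrite mem_undup !mem_cat => /orP[/msuppZ_le ->|->] //.
  by rewrite orbT.
- by move=> m mq; rewrite mem_undup mem_cat mq orbT.
- by move=> m mp; rewrite mem_undup mem_cat mp.
Qed.

HB.instance Definition _ :=
  GRing.isLinear.Build K S V *:%R linext linext_linear.

Lemma linextX m : linext 'X_[m] = h m.
Proof. by rewrite /linext msuppX big_seq1 mcoeffX eqxx scale1r. Qed.

End Linext.

Section Embedding.
Variables (K : fieldType) (n a b : nat) (s : splitting n a b).

Definition embL : {mpoly K[a]} -> {mpoly K[n]} :=
  mmap (@mpolyC n K) (fun i => 'X_(inL s i)).

HB.instance Definition _ := GRing.RMorphism.on embL.

Lemma embLX x : embL 'X_[x] = 'X_[join s x 0].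
Proof.
rewrite /embL mmapX /mmap1 mprodXnE; congr 'X_[_]; apply/mnmP => k.
rewrite mnm_sumE mnmE -[in LHS](sideK s k).
under eq_bigr => i _ do rewrite mulmnE mnm1E.
case: (side s k) => j.
  rewrite (bigD1 j) //= eqxx mul1n big1 ?addn0 // => i ij.
  rewrite (negPf (_ : inL s i != inL s j)) //; apply: contra ij => /eqP eq_in.
  by apply/eqP; have := side_inL s i; rewrite eq_in side_inL => -[].
rewrite mnm0E big1 // => i _; case: eqP => // eq_in.
by have := side_inL s i; rewrite eq_in side_inR.
Qed.

Lemma embLZ c p : embL (c *: p) = c *: embL p.
Proof. by rewrite /embL mmapZ mul_mpolyC. Qed.

End Embedding.

Definition embR (K : fieldType) n a b (s : splitting n a b) :
  {mpoly K[b]} -> {mpoly K[n]} := embL (swap_splitting s).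

HB.instance Definition _ (K : fieldType) n a b (s : splitting n a b) :=
  GRing.RMorphism.on (@embR K n a b s).

Section Contraction.
Variables (K : fieldType) (n a b : nat) (s : splitting n a b).
Local Notation Sa := {mpoly K[a]}.
Local Notation Sb := {mpoly K[b]}.
Local Notation S := {mpoly K[n]}.
Local Notation L := (@embL K n a b s).
Local Notation R := (@embR K n a b s).

Lemma embRX y : R 'X_[y] = 'X_[join s 0 y].
Proof.
rewrite /embR embLX; congr 'X_[_]; apply/mnmP=> k; rewrite !mnmE /=.
by case: (side s k) => i; rewrite ?mnm0E.
Qed.

Lemma emb_mul_X x y : L 'X_[x] * R 'X_[y] = 'X_[join s x y].
Proof. by rewrite embLX embRX -mpolyXD joinD addm0 add0m. Qed.

Lemma emb_expand (x : S) :
  x = \sum_(m <- msupp x) x@_m *: (L 'X_[resL s m] * R 'X_[resR s m]).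
Proof.
rewrite {1}(mpolyE x); apply: eq_bigr => m _.
by rewrite emb_mul_X resK.
Qed.

(** The map induced by the linear form [lam] on the second factor of
    [K[n] = K[a] * K[b]], with values in [K[a]]. *)
Definition contract (lam : Sb -> K) : S -> Sa :=
  linext (fun m => lam 'X_[resR s m] *: 'X_[resL s m]).

HB.instance Definition _ lam := GRing.Linear.on (contract lam).

Variable lam : {linear Sb -> K^o}.

Lemma contract_mul p q : contract lam (L p * R q) = lam q *: p.
Proof.
rewrite [in LHS](mpolyE p) [in RHS](mpolyE p) !raddf_sum mulr_suml /= raddf_sum /=.
apply: eq_bigr => x _.
rewrite [in LHS](mpolyE q) [in RHS](mpolyE q) !raddf_sum mulr_sumr /= raddf_sum scaler_suml.
apply: eq_bigr => y _ /=.
rewrite embLZ /embR embLZ -/(embR s _) -scalerAl -scalerAr !linearZ /= emb_mul_X /contract linextX.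
by rewrite joinKR joinKL /= !scalerA -mulrA.
Qed.

Lemma contract_embL f x : contract lam (L f * x) = f * contract lam x.
Proof.
rewrite [in LHS](emb_expand x) [in RHS](emb_expand x) mulr_sumr !raddf_sum mulr_sumr /=.
apply: eq_bigr => m _; rewrite -scalerAr !linearZ /= -scalerAr; congr (_ *: _).
by rewrite mulrA -rmorphM !contract_mul scalerAr.
Qed.

End Contraction.

(** ** Depth of a tensor product *)

Section TensorDepth.
Variables (K : fieldType).

Section OneSide.
Variables (n a b : nat) (s : splitting n a b).
Local Notation Sa := {mpoly K[a]}.
Local Notation Sb := {mpoly K[b]}.
Local Notation S := {mpoly K[n]}.
Local Notation L := (@embL K n a b s).
Local Notation R := (@embR K n a b s).
Variables (u1 : 'X_{1..a} -> Prop) (u2 : 'X_{1..b} -> Prop).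
Hypotheses (up1 : upset u1) (up2 : upset u2).
Local Notation U1 := (@mono_ideal a K u1).
Local Notation U2 := (@mono_ideal b K u2).
Local Notation U := (@mono_ideal n K (tensorU s u1 u2)).

(** [W1 * U2 + U1 * W2], the submodule by which [U1 * U2] is divided to get
    [(U1/W1) * (U2/W2)] *)
Definition tensor_sub (W1 : Sa -> Prop) (W2 : Sb -> Prop) (x : S) : Prop :=
  exists l : seq (Sa * Sb),
    (forall t, t \in l -> W1 t.1 /\ U2 t.2 \/ U1 t.1 /\ W2 t.2) /\
    x = \sum_(t <- l) L t.1 * R t.2.

Lemma tensor_sub_pair (W1 : Sa -> Prop) (W2 : Sb -> Prop) p q :
  W1 p /\ U2 q \/ U1 p /\ W2 q -> tensor_sub W1 W2 (L p * R q).
Proof.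
by exists [:: (p, q)]; rewrite big_seq1; split=> // t; rewrite inE => /eqP ->.
Qed.

Lemma tensor_sub_subspace W1 W2 : subspace W1 -> subspace W2 ->
  subspace (tensor_sub W1 W2).
Proof.
move=> [_ _ WZ1] [_ _ WZ2]; split.
- by exists [::]; rewrite big_nil.
- move=> _ _ [l [lP ->]] [l' [lP' ->]]; exists (l ++ l'); rewrite big_cat.
  by split=> // t; rewrite mem_cat => /orP[/lP|/lP'].
move=> c _ [l [lP ->]]; exists [seq (c *: t.1, t.2) | t <- l]; split.
  move=> _ /mapP[t /lP tP ->] /=; have [_ _ UZ] := mono_ideal_subspace K u1.
  by case: tP => -[t1 t2]; [left|right]; split=> //; [apply: WZ1 | apply: UZ].
rewrite big_map scaler_sumr; apply: eq_bigr => t _ /=.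
by rewrite embLZ scalerAl.
Qed.

Lemma tensor_sub_full : tensor_sub U1 U2 = U.
Proof.
apply/predeqP => x; split=> [[l [lP ->]]|Ux].
  apply: subspace_sum; first exact: mono_ideal_subspace.
  move=> [p q] /lP /= pqP.
  have {lP pqP}[Up Uq] : U1 p /\ U2 q by case: pqP.
  rewrite {1}(mpolyE p) raddf_sum mulr_suml /=; apply: subspace_sum.
    exact: mono_ideal_subspace.
  move=> m1 /Up Um1; rewrite (mpolyE q) raddf_sum mulr_sumr /=; apply: subspace_sum.
    exact: mono_ideal_subspace.
  move=> m2 /Uq Um2; rewrite /embR !embLZ -/(embR s _) -scalerAl -scalerAr emb_mul_X.
  have [_ _ UZ] := mono_ideal_subspace K (tensorU s u1 u2).
  by apply/UZ/UZ/mono_idealX; rewrite /tensorU joinKL joinKR.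
have sT := tensor_sub_subspace (mono_ideal_subspace K u1) (mono_ideal_subspace K u2).
rewrite (emb_expand s x); apply: subspace_sum => // m /Ux [m1 m2].
have [_ _] := sT; apply; apply: tensor_sub_pair; left.
by split; apply/mono_idealX.
Qed.

Lemma tensor_sub_mono (v1 : 'X_{1..a} -> Prop) (v2 : 'X_{1..b} -> Prop) :
  (forall m, v1 m -> u1 m) -> (forall m, v2 m -> u2 m) ->
  tensor_sub (@mono_ideal a K v1) (@mono_ideal b K v2) =
  @mono_ideal n K (tensorV s u1 v1 u2 v2).
Proof.
move=> vu1 vu2; apply/predeqP => x; split=> [[l [lP ->]]|Vx].
  apply: subspace_sum; first exact: mono_ideal_subspace.
  move=> [p q] /lP /= pqP.
  rewrite {1}(mpolyE p) raddf_sum mulr_suml /=; apply: subspace_sum.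
    exact: mono_ideal_subspace.
  move=> m1 pm1; rewrite (mpolyE q) raddf_sum mulr_sumr /=; apply: subspace_sum.
    exact: mono_ideal_subspace.
  move=> m2 qm2; rewrite /embR !embLZ -/(embR s _) -scalerAl -scalerAr emb_mul_X.
  have [_ _ VZ] := mono_ideal_subspace K (tensorV s u1 v1 u2 v2).
  apply/VZ/VZ/mono_idealX; rewrite /tensorV /tensorU joinKL joinKR.
  by case: pqP => -[/(_ _ pm1) m1P /(_ _ qm2) m2P]; split;
    [split=> //; apply: vu1 | left | split=> //; apply: vu2 | right].
have sT := tensor_sub_subspace (mono_ideal_subspace K v1) (mono_ideal_subspace K v2).
rewrite (emb_expand s x); apply: subspace_sum => // m /Vx [[m1 m2] v12].
have [_ _] := sT; apply; apply: tensor_sub_pair.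
by case: v12 => vm; [left|right]; split; apply/mono_idealX.
Qed.

(** Contracting along the coordinates of normal forms modulo [W2] reduces the
    claim to [U1/W1]. *)
Lemma tensor_nonzerodivisor W1 W2 f : subspace W1 -> subspace W2 ->
  (forall q, W2 q -> U2 q) ->
  nonzerodivisor U1 W1 f -> nonzerodivisor U (tensor_sub W1 W2) (L f).
Proof.
move=> sW1 sW2 WU2 W1f x Ux Tfx.
have sT := tensor_sub_subspace sW1 sW2; have [_ TD TZ] := sT.
have [nf [nf_lin Wnf nf0]] := normal_form sW2.
have coord_lin be : linear (fun q : Sb => (nf q)@_be : K^o).
  by move=> c p q; rewrite nf_lin mcoeffD mcoeffZ.
pose lam be : {linear Sb -> K^o} := HB.pack (fun q : Sb => (nf q)@_be : K^o)
  (GRing.isLinear.Build K Sb K^o *:%R _ (coord_lin be)).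
have Unf be q : U2 q -> be \in msupp (nf q) -> u2 be.
  move=> Uq; have : U2 (nf q); last by apply.
  rewrite -[nf q](subKr q).
  exact: subspaceB (mono_ideal_subspace K u2) Uq (WU2 _ (Wnf q)).
have contract_in be : W1 (contract s (lam be) x).
  apply: W1f.
    apply: subspace_sum; first exact: mono_ideal_subspace.
    move=> m /Ux [m1 _]; have [_ _ UZ] := mono_ideal_subspace K u1.
    by apply/UZ/UZ/mono_idealX.
  rewrite -(contract_embL s (lam be)); case: Tfx => l [lP ->].
  rewrite raddf_sum /=; apply: subspace_sum => // t /lP tP.
  rewrite [X in W1 X](contract_mul s (lam be)); have [W0 _ WZ] := sW1.
  case: tP => -[t1 t2]; first exact: WZ.
  by rewrite /= (nf0 _ t2) mcoeff0 scale0r.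
pose B := undup (flatten [seq msupp (nf 'X_[resR s m]) | m <- msupp x]).
have expand_nf m : m \in msupp x ->
    nf 'X_[resR s m] = \sum_(be <- B) (nf 'X_[resR s m])@_be *: 'X_[be].
  move=> xm; rewrite {1}(mpolyE (nf _)).
  apply: (linextE (fun be => 'X_[be] : Sb)); first exact: undup_uniq.
  move=> be nf_be; rewrite mem_undup; apply/flattenP.
  by exists (msupp (nf 'X_[resR s m])) => //; apply: map_f.
(* Write each monomial in the second group of variables as its normal form, which
   contributes to W1 * U2, plus an element of W2. *)
have -> : x = \sum_(be <- B) L (contract s (lam be) x) * R 'X_[be] +
    \sum_(m <- msupp x) x@_m *: (L 'X_[resL s m] * R ('X_[resR s m] - nf 'X_[resR s m])).
  rewrite [LHS](emb_expand s x).
  under [X in _ + X]eq_bigr => m _ do rewrite rmorphB mulrBr scalerBr.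
  rewrite sumrB addrCA [X in _ + X](_ : _ = 0) ?addr0 //.
  apply/eqP; rewrite subr_eq0; apply/eqP.
  under eq_bigr => be _ do
    rewrite [contract _ _ _]/(linext _ _) /linext raddf_sum mulr_suml /=.
  rewrite exchange_big /= big_seq [RHS]big_seq; apply: eq_bigr => m xm.
  rewrite [in RHS](expand_nf m xm) raddf_sum mulr_sumr scaler_sumr /=.
  apply: eq_bigr => be _.
  by rewrite /embR !embLZ -scalerAl -scalerAl -scalerAr.
apply: TD; apply: subspace_sum => //.
  move=> be; rewrite mem_undup => /flattenP[_ /mapP[m xm ->] nf_be].
  apply: tensor_sub_pair; left; split=> //; apply/mono_idealX.
  apply: Unf nf_be; apply/mono_idealX; by have [] := Ux m xm.
move=> m xm; apply: TZ; apply: tensor_sub_pair; right; split=> //.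
by apply/mono_idealX; have [] := Ux m xm.
Qed.

Lemma subspace_extend n' (A B : {mpoly K[n']} -> Prop) f : subspace A -> subspace B ->
  subspace (extend A B f).
Proof.
move=> [A0 AD AZ] [B0 BD BZ]; split.
- by exists 0, 0; rewrite mulr0 addr0.
- move=> _ _ [v [u [Bv Au ->]]] [v' [u' [Bv' Au' ->]]].
  by exists (v + v'), (u + u'); rewrite mulrDr addrACA; split; [exact: BD|exact: AD|].
move=> c _ [v [u [Bv Au ->]]]; exists (c *: v), (c *: u).
by rewrite scalerDr scalerAr; split; [exact: BZ|exact: AZ|].
Qed.

Lemma tensor_extend W1 W2 f : ideal W1 -> subspace W2 ->
  extend U (tensor_sub W1 W2) (L f) = tensor_sub (extend U1 W1 f) W2.
Proof.
move=> iW1 sW2; have sW1 := ideal_subspace iW1.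
have iU1 : ideal U1 by apply: mono_ideal_ideal.
have sT := tensor_sub_subspace sW1 sW2.
have sE := subspace_extend f (ideal_subspace iU1) sW1.
have sT' := tensor_sub_subspace sE sW2.
apply/predeqP => x; split.
  move=> [v [u [[l [lP ->]] Uu ->]]]; have [_ TD _] := sT'; apply: TD.
    apply: subspace_sum => // t /lP tP; apply: tensor_sub_pair.
    case: tP => -[t1 t2]; [left|right]; split=> //.
    exact: sub_extend.
  rewrite -tensor_sub_full in Uu; case: Uu => l' [lP' ->].
  rewrite mulr_sumr; apply: subspace_sum => // t /lP' tP.
  rewrite mulrA -rmorphM; apply: tensor_sub_pair; left.
  by case: tP => -[t1 t2]; split=> //; apply: mul_extend.
move=> [l [lP ->]]; apply: subspace_sum.
  apply: subspace_extend => //; exact: mono_ideal_subspace.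
have [T0 _ _] := sT; have [U0 _ _] := mono_ideal_subspace K (tensorU s u1 u2).
move=> [p q] /lP[/= [[v [u [W1v U1u ->]]] U2q]|/= [U1p W2q]].
  exists (L v * R q), (L u * R q); rewrite rmorphD rmorphM mulrDl mulrA; split=> //.
    by apply: tensor_sub_pair; left.
  by rewrite -tensor_sub_full; apply: tensor_sub_pair; left.
exists (L p * R q), 0; rewrite mulr0 addr0; split=> //.
by apply: tensor_sub_pair; right.
Qed.

Lemma tensor_regular V1 W2 fs : ideal V1 -> subspace W2 ->
  (forall q, W2 q -> U2 q) -> regular U1 V1 fs ->
  regular U (tensor_sub V1 W2) [seq L f | f <- fs] /\
  extend_seq U (tensor_sub V1 W2) [seq L f | f <- fs] =
    tensor_sub (extend_seq U1 V1 fs) W2.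
Proof.
move=> iV1 sW2 WU2; elim: fs V1 iV1 => //= f fs IH V1 iV1 [V1f reg_fs].
have iU1 : ideal U1 by apply: mono_ideal_ideal.
have [||reg eq_ext] := IH (extend U1 V1 f); [exact: ideal_extend|by []|].
rewrite tensor_extend //; split=> //; split=> //.
by apply: tensor_nonzerodivisor => //; apply: ideal_subspace.
Qed.

Lemma irr_embL f : in_irrelevant f -> in_irrelevant (L f).
Proof.
move=> [q ->]; rewrite raddf_sum /=; apply: subspace_sum.
  exact/ideal_subspace/ideal_irr.
move=> i _; rewrite rmorphM /= embLX.
have -> : join s U_(i) 0 = U_(inL s i)%MM.
  apply/mnmP=> k; rewrite mnmE mnm1E -{2}(sideK s k); case: (side s k) => j.
    rewrite mnm1E; congr (nat_of_bool _); apply/eqP/eqP => [-> //|eq_in].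
    by have := side_inL s i; rewrite eq_in side_inL => -[].
  rewrite mnm0E; case: eqP => // eq_in.
  by have := side_inL s i; rewrite eq_in side_inR.
by have [_ _] := ideal_irr n K; apply; apply: irrX.
Qed.

(** A contraction that does not vanish at [q] maps [p * q] to a nonzero multiple of
    [p]. *)
Lemma tensor_socle W1 W2 p q : subspace W1 -> subspace W2 ->
  U1 p -> U2 q -> ~ W1 p -> ~ W2 q -> ~ tensor_sub W1 W2 (L p * R q).
Proof.
move=> sW1 sW2 Up Uq nWp nWq [l [lP def_pq]].
have [nf [nf_lin Wnf nf0]] := normal_form sW2.
have [be nz_be] : exists be, (nf q)@_be != 0.
  apply: contrapT => nobe; apply: nWq; rewrite -[q]subr0.
  have -> : 0 = nf q; last exact: Wnf.
  apply/mpolyP => be; rewrite mcoeff0; apply/esym/eqP/negPn/negP => nz.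
  by apply: nobe; exists be.
have coord_lin : linear (fun q : Sb => (nf q)@_be : K^o).
  by move=> c p' q'; rewrite nf_lin mcoeffD mcoeffZ.
pose lam : {linear Sb -> K^o} := HB.pack (fun q : Sb => (nf q)@_be : K^o)
  (GRing.isLinear.Build K Sb K^o *:%R _ coord_lin).
have [W0 _ WZ] := sW1.
have : W1 (contract s lam (L p * R q)).
  rewrite def_pq raddf_sum; apply: subspace_sum => // t /lP tP.
  rewrite [X in W1 X](contract_mul s lam); case: tP => -[t1 t2]; first exact: WZ.
  by rewrite /= (nf0 _ t2) mcoeff0 scale0r.
rewrite contract_mul => /(WZ ((nf q)@_be)^-1); rewrite scalerA mulVf // scale1r.
exact: nWp.
Qed.

End OneSide.

Variables (n a b : nat) (s : splitting n a b).
Local Notation U u1 u2 := (@mono_ideal n K (tensorU s u1 u2)).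

Lemma tensor_sub_swap u1 u2 W1 W2 :
  tensor_sub (swap_splitting s) u2 u1 W2 W1 = tensor_sub s u1 u2 W1 W2.
Proof.
apply/predeqP => x; split=> -[l [lP ->]].
  exists [seq (t.2, t.1) | t <- l]; split; last first.
    by rewrite big_map; apply: eq_bigr => t _; rewrite mulrC.
  by move=> _ /mapP[t /lP tP ->]; case: tP => -[]; [right|left].
exists [seq (t.2, t.1) | t <- l]; split; last first.
  by rewrite big_map; apply: eq_bigr => t _; rewrite mulrC.
by move=> _ /mapP[t /lP tP ->]; case: tP => -[]; [right|left].
Qed.

Lemma tensorU_swap u1 u2 : tensorU (swap_splitting s) u2 u1 = tensorU s u1 u2.
Proof. by apply/predeqP => m; split=> -[]. Qed.

(** The two sequences are concatenated: over a field, tensoring with the other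
    factor keeps each of them regular, and the product of two socle elements is a
    socle element. *)
Theorem tensor_depth u1 v1 u2 v2 d e :
  mono_module u1 v1 -> mono_module u2 v2 ->
  has_depth (@mono_ideal a K u1) (mono_ideal v1) d ->
  has_depth (@mono_ideal b K u2) (mono_ideal v2) e ->
  has_depth (U u1 u2) (mono_ideal (tensorV s u1 v1 u2 v2)) (d + e).
Proof.
move=> [up1 upv1 vu1 _] [up2 upv2 vu2 _].
move=> [fs [irr_fs reg_fs <- [p [Up nWp Xp]]]] [gs [irr_gs reg_gs <- [q [Uq nWq Xq]]]].
have iV1 : ideal (@mono_ideal a K v1) by apply: mono_ideal_ideal.
have iV2 : ideal (@mono_ideal b K v2) by apply: mono_ideal_ideal.
have iU1 : ideal (@mono_ideal a K u1) by apply: mono_ideal_ideal.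
have iU2 : ideal (@mono_ideal b K u2) by apply: mono_ideal_ideal.
set W1 := extend_seq _ _ fs in nWp Xp; set W2 := extend_seq _ _ gs in nWq Xq.
have iW1 : ideal W1 by apply: ideal_extend_seq.
have iW2 : ideal W2 by apply: ideal_extend_seq.
have W1U x : W1 x -> mono_ideal u1 x.
  suff: forall V, ideal V -> (forall y, V y -> mono_ideal u1 y) ->
      extend_seq (mono_ideal u1) V fs x -> mono_ideal u1 x.
    by apply=> // y Vy m /Vy /vu1.
  elim: (fs) => [|f fs' IH] V iV VU /=; first exact: VU.
  apply: IH; first exact: ideal_extend.
  have [_ UD UM] := iU1; move=> _ [v [w [Vv Uw ->]]].
  by apply: UD; [apply: VU | apply: UM].
have [|regL extL] := @tensor_regular _ _ _ s u1 u2 up1 _ (mono_ideal v2) _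
  iV1 (ideal_subspace iV2) _ reg_fs.
  by move=> y Vy m /Vy /vu2.
have [|] := @tensor_regular _ _ _ (swap_splitting s) u2 u1 up2 _ W1 _
  iV2 (ideal_subspace iW1) _ reg_gs.
  exact: W1U.
rewrite !tensor_sub_swap tensorU_swap -/(embR s) => regR extR.
exists ([seq embL s f | f <- fs] ++ [seq embR s g | g <- gs]).
rewrite -tensor_sub_mono // extend_seq_cat extL extR.
split.
- by move=> h; rewrite mem_cat => /orP[] /mapP[g gin ->]; apply: irr_embL; auto.
- by apply/regular_cat; rewrite extL.
- by rewrite size_cat !size_map.
exists (embL s p * embR s q); split.
- by rewrite -tensor_sub_full; apply: tensor_sub_pair; left.
- by apply: tensor_socle => //; apply: ideal_subspace.
move=> k.
rewrite -(sideK s k); case: (side s k) => i.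
  have -> : 'X_(inL s i) = embL s 'X_i :> {mpoly K[n]}.
    by rewrite /embL mmapX mmap1U.
  by rewrite mulrA -rmorphM; apply: tensor_sub_pair; left; split=> //; apply: Xp.
have -> : 'X_(inR s i) = embR s 'X_i :> {mpoly K[n]}.
  by rewrite /embR /embL mmapX mmap1U.
rewrite mulrCA -rmorphM; apply: tensor_sub_pair; right; split=> //; exact: Xq.
Qed.

End TensorDepth.

(** * Depth of quotients of monomial ideals *)

Section MonoDepth.
Variables (K : fieldType) (n : nat).
Local Notation S := {mpoly K[n]}.
Local Notation irr := (@in_irrelevant n K).
Implicit Types (U V : 'X_{1..n} -> Prop) (m : 'X_{1..n}) (p x : S).

Lemma mcoeffXM (k : 'X_{1..n}) p m :
  ('X_[k] * p)@_m = if (k <= m)%MM then p@_(m - k) else 0.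
Proof.
rewrite mulrC; case: ifPn => [km|nkm]; first by rewrite -{1}(submK km) addmC mcoeffMX.
apply: memN_msupp_eq0; rewrite (perm_mem (msuppMX _ _)); apply: contra nkm.
by case/mapP=> u _ ->; apply: lem_addr.
Qed.

Lemma mono_ideal_mulX U i p :
  (forall m, U (m + U_(i))%MM -> U m) -> mono_ideal U ('X_i * p) -> mono_ideal U p.
Proof.
move=> Ui Up m pm; apply/Ui/Up.
rewrite mcoeff_msupp addmC mcoeffXM lem_addr.
by rewrite addmC addmK -mcoeff_msupp.
Qed.

(** The graded Nakayama lemma: a monomial of least degree in [U] outside [V]
    never occurs in [V + (fs)U]. *)
Lemma mono_proper U V fs : mono_module U V -> (forall f, f \in fs -> irr f) ->
  exists2 x : S, mono_ideal U x & ~ extend_seq (mono_ideal U) (mono_ideal V) fs x.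
Proof.
move=> [upU upV VU [m1 Um1 nVm1]] irr_fs.
have exd : exists d, `[< exists m, [/\ U m, ~ V m & mdeg m = d] >].
  by exists (mdeg m1); apply/asboolP; exists m1.
case: (ex_minnP exd) => d /asboolP[m0 [Um0 nVm0 <-]] min_d.
exists 'X_[m0]; first exact/mono_idealX.
suff gen W : (forall x, W x -> x@_m0 = 0) ->
    forall x, extend_seq (mono_ideal U) W fs x -> x@_m0 = 0.
  move=> /gen-/(_ (fun x Vx => mono_ideal_coeff Vx nVm0))/eqP.
  by rewrite mcoeffX eqxx oner_eq0.
have [_ _ UM] := mono_ideal_ideal K upU.
elim: fs W irr_fs => [|f fs IH] W irr_fs W0 x /=; first exact: W0.
apply: IH => [g gfs|y]; first by apply: irr_fs; rewrite inE gfs orbT.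
move=> [v [u [/W0 v0 Uu ->]]]; rewrite mcoeffD v0 add0r.
have [q ->] := irr_fs f (mem_head _ _).
rewrite mulr_suml raddf_sum big1 //= => i _.
rewrite -mulrA mulrCA mcoeffXM; case: ifP => // im0.
apply: mono_ideal_coeff (UM _ _ Uu) _ => Um0i.
have : (mdeg m0 <= mdeg (m0 - U_(i)))%N.
  apply: min_d; apply/asboolP; exists (m0 - U_(i))%MM; split=> // Vm.
  by apply: nVm0; apply: upV Vm; apply: lem_subr.
by rewrite -{1}(submK im0) mdegD mdeg1 addn1 ltnn.
Qed.

Lemma mono_depth_exists U V : mono_module U V ->
  exists d, has_depth (@mono_ideal n K U) (mono_ideal V) d.
Proof.
move=> mUV; have [upU upV _ _] := mUV.
by apply: has_depth_exists => [||fs irr_fs]; [exact: mono_ideal_ideal.. | exact: mono_proper].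
Qed.

Lemma mono_depth_inj U V d e : mono_module U V ->
  has_depth (@mono_ideal n K U) (mono_ideal V) d ->
  has_depth (@mono_ideal n K U) (mono_ideal V) e -> d = e.
Proof. by move=> [upU upV _ _]; apply: has_depth_inj; apply: mono_ideal_ideal. Qed.

(** ** Regular sequences of variables *)

Definition occurs (Q : {set 'I_n}) m : Prop := exists2 i, i \in Q & (0 < m i)%N.

Lemma occurs_upset Q : upset (occurs Q).
Proof.
move=> u v /mnm_lepP uv [i iQ ui]; exists i => //.
by apply: leq_trans (uv i).
Qed.

(** For an up-set, this makes membership independent of the exponent of [i]. *)
Definition cylinder U i : Prop := forall m, U (m + U_(i))%MM -> U m.

Lemma extend_variable U V i : upset U -> upset V -> (forall m, V m -> U m) ->
  cylinder U i ->
  extend (@mono_ideal n K U) (mono_ideal V) 'X_i =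
  mono_ideal (fun m => V m \/ U m /\ (0 < m i)%N).
Proof.
move=> upU upV VU cylU; apply/predeqP => x; split.
  move=> [v [u [Vv Uu ->]]].
  apply: (let: And3 _ D _ := mono_ideal_subspace K _ in D) => m.
    by move=> /Vv; left.
  rewrite mcoeff_msupp mcoeffXM; case: ifP => [im nz|]; last by rewrite eqxx.
  right; split; last by rewrite lt0n -lep1mP.
  by apply: upU (lem_subr _ _) _; apply: Uu; rewrite mcoeff_msupp; apply: nz.
move=> Vx; rewrite (mpolyE x).
have iE : ideal (extend (@mono_ideal n K U) (mono_ideal V) 'X_i).
  by apply: ideal_extend; apply: mono_ideal_ideal.
have [_ _ EZ] := ideal_subspace iE.
apply: subspace_sum; first exact: ideal_subspace.
move=> m /Vx Vm; apply: EZ; case: Vm => [Vm|[Um mi]].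
  by apply: sub_extend; [apply: mono_ideal_ideal | apply/mono_idealX].
have im : (U_(i) <= m)%MM by rewrite lep1mP -lt0n.
rewrite -(submK im) addmC mpolyXD; apply: mul_extend.
  exact: mono_ideal_ideal.
by apply/mono_idealX; apply: cylU; rewrite submK.
Qed.

(** Each variable of [l] is adjoined to [V] as a monomial condition, without
    affecting the directions of the others. *)
Lemma regular_variables U V (l : seq 'I_n) : upset U -> upset V ->
  (forall m, V m -> U m) -> uniq l ->
  (forall i, i \in l -> cylinder U i /\ cylinder V i) ->
  regular (@mono_ideal n K U) (mono_ideal V) [seq 'X_i | i <- l] /\
  extend_seq (@mono_ideal n K U) (mono_ideal V) [seq 'X_i | i <- l] =
    mono_ideal (fun m => V m \/ U m /\ exists2 i, i \in l & (0 < m i)%N).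
Proof.
move=> upU; elim: l V => [|i l IH] V upV VU /=.
  move=> _ _; split=> //; congr mono_ideal; apply/predeqP => m.
  by split=> [|[|[_ [j]]]] //; left.
move=> /andP[i_l uniq_l] cyl.
have [cylUi cylVi] := cyl i (mem_head _ _).
pose V' m := V m \/ U m /\ (0 < m i)%N.
have [||//||reg ext] := IH V'.
- move=> u v uv [Vu|[Uu ui]]; first by left; apply: upV Vu.
  by right; split; [apply: upU Uu | apply: leq_trans ui (mnm_lepP uv i)].
- by move=> m [/VU|[]].
- move=> j jl; have jil : j \in i :: l by rewrite inE jl orbT.
  have [cylUj cylVj] := cyl j jil; split=> // m [/cylVj|[/cylUj Um]]; first by left.
  rewrite mnmDE mnm1E (_ : j == i = false) ?addn0; first by right.
  by apply: contraNF i_l => /eqP <-.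
rewrite extend_variable //; split; first split=> //.
  by move=> x _; apply: mono_ideal_mulX.
rewrite ext; congr mono_ideal; apply/predeqP => m; split.
  case=> [[Vm|[Um mi]]|[Um [j jl mj]]]; first by left.
    by right; split=> //; exists i; rewrite ?mem_head.
  by right; split=> //; exists j; rewrite // inE jl orbT.
case=> [Vm|[Um [j]]]; first by left; left.
rewrite inE => /predU1P[->|jl] mj; first by left; right.
by right; split=> //; exists j.
Qed.

End MonoDepth.

Section DepthExamples.
Variables (K : fieldType) (n : nat).
Local Notation S := {mpoly K[n]}.
Implicit Types (P Q : {set 'I_n}) (m : 'X_{1..n}).
Let full m := True.
Let empty m := False.

Lemma size_enum_setC Q : size (enum (~: Q)) = (n - #|Q|)%N.
Proof.
have e : (#|Q| + #|~: Q| = n)%N by rewrite cardsC card_ord.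
have -> : size (enum (~: Q)) = #|~: Q| by rewrite cardE.
by apply: (@addnI #|Q|); rewrite e subnKC // -[X in (_ <= X)%N]e leq_addr.
Qed.

Lemma full_upset : upset full. Proof. by []. Qed.
Lemma empty_upset : upset empty. Proof. by []. Qed.

Lemma ring_mono_module : mono_module full empty.
Proof. by split=> //; exists 0%MM. Qed.

Lemma depth_ring : has_depth (@mono_ideal n K full) (mono_ideal empty) n.
Proof.
have [|||reg ext] := @regular_variables K n full empty (enum 'I_n) full_upset empty_upset.
- by [].
- exact: enum_uniq.
- by move=> i _; split.
exists [seq 'X_i | i <- enum 'I_n]; split=> //.
- by move=> _ /mapP[i _ ->]; apply: irrX.
- by rewrite size_map size_enum_ord.
rewrite ext; exists 'X_[0]; split=> [//| /mono_idealX [//|[_ [i _]]]|i].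
  by rewrite mnm0E.
rewrite -mpolyXD addm0; apply/mono_idealX; right; split=> //.
by exists i; rewrite ?mem_enum // mnm1E eqxx.
Qed.

Lemma occurs_mono_module Q i : i \in Q -> mono_module (occurs Q) empty.
Proof.
move=> iQ; split=> //; first exact: occurs_upset.
by exists U_(i)%MM => //; exists i; rewrite // mnm1E eqxx.
Qed.

Lemma cylinder_occurs Q i : i \notin Q -> cylinder (occurs Q) i.
Proof.
move=> niQ m [j jQ]; rewrite mnmDE mnm1E (_ : i == j = false) ?addn0.
  by exists j.
by apply: contraNF niQ => /eqP ->.
Qed.

(** The variables outside [Q] and one variable [y] of [Q] form a maximal regular
    sequence on the ideal generated by [Q]; [y] itself becomes a socle element. *)
Lemma depth_variables_ideal Q i : i \in Q ->
  has_depth (@mono_ideal n K (occurs Q)) (mono_ideal empty) (n - #|Q|).+1.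
Proof.
move=> iQ; have upQ := occurs_upset (Q := Q).
have [|||reg ext] := @regular_variables K n (occurs Q) empty (enum (~: Q)) upQ empty_upset.
- by [].
- exact: enum_uniq.
- by move=> j; rewrite mem_enum inE => jQ; split=> //; apply: cylinder_occurs.
exists (rcons [seq 'X_j | j <- enum (~: Q)] 'X_i); split.
- by move=> f; rewrite mem_rcons inE => /predU1P[->|/mapP[j _ ->]]; apply: irrX.
- apply/regular_rcons; split=> //; rewrite ext => x Ux Wx m xm.
  have [//|[_ [j jl mj]]] : empty (U_(i) + m)%MM \/ occurs Q (U_(i) + m) /\
      exists2 j, j \in enum (~: Q) & (0 < (U_(i) + m)%MM j)%N.
    apply: Wx; rewrite mcoeff_msupp mcoeffXM lem_addr.
    by rewrite addmC addmK -mcoeff_msupp.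
  right; split; first exact: Ux; exists j => //; move: mj.
  rewrite mnmDE mnm1E (_ : i == j = false) //; apply: contraTF jl => /eqP <-.
  by rewrite mem_enum inE negbK.
- by rewrite size_rcons size_map size_enum_setC.
rewrite extend_seq_rcons ext; exists 'X_i; split.
- by apply/mono_idealX; exists i; rewrite // mnm1E eqxx.
- move=> [v [u [Wv Uu]]] /(congr1 (mcoeff U_(i)%MM)).
  rewrite mcoeffD mcoeffXM lepm_refl mcoeffX eqxx.
  rewrite (mono_ideal_coeff Wv) ?(mono_ideal_coeff Uu) ?addr0.
  + by move/eqP; rewrite oner_eq0.
  + by case=> j _; rewrite mnmBE subnn.
  + case=> // -[_ [j]]; rewrite mem_enum inE mnm1E => jQ.
    by case: eqP => // eq_ij; rewrite -eq_ij iQ in jQ.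
move=> j; case: (boolP (j \in Q)) => jQ.
  rewrite mulrC; apply: mul_extend.
    apply: mono_ideal_ideal => u v uv [//|[Uu [k kl uk]]]; right.
    split; first exact: upQ uv Uu.
    by exists k => //; apply: leq_trans uk (mnm_lepP uv k).
  by apply/mono_idealX; exists j; rewrite // mnm1E eqxx.
apply: sub_extend; first exact: mono_ideal_ideal.
rewrite -mpolyXD; apply/mono_idealX; right; split.
  by exists i; rewrite // mnmDE !mnm1E eqxx addnC.
by exists j; rewrite ?mem_enum ?inE // mnmDE mnm1E eqxx.
Qed.

Definition occurs_both P Q m : Prop := occurs P m /\ occurs Q m.

Lemma occurs_both_upset P Q : upset (occurs_both P Q).
Proof. by move=> u v uv [Pu Qu]; split; apply: occurs_upset uv _. Qed.

Lemma occurs_both_mono_module P Q : mono_module full (occurs_both P Q).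
Proof.
split=> //; first exact: occurs_both_upset.
by exists 0%MM => // -[[i _]]; rewrite mnm0E.
Qed.

(** The product of the ideals of two disjoint sets of variables: the union of
    two linear subspaces meeting only where all variables of both sets vanish.
    The variables outside both sets and the sum of one from each form a maximal
    regular sequence, modulo which either of these two is a socle element. *)
Lemma depth_product_of_variables P Q i j : [disjoint P & Q] -> i \in P -> j \in Q ->
  has_depth (@mono_ideal n K full) (mono_ideal (occurs_both P Q))
    (n - #|P :|: Q|).+1.
Proof.
move=> disjPQ iP jQ; have upV := occurs_both_upset (P := P) (Q := Q).
have iNQ : i \notin Q by rewrite (disjointFr disjPQ).
have jNP : j \notin P by rewrite (disjointFl disjPQ).
have neq_ij : (i == j) = false by apply: contraNF iNQ => /eqP ->.
have neq_ji : (j == i) = false by rewrite eq_sym.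
pose l := enum (~: (P :|: Q)).
have lP k : k \in l -> k \notin P /\ k \notin Q.
  by rewrite mem_enum !inE negb_or => /andP.
have [|||reg ext] := @regular_variables K n full (occurs_both P Q) l full_upset upV.
- by [].
- exact: enum_uniq.
- move=> k /lP[kP kQ]; split=> // m [Pm Qm].
  by split; [apply: cylinder_occurs kP _ Pm | apply: cylinder_occurs kQ _ Qm].
pose W m := occurs_both P Q m \/ full m /\ exists2 k, k \in l & (0 < m k)%N.
have upW : upset W.
  move=> u v uv [Vu|[_ [k kl uk]]]; first by left; apply: upV Vu.
  by right; split=> //; exists k => //; apply: leq_trans uk (mnm_lepP uv k).
have iW : ideal (@mono_ideal n K W) by apply: mono_ideal_ideal.
have WX m k : ~ W m -> W (m + U_(k))%MM ->
    k \in P /\ occurs Q m \/ k \in Q /\ occurs P m \/ k \in l.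
  move=> nWm; rewrite -/(cylinder W k) => WmX.
  case: (boolP (k \in l)) => kl; first by right; right.
  have [kP|kP] := boolP (k \in P).
    left; split=> //; case: WmX => [[_ Qm]|[_ [k' k'l mk']]].
      by apply: cylinder_occurs Qm; rewrite (disjointFr disjPQ).
    case: nWm; right; split=> //; exists k' => //; move: mk'.
    by rewrite mnmDE mnm1E (_ : k == k' = false) ?addn0 //; apply: contraNF kl => /eqP ->.
  have kQ : k \in Q by move: kl; rewrite mem_enum !inE (negPf kP) negbK.
  right; left; split=> //; case: WmX => [[Pm _]|[_ [k' k'l mk']]].
    exact: cylinder_occurs Pm.
  case: nWm; right; split=> //; exists k' => //; move: mk'.
  by rewrite mnmDE mnm1E (_ : k == k' = false) ?addn0 //; apply: contraNF kl => /eqP ->.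
pose f : S := 'X_i + 'X_j.
exists (rcons [seq 'X_k | k <- l] f); split.
- have [_ irrD _] := ideal_irr n K.
  move=> g; rewrite mem_rcons inE => /predU1P[->|/mapP[k _ ->]]; last exact: irrX.
  by apply: irrD; apply: irrX.
- apply/regular_rcons; split=> //; rewrite ext => x _ Wfx m xm.
  apply: contrapT => nWm.
  have coeff_f k : ~ W (m + U_(k))%MM ->
      ('X_i * x)@_(m + U_(k))%MM + ('X_j * x)@_(m + U_(k))%MM = 0.
    by move=> nW; rewrite -mcoeffD -mulrDl (mono_ideal_coeff Wfx).
  have nz : x@_m != 0 by rewrite -mcoeff_msupp.
  (* No variable of P, or none of Q, occurs in m: in the first case multiply by
     'X_j, in the second by 'X_i, so that the other term of f contributes nothing. *)
  have [Qm|nQm] := pselect (occurs Q m).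
    have nPm : ~ occurs P m by move=> Pm; apply: nWm; left.
    move: (coeff_f j); rewrite !mcoeffXM lem_addl addmK.
    rewrite (_ : (U_(i) <= _)%MM = false) ?add0r.
      move=> coeff0; move/negP: nz; apply; apply/eqP/coeff0 => /(WX _ _ nWm).
      by case=> [[]|[[_ /nPm] //|/lP[_]]]; rewrite ?(negPf jNP) ?jQ.
    apply/negbTE; rewrite lep1mP negbK mnmDE mnm1E neq_ji addn0 -leqn0 leqNgt.
    by apply/negP => mi; apply: nPm; exists i.
  move: (coeff_f i); rewrite !mcoeffXM lem_addl addmK.
  rewrite (_ : (U_(j) <= _)%MM = false) ?addr0.
    move=> coeff0; move/negP: nz; apply; apply/eqP/coeff0 => /(WX _ _ nWm).
    by case=> [[_ /nQm] //|[[]|/lP[]]]; rewrite ?(negPf iNQ) ?iP.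
  apply/negbTE; rewrite lep1mP negbK mnmDE mnm1E neq_ij addn0 -leqn0 leqNgt.
  by apply/negP => mj; apply: nQm; exists j.
- by rewrite size_rcons size_map size_enum_setC.
have nWU k : k \in P :|: Q -> ~ W U_(k)%MM.
  move=> kPQ [[[k1 k1P +] [k2 k2Q]]|[_ [k' k'l]]]; rewrite !mnm1E.
    case: eqP k1P => // <- kP _; case: eqP => // e _; move: k2Q; rewrite -e.
    by rewrite (disjointFr disjPQ).
  by case: eqP => // e _; move: k'l; rewrite mem_enum inE -e kPQ.
rewrite extend_seq_rcons ext -/W; exists 'X_i; split=> //.
- move=> [w [u [Ww _ def_x]]].
  have /(congr1 (mcoeff U_(j)%MM)) := def_x.
  rewrite mcoeffX eq_mnm1 neq_ij mcoeffD (mono_ideal_coeff Ww); last first.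
    by apply: nWU; rewrite inE jQ orbT.
  rewrite mulrDl mcoeffD !mcoeffXM lepm_refl lep1mP mnm1E neq_ji /= !add0r => u0.
  have /(congr1 (mcoeff U_(i)%MM)) := def_x.
  rewrite mcoeffX eqxx mcoeffD (mono_ideal_coeff Ww); last by apply: nWU; rewrite inE iP.
  rewrite mulrDl mcoeffD !mcoeffXM lepm_refl lep1mP mnm1E neq_ij /= addr0 add0r.
  have subnn' k : (U_(k) - U_(k) = 0 :> 'X_{1..n})%MM.
    by apply/mnmP => k'; rewrite mnmBE subnn mnm0E.
  by move: u0; rewrite !subnn' => <- /eqP; rewrite oner_eq0.
move=> k; have [kP|kP] := boolP (k \in P).
  have -> : 'X_k * 'X_i = - ('X_k * 'X_j) + f * 'X_k :> S by rewrite /f; ring.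
  exists (- ('X_k * 'X_j)), 'X_k; split=> //.
  apply: (idealN iW); rewrite -mpolyXD; apply/mono_idealX; left.
  by split; [exists k | exists j]; rewrite // mnmDE !mnm1E eqxx // addnC.
apply: sub_extend; first exact: mono_ideal_ideal.
rewrite -mpolyXD; apply/mono_idealX.
have [kQ|kQ] := boolP (k \in Q).
  by left; split; [exists i | exists k]; rewrite // mnmDE !mnm1E eqxx // addnC.
right; split=> //; exists k; last by rewrite mnmDE mnm1E eqxx.
by rewrite mem_enum !inE negb_or kP.
Qed.

End DepthExamples.

(** * Stanley depth of sets of monomials *)

Section Cones.
Variable n : nat.
Implicit Types (c : 'X_{1..n} * {set 'I_n}) (v : 'X_{1..n}) (X Y : 'X_{1..n} -> Prop).

Definition in_cone c v : bool :=
  [forall i, if i \in c.2 then (c.1 i <= v i)%N else v i == c.1 i].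

(** Counting the cones through [v] expresses covering and disjointness at once,
    and makes products and restrictions of partitions list computations. *)
Definition cone_partition X (l : seq ('X_{1..n} * {set 'I_n})) : Prop :=
  forall v, count (in_cone^~ v) l = `[< X v >].

Definition has_sdepth X d : Prop :=
  exists2 l, cone_partition X l & forall c, c \in l -> (d <= #|c.2|)%N.

Lemma has_sdepth_le X d e : (e <= d)%N -> has_sdepth X d -> has_sdepth X e.
Proof. by move=> ed [l lX ld]; exists l => // c /ld; apply: leq_trans. Qed.

Lemma eq_has_sdepth X Y d : (forall v, X v <-> Y v) -> has_sdepth X d -> has_sdepth Y d.
Proof. by move=> XY; rewrite (_ : X = Y) //; apply/predeqP. Qed.

Lemma has_sdepth_bound X d v : X v -> has_sdepth X d -> (d <= n)%N.
Proof.
move=> Xv [l /(_ v)]; rewrite asboolT // => count1 ld.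
have : has (in_cone^~ v) l by rewrite has_count count1.
case/hasP=> c /ld dc _; apply: leq_trans dc _.
by have := max_card (mem c.2); rewrite card_ord.
Qed.

Lemma has_sdepth_union X Y d : (forall v, X v -> ~ Y v) ->
  has_sdepth X d -> has_sdepth Y d -> has_sdepth (fun v => X v \/ Y v) d.
Proof.
move=> XY [l lX ld] [l' lY ld']; exists (l ++ l') => [v|c]; last first.
  by rewrite mem_cat => /orP[/ld|/ld'].
rewrite count_cat lX lY asbool_or; have := XY v.
by case: (asboolP (X v)) => Xv; case: (asboolP (Y v)) => Yv // /(_ Xv).
Qed.

Lemma has_sdepth_full : has_sdepth (fun=> True) n.
Proof.
exists [:: (0%MM, setT)] => [v|c]; last by rewrite inE => /eqP ->; rewrite cardsT card_ord.
rewrite asboolT //= (_ : in_cone _ v) //; apply/forallP => i.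
by rewrite inE mnm0E.
Qed.

Lemma has_sdepth_zero : has_sdepth (fun v => v = 0%MM) 0.
Proof.
exists [:: (0%MM, set0)] => // v; rewrite /= addn0; congr nat_of_bool.
apply/forallP/asboolP => [v0|-> i]; last by rewrite inE mnm0E.
by apply/mnmP=> i; have := v0 i; rewrite inE => /eqP.
Qed.

(** Truncating exponents at a common bound [N] for [U] and [V] does not change
    membership in their difference, so the cones over the truncated monomials,
    free in the directions that reach [N], form a finite partition. *)
Lemma has_sdepth_exists U V : upset U -> upset V -> (has_sdepth (fun v => U v /\ ~ V v) 0).
Proof.
move=> upU upV; have [N1 bU] := upset_bounded upU; have [N2 bV] := upset_bounded upV.
pose N := maxn N1 N2.
pose trunc v : {ffun 'I_n -> 'I_N.+1} := [ffun i => inord (minn (v i) N)].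
pose mon (f : {ffun 'I_n -> 'I_N.+1}) : 'X_{1..n} := [multinom (f i : nat) | i < n].
have truncE v i : mon (trunc v) i = minn (v i) N.
  by rewrite mnmE ffunE inordK // ltnS geq_minr.
have bound (W : 'X_{1..n} -> Prop) N' v : upset W -> (N' <= N)%N ->
    (forall u, W u -> W [multinom minn (u i) N' | i < n]) ->
    W (mon (trunc v)) <-> W v.
  move=> upW N'N bW; split=> [|/bW]; apply: upW; apply/mnm_lepP => i; rewrite truncE.
    exact: geq_minl.
  by rewrite mnmE leq_min geq_minl (leq_trans (geq_minr _ _)).
have XE v : `[< U (mon (trunc v)) /\ ~ V (mon (trunc v)) >] = `[< U v /\ ~ V v >].
  by apply/asbool_equiv_eq; rewrite (bound U N1) ?(bound V N2) ?leq_maxl ?leq_maxr.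
pose cone f := (mon f, [set i | mon f i == N]).
have in_coneE f v : in_cone (cone f) v = (f == trunc v).
  apply/forallP/eqP => [fv|-> i]; last first.
    by rewrite inE !truncE; case: (leqP (v i) N) => vi; case: ifP => //; lia.
  apply/ffunP => i; apply: val_inj; have := fv i.
  rewrite ffunE /= inordK ?ltnS ?geq_minr // inE !mnmE.
  have : (f i <= N)%N by rewrite -ltnS.
  by case: ifP => /eqP; lia.
exists [seq cone f | f <- enum {ffun 'I_n -> 'I_N.+1} & `[< U (mon f) /\ ~ V (mon f) >]] => // v.
rewrite count_map count_filter (eq_count (a2 := fun f => (f == trunc v) && `[< U v /\ ~ V v >])).
  case: (`[< _ >]); last by rewrite (eq_count (a2 := pred0)) ?count_pred0 // => f; rewrite andbF.
  rewrite (eq_count (a2 := pred1 (trunc v))) ?count_uniq_mem ?enum_uniq ?mem_enum //.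
  by move=> f; rewrite andbT.
by move=> f /=; rewrite in_coneE; case: eqP => //= ->; rewrite XE.
Qed.

Lemma has_sdepth_max U V : mono_module U V ->
  exists d, is_nat_max (has_sdepth (fun v => U v /\ ~ V v)) d.
Proof.
move=> [upU upV _ [m Um nVm]]; set X := fun v => _.
have Xm : X m by [].
have exd : exists d, `[< has_sdepth X d >].
  by exists 0%N; apply/asboolP/has_sdepth_exists.
have bd d : `[< has_sdepth X d >] -> (d <= n)%N.
  by move/asboolP; apply: has_sdepth_bound Xm.
case: (ex_maxnP exd bd) => d /asboolP Xd max_d; exists d; split=> // e Xe.
by apply: max_d; apply/asboolP.
Qed.

Lemma sdepth_max_le X Y d e : is_nat_max (has_sdepth X) d ->
  is_nat_max (has_sdepth Y) e -> (forall k, has_sdepth X k -> has_sdepth Y k) ->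
  (d <= e)%N.
Proof. by move=> [Xd _] [_ max_e] XY; apply/max_e/XY. Qed.

Definition zero_at i v : 'X_{1..n} := [multinom if k == i then 0%N else v k | k < n].

(** Cones meeting the hyperplane [v i = 0] are the only ones needed to cover it,
    and each may be enlarged by the direction [i]. *)
Lemma has_sdepth_cylinder X Y i d :
  (forall v, v i = 0%N -> X v <-> Y v) -> (forall v, Y v <-> Y (zero_at i v)) ->
  has_sdepth X d -> has_sdepth Y d.
Proof.
move=> XY cylY [l lX ld].
exists [seq (c.1, i |: c.2) | c <- l & c.1 i == 0%N] => [v|c]; last first.
  move=> /mapP[c0]; rewrite mem_filter => /andP[_ /ld dc] ->.
  by apply: leq_trans dc _; rewrite subset_leq_card // subsetUr.
have -> : `[< Y v >] = `[< X (zero_at i v) >].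
  by apply/asbool_equiv_eq; rewrite cylY XY // mnmE eqxx.
rewrite -lX count_map count_filter; apply: eq_count => c /=.
have [ci|nci] := eqVneq (c.1 i) 0%N; last first.
  rewrite andbF; apply/esym/negbTE/negP => /forallP/(_ i).
  by rewrite mnmE eqxx; case: ifP => _; move: nci; case: (c.1 i).
rewrite andbT; apply: eq_forallb => k /=; rewrite !inE mnmE.
have [->|] := eqVneq k i; last by [].
by rewrite /= ci; case: ifP.
Qed.

End Cones.

Section ConeFamilies.
Variable n : nat.
Implicit Types (v : 'X_{1..n}).

(** Cone partitions in the indexed form of Stanley decompositions. *)
Definition cone_family (X : 'X_{1..n} -> Prop) t (c : 'I_t -> 'X_{1..n} * {set 'I_n}) : Prop :=
  [/\ forall v, X v -> exists i, in_cone (c i) v,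
      forall i v, in_cone (c i) v -> X v
    & forall i j v, in_cone (c i) v -> in_cone (c j) v -> i = j].

Lemma cone_familyP X t (c : 'I_t -> 'X_{1..n} * {set 'I_n}) :
  cone_family X c <-> cone_partition X [seq c i | i <- enum 'I_t].
Proof.
have countE v : count ((@in_cone n)^~ v) [seq c i | i <- enum 'I_t] = #|[pred i | in_cone (c i) v]|.
  by rewrite count_map cardE -size_filter enumT.
split=> [[cov sub uniq_c] v|part].
  rewrite countE; case: asboolP => Xv; last first.
    by apply: eq_card0 => i; rewrite inE; apply/negP => /sub.
  have [i ci] := cov v Xv; apply/eqP/card1P; exists i => j; rewrite !inE.
  by apply/idP/eqP => [cj|-> //]; apply: uniq_c ci.
split=> [v Xv|i v ci|i j v ci cj].
- have := part v; rewrite countE asboolT // => /eqP/card1P[i ci].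
  by exists i; have := ci i; rewrite !inE eqxx.
- have := part v; rewrite countE; case: asboolP => // _ /card0_eq/(_ i).
  by rewrite !inE ci.
have := part v; rewrite countE; case: asboolP => _ card_v.
  have := card_v; move/eqP/card1P => [k ck]; have := ck i; have := ck j.
  by rewrite !inE ci cj => /esym/eqP -> /esym/eqP ->.
by move/card0_eq: card_v => /(_ i); rewrite !inE ci.
Qed.

End ConeFamilies.

Section SplitCones.
Variables (n a b : nat) (s : splitting n a b).

Definition coneL (c : 'X_{1..n} * {set 'I_n}) := (resL s c.1, inL s @^-1: c.2).
Definition coneR (c : 'X_{1..n} * {set 'I_n}) := (resR s c.1, inR s @^-1: c.2).
Definition cone_join (c : 'X_{1..a} * {set 'I_a}) (c' : 'X_{1..b} * {set 'I_b}) :=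
  (join s c.1 c'.1, [set k | match side s k with inl i => i \in c.2 | inr j => j \in c'.2 end]).

Lemma in_cone_split c v :
  in_cone c v = in_cone (coneL c) (resL s v) && in_cone (coneR c) (resR s v).
Proof.
apply/forallP/andP => [cv|[/forallP cL /forallP cR] k].
  by split; apply/forallP => i; rewrite inE !mnmE.
have := cL; have := cR; rewrite -(sideK s k).
by case: (side s k) => i => [_ /(_ i)|/(_ i) + _]; rewrite inE !mnmE.
Qed.

Lemma cone_joinL c c' : coneL (cone_join c c') = c.
Proof.
case: c => u Z; rewrite /coneL /= joinKL; congr pair.
by apply/setP => i; rewrite !inE side_inL.
Qed.

Lemma cone_joinR c c' : coneR (cone_join c c') = c'.
Proof.
case: c' => u Z; rewrite /coneR /= joinKR; congr pair.
by apply/setP => i; rewrite !inE side_inR.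
Qed.

Lemma inL_inj : injective (inL s).
Proof. by move=> i j /(congr1 (side s)); rewrite !side_inL => -[]. Qed.

Lemma inR_inj : injective (inR s).
Proof. by move=> i j /(congr1 (side s)); rewrite !side_inR => -[]. Qed.

Lemma card_split (Z : {set 'I_n}) :
  #|Z| = (#|inL s @^-1: Z| + #|inR s @^-1: Z|)%N.
Proof.
have {1}-> : Z = inL s @: (inL s @^-1: Z) :|: inR s @: (inR s @^-1: Z).
  apply/setP => k; rewrite inE; apply/idP/orP => [kZ|[]]; last 2 first.
  - by move=> /imsetP[i + ->]; rewrite inE.
  - by move=> /imsetP[i + ->]; rewrite inE.
  move: kZ; rewrite -(sideK s k); case: (side s k) => i iZ; [left|right];
    by rewrite imset_f // inE.
rewrite cardsU [X in (_ - X)%N](_ : _ = 0%N); last first.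
  apply: eq_card0 => k; rewrite inE; apply/negP => /andP[/imsetP[i _ ->] /imsetP[j _]].
  by move/(congr1 (side s)); rewrite side_inL side_inR.
by rewrite subn0 !card_imset; [|exact: inR_inj|exact: inL_inj].
Qed.

Lemma has_sdepth_tensor X1 X2 d1 d2 :
  has_sdepth X1 d1 -> has_sdepth X2 d2 -> has_sdepth (tensorU s X1 X2) (d1 + d2).
Proof.
move=> [l1 lX1 ld1] [l2 lX2 ld2].
exists [seq cone_join c c' | c <- l1, c' <- l2] => [v|_ /allpairsP[[c c'] /= [cl cl' ->]]].
  have -> : `[< tensorU s X1 X2 v >] = `[< X1 (resL s v) >] && `[< X2 (resR s v) >].
    by rewrite -asbool_and.
  rewrite -mulnb -lX1 -lX2; elim: l1 {lX1 ld1} => //= c l1 IH.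
  rewrite count_cat IH mulnDl count_map; congr (_ + _)%N.
  under eq_count => c' do rewrite /= in_cone_split cone_joinL cone_joinR.
  by case: (in_cone c _); rewrite ?mul1n // mul0n count_pred0.
rewrite card_split; have -> : inL s @^-1: (cone_join c c').2 = c.2.
  exact: (congr1 snd (cone_joinL c c')).
have -> : inR s @^-1: (cone_join c c').2 = c'.2.
  exact: (congr1 snd (cone_joinR c c')).
by rewrite leq_add ?ld1 ?ld2.
Qed.

(** A cone meets a slice in a cone that has lost at most the [b] directions
    transversal to the slice. *)
Lemma has_sdepth_slice X be d :
  has_sdepth X d -> has_sdepth (fun al => X (join s al be)) (d - b).
Proof.
move=> [l lX ld]; exists [seq coneL c | c <- l & in_cone (coneR c) be] => [al|].
  rewrite -lX count_map count_filter; apply: eq_count => c /=.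
  by rewrite in_cone_split joinKL joinKR.
move=> c' /mapP[c]; rewrite mem_filter => /andP[_ /ld dc] {c'}->.
rewrite leq_subLR addnC; apply: leq_trans dc _; rewrite card_split leq_add2l.
by have := max_card (mem (inR s @^-1: c.2)); rewrite card_ord.
Qed.

Lemma tensor_diff U1 V1 U2 V2 v :
  (tensorU s U1 U2 v /\ ~ tensorV s U1 V1 U2 V2 v) <->
  tensorU s (fun u => U1 u /\ ~ V1 u) (fun u => U2 u /\ ~ V2 u) v.
Proof.
split=> [[[u1 u2] nV]|[[u1 nv1] [u2 nv2]]]; last by split=> // -[_ []].
by split; split=> // Vv; apply: nV; split=> //; [left|right].
Qed.

End SplitCones.

(** ** The ideal of all variables *)

Lemma occurs_setT n (m : 'X_{1..n}) : occurs setT m <-> m <> 0%MM.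
Proof.
split=> [[i _ mi] m0|nz_m]; first by rewrite m0 mnm0E in mi.
apply: contrapT => no; apply: nz_m; apply/mnmP => i; rewrite mnm0E.
by apply/eqP; rewrite eqn0Ngt; apply/negP => mi; apply: no; exists i.
Qed.

Lemma res_eq0 n a b (s : splitting n a b) v :
  v = 0%MM <-> resL s v = 0%MM /\ resR s v = 0%MM.
Proof.
split=> [->|[L0 R0]]; first by split; apply/mnmP => i; rewrite !mnmE.
rewrite -(resK s v) L0 R0; apply/mnmP => k; rewrite !mnmE.
by case: (side s k) => i; rewrite mnm0E.
Qed.

(** Induction from [m] to [3 m] variables in three blocks, arranged cyclically: in
    each of the first three parts one block does not vanish, the next is free and
    the remaining one vanishes, and in the fourth part no block vanishes. Hence the
    bound grows by at least one. *)
Lemma has_sdepth_all_variables d :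
  exists2 m, (0 < m)%N & has_sdepth (occurs [set: 'I_m]) d.
Proof.
suff [m m_gt0 md] : exists2 m, (0 < m)%N & has_sdepth (occurs [set: 'I_m]) d.+1.
  by exists m => //; apply: has_sdepth_le md.
elim: d => [|d [m m_gt0 md]].
  exists 1%N => //; exists [:: (U_(ord0)%MM, setT)] => [v|c]; last first.
    by rewrite inE => /eqP ->; rewrite cardsT card_ord.
  rewrite /= addn0; congr nat_of_bool; apply/forallP/asboolP => [v0|[i _ vi] j].
    by exists ord0 => //; have := v0 ord0; rewrite inE mnm1E.
  by rewrite (ord1 i) in vi; rewrite inE mnm1E (ord1 j).
pose s1 := ord_splitting (m + m) m; pose s2 := ord_splitting m m.
pose occ := occurs [set: 'I_m]; pose zero (v : 'X_{1..m}) := v = 0%MM.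
pose all (v : 'X_{1..m}) := True.
have m0 := has_sdepth_zero m; have mT := has_sdepth_full m.
exists (m + m + m)%N; first by rewrite !addn_gt0 m_gt0.
pose C1 := tensorU s1 (tensorU s2 occ all) zero.
pose C2 := tensorU s1 (tensorU s2 zero occ) all.
pose C3 := tensorU s1 (tensorU s2 all zero) occ.
pose C4 := tensorU s1 (tensorU s2 occ occ) occ.
have C1d : has_sdepth C1 d.+2.
  have h := has_sdepth_tensor s1 (has_sdepth_tensor s2 md mT) m0.
  by apply: has_sdepth_le h; lia.
have C2d : has_sdepth C2 d.+2.
  have h := has_sdepth_tensor s1 (has_sdepth_tensor s2 m0 md) mT.
  by apply: has_sdepth_le h; lia.
have C3d : has_sdepth C3 d.+2.
  have h := has_sdepth_tensor s1 (has_sdepth_tensor s2 mT m0) md.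
  by apply: has_sdepth_le h; lia.
have C4d : has_sdepth C4 d.+2.
  have h := has_sdepth_tensor s1 (has_sdepth_tensor s2 md md) md.
  by apply: has_sdepth_le h; lia.
have occE v : occ v <-> ~ zero v by apply: occurs_setT.
apply: eq_has_sdepth (has_sdepth_union _ C1d (has_sdepth_union _ C2d (has_sdepth_union _ C3d C4d))).
- move=> v; rewrite occurs_setT (res_eq0 s1) (res_eq0 s2) /C1 /C2 /C3 /C4 /tensorU /=.
  rewrite !occE /zero /all.
  move: (resL s2 _ = _) (resR s2 _ = _) (resR s1 v = _) => A B C.
  by case: (pselect A) => a; case: (pselect B) => b; case: (pselect C) => c; tauto.
- by move=> v [[/occE oA _] z]; rewrite /C2 /C3 /C4 /tensorU !occE; tauto.
- by move=> v [[z o] _]; rewrite /C3 /C4 /tensorU !occE; move: o; rewrite !occE; tauto.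
- by move=> v [[_ z] o]; rewrite /C4 /tensorU !occE; tauto.
Qed.

(** The set is the union of two coordinate subspaces that meet in 0: take all of
    the first, and the nonzero part of the second. *)
Lemma has_sdepth_two_subspaces d :
  exists2 m, (0 < m)%N & let s := ord_splitting m m in
    has_sdepth (fun v => True /\ ~ occurs_both (inL s @: setT) (inR s @: setT) v) d.
Proof.
have [m m_gt0 md] := has_sdepth_all_variables d; exists m => // s.
have dm : (d <= m)%N.
  apply: (has_sdepth_bound (v := U_(Ordinal m_gt0)%MM)) md.
  by exists (Ordinal m_gt0); rewrite ?mnm1E ?eqxx.
have m0 := has_sdepth_zero m; have mT := has_sdepth_le dm (has_sdepth_full m).
have h1 := has_sdepth_tensor s mT m0; have h2 := has_sdepth_tensor s m0 md.
rewrite addn0 in h1; rewrite add0n in h2.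
apply: eq_has_sdepth (has_sdepth_union _ h1 h2); last first.
  by move=> v [_ v0] [_ /occurs_setT].
have occL v : occurs (inL s @: setT) v <-> resL s v <> 0%MM.
  rewrite -occurs_setT; split=> [[_ /imsetP[i _ ->] vi]|[i _ vi]].
    by exists i; rewrite ?mnmE.
  by exists (inL s i); rewrite ?imset_f // -[v _](mnmE (fun i => v (inL s i))).
have occR v : occurs (inR s @: setT) v <-> resR s v <> 0%MM.
  rewrite -occurs_setT; split=> [[_ /imsetP[i _ ->] vi]|[i _ vi]].
    by exists i; rewrite ?mnmE.
  by exists (inR s i); rewrite ?imset_f // -[v _](mnmE (fun i => v (inR s i))).
move=> v; rewrite /occurs_both occL occR /tensorU occurs_setT.
move: (resL s v = _) (resR s v = _) => A B.
by case: (pselect A) => a; case: (pselect B) => b; tauto.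
Qed.

(** * Depth and Stanley depth of monomially presented modules *)

Section Presentations.
Variables (n : nat) (K : fieldType).
Local Notation S := {mpoly K[n]}.
Implicit Types (p q : S) (U V : 'X_{1..n} -> Prop).

Lemma extend_seqP (U V : S -> Prop) fs p :
  U 0 -> extend_seq U V fs p <->
  exists v (y : nat -> S), [/\ V v, forall i, U (y i)
    & p = v + \sum_(i < size fs) fs`_i * y i].
Proof.
move=> U0; elim/last_ind: fs p => [|fs f IH] p /=.
  split=> [Vp|[v [y [Vv _ ->]]]]; last by rewrite big_ord0 addr0.
  by exists p, (fun=> 0); rewrite big_ord0 addr0.
have nth_fs (i : 'I_(size fs)) : (rcons fs f)`_i = fs`_i by rewrite nth_rcons ltn_ord.
rewrite extend_seq_rcons size_rcons; split.
  move=> [_ [u [/IH [v [y [Vv Uy ->]]] Uu ->]]].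
  exists v, (fun i => if i == size fs then u else y i); split=> // [i|].
    by case: ifP.
  rewrite big_ord_recr /= nth_rcons ltnn eqxx addrA; congr (_ + _ + _).
  by apply: eq_bigr => i _; rewrite nth_fs ltn_eqF.
move=> [v [y [Vv Uy ->]]]; rewrite big_ord_recr /= nth_rcons ltnn eqxx addrA.
exists (v + \sum_(i < size fs) fs`_i * y i), (y (size fs)); split=> //.
  by apply/IH; exists v, y.
by congr (_ + _ + _); apply: eq_bigr => i _; rewrite nth_fs.
Qed.

Lemma regularP (U V : S -> Prop) fs : regular U V fs <->
  forall k, (k < size fs)%N -> nonzerodivisor U (extend_seq U V (take k fs)) fs`_k.
Proof.
elim: fs V => [|f fs IH] V //=; split=> [[Vf /IH reg] [|k]|reg] //=.
  by rewrite ltnS; apply: reg.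
split; first exact: (reg 0%N).
by apply/IH => k kfs; apply: (reg k.+1).
Qed.

Variables (M : lmodType S) (G : Zn_grading M).

(** [phi] identifies the graded module [M] with the quotient of the ideal
    spanned by [U] by the one spanned by [V]. *)
Definition presents U V (phi : S -> M) : Prop :=
  [/\ forall s p q, mono_ideal U p -> mono_ideal U q -> phi (s * p + q) = s *: phi p + phi q,
      forall x, exists2 p, mono_ideal U p & x = phi p,
      forall p, mono_ideal U p -> (phi p = 0 <-> mono_ideal V p)
    & forall a x, hcomp G a x <-> exists p, [/\ mono_ideal U p, poly_hcomp a p & x = phi p]].

Variables (U V : 'X_{1..n} -> Prop) (phi : S -> M).
Hypotheses (mUV : mono_module U V) (phiP : presents U V phi).

Let upU : upset U. Proof. by case: mUV. Qed.
Let upV : upset V. Proof. by case: mUV. Qed.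
Let iU : ideal (@mono_ideal n K U). Proof. exact: mono_ideal_ideal. Qed.
Let iV : ideal (@mono_ideal n K V). Proof. exact: mono_ideal_ideal. Qed.
Let U0 : @mono_ideal n K U 0. Proof. by case: iU. Qed.
Let UM s p : mono_ideal U p -> mono_ideal U (s * p : S).
Proof. by case: iU => _ _; apply. Qed.

Lemma presents_eq0 p : mono_ideal U p -> (phi p = 0 <-> mono_ideal V p).
Proof. by case: phiP => _ _ + _; apply. Qed.

Lemma presents0 : phi 0 = 0.
Proof. by apply/presents_eq0 => //; case: iV. Qed.

Lemma presentsM s p : mono_ideal U p -> phi (s * p) = s *: phi p.
Proof.
move=> Up; have [lin _ _ _] := phiP.
by rewrite -[s * p]addr0 lin // presents0 addr0.
Qed.

Lemma presents_lin s p q : mono_ideal U p -> mono_ideal U q ->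
  phi (s * p + q) = s *: phi p + phi q.
Proof. by case: phiP => + _ _ _; apply. Qed.

Lemma presents_sum (I : Type) (r : seq I) (P : pred I) (s F : I -> S) :
  (forall i, mono_ideal U (F i)) ->
  phi (\sum_(i <- r | P i) s i * F i) = \sum_(i <- r | P i) s i *: phi (F i).
Proof.
move=> UF; suff [] : mono_ideal U (\sum_(i <- r | P i) s i * F i) /\
  phi (\sum_(i <- r | P i) s i * F i) = \sum_(i <- r | P i) s i *: phi (F i) by [].
elim/big_rec2: _ => [|i x y _ [Uy eq_xy]]; first by split=> //; apply: presents0.
split; first by have [_ UD _] := iU; apply: UD => //; apply: UM.
by rewrite presents_lin // eq_xy.
Qed.

Lemma presentsB p q : mono_ideal U p -> mono_ideal U q ->
  phi p = phi q <-> mono_ideal V (p - q).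
Proof.
move=> Up Uq; have Upq : mono_ideal U (p - q) by apply: (idealB iU).
rewrite -presents_eq0 // (_ : p - q = (- 1) * q + p); last by rewrite mulN1r addrC.
rewrite presents_lin // scaleN1r addrC.
by split=> [->|/subr0_eq //]; rewrite subrr.
Qed.

Lemma presents_in_ideal_mul fs p : mono_ideal U p ->
  in_ideal_mul fs (phi p) <-> extend_seq (mono_ideal U) (mono_ideal V) fs p.
Proof.
move=> Up; rewrite extend_seqP //.
have Usum (y : nat -> S) : (forall i, mono_ideal U (y i)) ->
    mono_ideal U (\sum_(i < size fs) fs`_i * y i).
  by move=> Uy; apply: (subspace_sum (ideal_subspace iU)) => i _; apply: UM.
split=> [[x def_x]|[v [y [Vv Uy def_p]]]].
  have [_ surj _ _] := phiP.
  have /choice [y yP] : forall i, exists q, mono_ideal U q /\ x i = phi q.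
    by move=> i; have [q] := surj (x i); exists q.
  have Uy i : mono_ideal U (y i) by have [] := yP i.
  exists (p - \sum_(i < size fs) fs`_i * y i), y; split=> //; last by rewrite subrK.
  apply/presentsB => //; first exact: Usum.
  rewrite def_x (@presents_sum _ _ _ (fun i : 'I_(size fs) => fs`_i) (fun i => y i)) //.
  by apply: eq_bigr => i _; have [_ ->] := yP i.
exists (fun i => phi (y i)).
rewrite -(@presents_sum _ _ _ (fun i : 'I_(size fs) => fs`_i) (fun i => y i)) //.
by apply/presentsB => //; [exact: Usum | rewrite def_p addrK].
Qed.

Lemma presents_regular fs :
  regular_seq M fs <-> regular (mono_ideal U) (mono_ideal V) fs /\
    exists2 x, mono_ideal U x & ~ extend_seq (mono_ideal U) (mono_ideal V) fs x.
Proof.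
have [_ surj _ _] := phiP; rewrite regularP /regular_seq; split=> -[reg proper]; split.
- move=> k kfs x Ux Wx; apply/presents_in_ideal_mul => //; apply: reg => //.
  by rewrite -presentsM //; apply/presents_in_ideal_mul => //; apply: UM.
- have [x nx] := proper; have [p Up def_x] := surj x; exists p => // Wp; apply: nx.
  by rewrite def_x; apply/presents_in_ideal_mul.
- move=> k kfs x; have [p Up ->] := surj x; rewrite -presentsM //.
  move/presents_in_ideal_mul => /(_ (@UM _ _ Up)) Wp.
  by apply/presents_in_ideal_mul => //; apply: reg.
- by have [p Up nWp] := proper; exists (phi p) => /presents_in_ideal_mul-/(_ Up).
Qed.

Theorem depth_presents d :
  has_depth (@mono_ideal n K U) (mono_ideal V) d -> depth M = d.
Proof.
move=> [fs [irr_fs reg_fs def_d soc]]; apply: nat_maxP; split.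
  exists fs; split=> //; apply/presents_regular; split=> //.
  by have [u [Uu nWu _]] := soc; exists u.
move=> e [gs [irr_gs /presents_regular [reg_gs _] <-]]; rewrite -def_d.
exact: (regular_size_le iU iV irr_fs irr_gs reg_fs soc reg_gs).
Qed.

(** ** Stanley decompositions *)

Lemma in_coneP (c : 'X_{1..n} * {set 'I_n}) v :
  in_cone c v <-> exists2 w, v = (w + c.1)%MM & forall i, i \notin c.2 -> w i = 0%N.
Proof.
split=> [/forallP cv|[w -> wP]].
  exists (v - c.1)%MM => [|i ic]; last first.
    by have := cv i; rewrite (negPf ic) mnmBE => /eqP ->; rewrite subnn.
  by rewrite submK //; apply/mnm_lepP => i; have := cv i; case: ifP => // _ /eqP ->.
apply/forallP => i; rewrite mnmDE; case: ifPn => [_|/wP ->]; first exact: leq_addl.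
by rewrite add0n.
Qed.

Lemma homogeneous_monomial a p : poly_hcomp a p -> p != 0 ->
  exists c u, [/\ c != 0, mdegZ u = a & p = c *: 'X_[u]].
Proof.
move=> ap nz_p; exists (mleadc p), (mlead p).
have up := mlead_supp nz_p; split; [by rewrite mleadc_eq0|exact: ap|].
rewrite {1}[p]mpolyE (perm_big [:: mlead p]) ?big_seq1 //.
apply: uniq_perm; rewrite ?msupp_uniq // => m; rewrite inE.
by apply/idP/eqP => [/ap am|-> //]; apply: (@mdegZ_inj n); rewrite am ap.
Qed.

Lemma in_varsX (Z : {set 'I_n}) (w : 'X_{1..n}) :
  (forall i, i \notin Z -> w i = 0%N) -> in_vars Z ('X_[w] : S).
Proof. by move=> wP m; rewrite msuppX inE => /eqP ->. Qed.

Lemma in_varsZ (Z : {set 'I_n}) c p : in_vars Z p -> in_vars Z (c *: p).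
Proof. by move=> pP m /msuppZ_le; apply: pP. Qed.

Let X v := U v /\ ~ V v.

(** Homogeneous elements are monomials up to scalars. Freeness keeps the cones
    outside [V], spanning makes them cover, and directness makes them disjoint. *)
Lemma stanley_decomposition_cones t (m : 'I_t -> M) Z :
  stanley_decomposition G m Z ->
  exists u : 'I_t -> 'X_{1..n}, cone_family X (fun i => (u i, Z i)).
Proof.
move=> [hom_m free span direct]; have [_ surj _ hcompE] := phiP.
have nz_m i : m i <> 0.
  move=> mi0; have := free i 1; rewrite mi0 scaler0 -mpolyX0 => /(_ _ erefl).
  have h : in_vars (Z i) ('X_[0] : S) by apply: in_varsX => k; rewrite mnm0E.
  by move=> /(_ h)/eqP; rewrite mpolyX0 oner_eq0.
have /choice [cu cuP] : forall i, exists cu : K * 'X_{1..n},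
    [/\ cu.1 != 0, X cu.2 & m i = phi (cu.1 *: 'X_[cu.2])].
  move=> i; have [a /hcompE [p [Up ap def_m]]] := hom_m i.
  have nz_p : p != 0.
    by apply/eqP => p0; apply: (nz_m i); rewrite def_m p0 presents0.
  have [c [u [nz_c _ def_p]]] := homogeneous_monomial ap nz_p.
  exists (c, u); rewrite -def_p; split=> //.
  have up : u \in msupp p by rewrite def_p msuppMCX // mem_head.
  split; first exact: Up.
  move=> Vu; apply: (nz_m i); rewrite def_m; apply/presents_eq0 => //.
  rewrite def_p; have [_ _ VZ] := mono_ideal_subspace K V.
  exact/VZ/mono_idealX.
pose u i := (cu i).2; pose c i := (cu i).1.
have nz_c i : c i != 0 by have [] := cuP i.
have Xu i : X (u i) by have [] := cuP i.
have def_m i : m i = phi (c i *: 'X_[u i]) by have [] := cuP i.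
have Um i : mono_ideal U (c i *: 'X_[u i] : S).
  by have [_ _ UZ] := mono_ideal_subspace K U; apply/UZ/mono_idealX; case: (Xu i).
exists u; split=> [v [Uv nVv]|i v /in_coneP [w /= -> wP]|i j v ci cj].
- have UX : mono_ideal U ('X_[v] : S) by apply/mono_idealX.
  have [y [yP def_v]] := span (phi 'X_[v]).
  have /choice [p pP] : forall i, exists p, in_vars (Z i) p /\ y i = p *: m i.
    by move=> i; have [p] := yP i; exists p.
  have Vdiff : mono_ideal V ('X_[v] - \sum_i p i * (c i *: 'X_[u i]) : S).
    apply/presentsB => //.
      by apply: (subspace_sum (ideal_subspace iU)) => i _; apply: UM.
    rewrite (@presents_sum _ _ _ (fun i => p i) (fun i => c i *: 'X_[u i])) // def_v.
    by apply: eq_bigr => i _; have [_ ->] := pP i; rewrite def_m.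
  have := mono_ideal_coeff Vdiff nVv.
  rewrite mcoeffB mcoeffX eqxx raddf_sum /= mulr1n => /subr0_eq one.
  have [i nz_i] : exists i, (p i * (c i *: 'X_[u i]))@_v != 0.
    apply: contrapT => noi; have := oner_neq0 K; rewrite one big1 ?eqxx // => i _.
    by apply/eqP/negPn/negP => nz; apply: noi; exists i.
  exists i; apply/in_coneP; exists (v - u i)%MM; move: nz_i;
    rewrite -scalerAr mulrC mcoeffZ mcoeffXM; case: ifP => [uv|]; rewrite ?mulr0 ?eqxx //.
    by rewrite submK.
  rewrite mulf_eq0 negb_or -mcoeff_msupp => /andP[_ pi_v] k kZ.
  by have [pZ _] := pP i; apply: pZ pi_v _ kZ.
- have Uw : U (w + u i)%MM by apply: upU (lem_addl _ _) _; case: (Xu i).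
  split=> // Vw; have /eqP : 'X_[w] = 0 :> S.
    apply: (free i); first exact: in_varsX.
    rewrite def_m -presentsM //; apply/presents_eq0; first exact: UM.
    rewrite -scalerAr -mpolyXD; have [_ _ VZ] := mono_ideal_subspace K V.
    exact/VZ/mono_idealX.
  by rewrite -mleadc_eq0 mleadXm mcoeffX eqxx oner_eq0.
have [[w /= vi wP] [w' /= vj wP']] := ((in_coneP _ _).1 ci, (in_coneP _ _).1 cj).
apply: contrapT => neq_ij; have neq_ji : (j == i) = false by apply/eqP => ji; apply: neq_ij.
have Uv a : mono_ideal U (a *: 'X_[v] : S).
  have [_ _ UZ] := mono_ideal_subspace K U; apply/UZ/mono_idealX; rewrite vi.
  by apply: upU (lem_addl _ _) _; case: (Xu i).
pose y k : M := if k == i then (c j *: 'X_[w]) *: m i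
             else if k == j then ((- c i) *: 'X_[w']) *: m j else 0.
have yi0 : y i = 0.
  apply: direct => [k|]; rewrite /y.
    case: eqP => [->|_]; first by exists (c j *: 'X_[w]) => //; apply/in_varsZ/in_varsX.
    case: eqP => [->|_]; first by exists ((- c i) *: 'X_[w']) => //; apply/in_varsZ/in_varsX.
    by exists 0; [move=> q; rewrite msupp0 | rewrite scale0r].
  rewrite (bigD1 i) //= eqxx (bigD1 j) ?neq_ji //= eqxx big1 ?addr0.
    rewrite !def_m -!presentsM // -!scalerAl -!scalerAr -!mpolyXD -vi -vj !scalerA.
    rewrite -[X in X + _]scale1r -presents_lin ?mul1r.
    + by rewrite mulNr mulrC scaleNr subrr presents0.
    + exact: Uv.
    + exact: Uv.
  by move=> k /andP[/negPf -> /negPf ->].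
have /eqP : c j *: 'X_[w] = 0 :> S.
  by apply: (free i); [apply/in_varsZ/in_varsX | move: yi0; rewrite /y eqxx].
rewrite scaler_eq0 (negPf (nz_c j)) /=.
by rewrite -mleadc_eq0 mleadXm mcoeffX eqxx oner_eq0.
Qed.

Lemma cones_stanley_decomposition t (c : 'I_t -> 'X_{1..n} * {set 'I_n}) :
  cone_family X c ->
  stanley_decomposition G (fun i => phi 'X_[(c i).1]) (fun i => (c i).2).
Proof.
move=> [cov sub uniq_c]; have [_ surj _ hcompE] := phiP.
have cone_base i : X (c i).1.
  by apply: (sub i); apply/in_coneP; exists 0%MM => [|k _]; rewrite ?add0m ?mnm0E.
have UX i : mono_ideal U ('X_[(c i).1] : S) by apply/mono_idealX; case: (cone_base i).
have in_c i (p : S) w : in_vars (c i).2 p -> w \in msupp p -> in_cone (c i) (w + (c i).1)%MM.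
  by move=> pP wp; apply/in_coneP; exists w => // k kc; apply: pP wp _ kc.
split=> [i|i p pP|x|y yP].
- exists (mdegZ (c i).1); apply/hcompE; exists 'X_[(c i).1]; split=> //.
  by move=> m; rewrite msuppX inE => /eqP ->.
- rewrite -presentsM // presents_eq0 => [Vp|]; last exact: UM.
  apply/mpolyP => w; rewrite mcoeff0; apply/eqP/negPn/negP; rewrite -mcoeff_msupp => wp.
  have [_ []] := sub i _ (in_c i p w pP wp); apply: Vp.
  by rewrite mcoeff_msupp mulrC addmC mcoeffXM lem_addr addmC addmK -mcoeff_msupp.
- have [q Uq ->] := surj x.
  pose p i : S := \sum_(v <- msupp q | in_cone (c i) v) q@_v *: 'X_[v - (c i).1].
  exists (fun i => p i *: phi 'X_[(c i).1]); split=> [i|].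
    exists (p i) => // w wp.
    have [v cv def_w] : exists2 v, in_cone (c i) v & w = (v - (c i).1)%MM.
      apply: contrapT => nov; move: wp; rewrite mcoeff_msupp /p raddf_sum big1 ?eqxx //= => v cv.
      rewrite mcoeffZ mcoeffX; case: eqP => [e|]; last by rewrite mulr0.
      by case: nov; exists v.
    by have [w' def_v wP] := (in_coneP _ _).1 cv; rewrite def_w def_v addmK.
  rewrite -(@presents_sum _ _ _ p (fun i => 'X_[(c i).1])) //.
  apply/presentsB => //.
    by apply: (subspace_sum (ideal_subspace iU)) => i _; apply: UM.
  have pE i : p i * 'X_[(c i).1] = \sum_(v <- msupp q | in_cone (c i) v) q@_v *: 'X_[v].
    rewrite mulr_suml; apply: eq_bigr => v /in_coneP[w def_v _].
    by rewrite -scalerAl -mpolyXD def_v addmK.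
  under eq_bigr => i _ do rewrite pE.
  rewrite {1}[q]mpolyE (exchange_big_dep xpredT) //= -sumrB.
  apply: (subspace_sum (mono_ideal_subspace K V)) => v vq.
  case: (pselect (X v)) => [Xv|nXv].
    have [i ci] := cov v Xv; rewrite (big_pred1 i) ?subrr //.
      by have [] := mono_ideal_subspace K V.
    by move=> j; apply/idP/eqP => [cj|-> //]; apply: uniq_c ci.
  have Vv : V v by apply: contrapT => nVv; apply: nXv; split=> //; apply: Uq.
  rewrite big1 ?subr0; last by move=> i /sub.
  by have [_ _ VZ] := mono_ideal_subspace K V; apply/VZ/mono_idealX.
have /choice [p pP] : forall i, exists p, in_vars (c i).2 p /\ y i = p *: phi 'X_[(c i).1].
  by move=> i; have [p] := yP i; exists p.
move=> sum0 i; suff -> : y i = p i *: phi 'X_[(c i).1].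
  suff -> : p i = 0 by rewrite scale0r.
  have Vsum : mono_ideal V (\sum_i p i * 'X_[(c i).1] : S).
    apply/presents_eq0; first by apply: (subspace_sum (ideal_subspace iU)) => k _; apply: UM.
    rewrite (@presents_sum _ _ _ p (fun i => 'X_[(c i).1])) // -[RHS]sum0.
    by apply: eq_bigr => k _; have [_ ->] := pP k.
  apply/mpolyP => w; rewrite mcoeff0; apply/eqP/negPn/negP; rewrite -mcoeff_msupp => wp.
  have [piZ _] := pP i; have cw := in_c i _ w piZ wp.
  have [_ nVw] := sub i _ cw.
  have := mono_ideal_coeff Vsum nVw; rewrite raddf_sum (bigD1 i) //= big1.
    rewrite mulrC mcoeffXM lem_addl addmK addr0; move/eqP.
    by rewrite mcoeff_eq0 wp.
  move=> j ji; rewrite mulrC mcoeffXM; case: ifP => // le_jw.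
  apply: memN_msupp_eq0; apply/negP => wpj; have [pjZ _] := pP j.
  move/eqP: ji; apply; apply: (uniq_c _ _ _ _ cw).
  by have := in_c j _ _ pjZ wpj; rewrite submK.
by have [] := pP i.
Qed.

Theorem sdepth_presents d : is_nat_max (has_sdepth X) d -> sdepth G = d.
Proof.
move=> [Xd max_d]; have [_ _ _ [v0 Uv0 nVv0]] := mUV.
have fwd e : (exists t (m : 'I_t -> M) (Z : 'I_t -> {set 'I_n}),
    stanley_decomposition G m Z /\ sdepth_dec Z = e) -> has_sdepth X e.
  move=> [t [m [Z [/stanley_decomposition_cones [u /cone_familyP part] <-]]]].
  exists [seq (u i, Z i) | i <- enum 'I_t] => // _ /mapP[i _ ->] /=.
  rewrite /sdepth_dec; have := mem_index_enum i; elim: (index_enum _) => //= j r IH.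
  by rewrite inE big_cons geq_min => /predU1P[<-|/IH ->]; rewrite ?leqnn ?orbT.
apply: nat_maxP; split; last by move=> e /fwd; apply: max_d.
have [l part ld] := Xd; pose c (i : 'I_(size l)) := tnth (in_tuple l) i.
have fam : cone_family X c by apply/cone_familyP; rewrite map_tnth_enum.
have dec := cones_stanley_decomposition fam.
exists (size l), (fun i => phi 'X_[(c i).1]), (fun i => (c i).2); split=> //.
apply/eqP; rewrite eqn_leq max_d /=; last first.
  by apply: fwd; exists (size l), (fun i => phi 'X_[(c i).1]), (fun i => (c i).2).
rewrite /sdepth_dec; elim/big_ind: _ => [|a b da db|i _].
- by apply: (has_sdepth_bound (v := v0)) Xd.
- by rewrite leq_min da.
- exact/ld/mem_tnth.
Qed.

End Presentations.

(** * The modules attached to monomial ideals *)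

Section IdealModules.
Variables (n : nat) (K : fieldType).
Local Notation S := {mpoly K[n]}.
Implicit Types (I J : monomial_ideal n K) (p : S) (m : 'X_{1..n}).

Definition exponents I m : Prop := ('X_[m] : S) \in ideal_of I.

Lemma exponents_upset I : upset (exponents I).
Proof.
move=> u v uv Iu; rewrite /exponents -(submK uv) mpolyXD.
exact: (@rpredZ _ (S^o : lmodType S) (ideal_of I) 'X_[v - u] _ Iu).
Qed.

Lemma in_ideal_exponents I p : p \in ideal_of I <-> mono_ideal (exponents I) p.
Proof.
split=> [Ip m pm|Ip]; first exact: msupp_monomial_ideal Ip pm.
rewrite (mpolyE p) big_seq; apply: rpred_sum => m /Ip Im.
rewrite -mul_mpolyC.
exact: (@rpredZ _ (S^o : lmodType S) (ideal_of I) _%:MP _ Im).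
Qed.

Lemma ideal_nonzeroP I : ideal_nonzero I <-> exists m, exponents I m.
Proof.
split=> [[p /in_ideal_exponents Ip nz_p]|[m Im]].
  by exists (mlead p); apply/Ip/mlead_supp.
exists 'X_[m] => //; by rewrite -mleadc_eq0 mleadXm mcoeffX eqxx oner_eq0.
Qed.

Lemma ideal_properP I : ideal_proper I <-> ~ exponents I 0%MM.
Proof. by rewrite /exponents mpolyX0 /ideal_proper; split=> /negP. Qed.

Lemma exponents_min I m : exponents I m ->
  exists2 u, min_monomial_gen I u & (u <= m)%MM.
Proof.
have [d] := ubnP (mdeg m); elim: d m => // d IH m md Im.
case: (pselect (min_monomial_gen I m)) => [min_m|not_min].
  by exists m; rewrite ?lepm_refl.
have [v [Iv vm nvm]] : exists v, [/\ exponents I v, (v <= m)%MM & v <> m].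
  apply: contrapT => nov; apply: not_min; split=> // v Iv vm.
  by apply: contrapT => nvm; apply: nov; exists v.
have [|u min_u uv] := IH v _ Iv; last by exists u => //; apply: lepm_trans uv vm.
move: md; rewrite ltnS; apply: leq_trans; rewrite -(submK vm) mdegD -[X in (X < _)%N]add0n ltn_add2r.
rewrite lt0n mdeg_eq0; apply/eqP => mv0; apply: nvm.
by rewrite -(submK vm) mv0 add0m.
Qed.

Lemma quot_presents I :
  presents (quot_ideal_grading I) (fun=> True) (exponents I) (@quotmod_pi _ _ (ideal_of I)).
Proof.
split=> [s p q _ _|x|p _|a x].
- by rewrite quotmod_piD quotmod_piZE.
- by exists (repr (x : Quotient.quot (submod_zmod (ideal_of I)))); rewrite ?quotmod_reprK.
- rewrite -in_ideal_exponents -(quotmod_pi0 (ideal_of I)).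
  by rewrite (quotmod_piP (ideal_of I)) subr0.
by split=> [[p ap ->]|[p [_ ap ->]]]; exists p.
Qed.

Definition to_ideal J (p : S) : ideal_mod J := insubd (0 : ideal_mod J) (p : S^o).

Lemma val_to_ideal J p : mono_ideal (exponents J) p -> val (to_ideal J p) = p.
Proof. by move/in_ideal_exponents => Jp; rewrite val_insubd Jp. Qed.

Lemma ideal_presents J :
  presents (ideal_mod_grading J) (exponents J) (fun=> False) (to_ideal J).
Proof.
have iJ : ideal (@mono_ideal n K (exponents J)).
  exact: mono_ideal_ideal (exponents_upset (I := J)).
have [J0 JD JM] := iJ.
split=> [s p q Jp Jq|x|p Jp|a x].
- apply: val_inj; rewrite val_to_ideal; last by apply: JD => //; apply: JM.
  by rewrite linearP /= !val_to_ideal.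
- have Jx : mono_ideal (exponents J) (val x) by apply/in_ideal_exponents/valP.
  by exists (val x) => //; apply: val_inj; rewrite val_to_ideal.
- split=> [|p0].
    by move/(congr1 val); rewrite val_to_ideal // => ->; rewrite raddf0 => m; rewrite msupp0.
  apply: val_inj; rewrite val_to_ideal // raddf0; apply/msuppnil0.
  case E: (msupp p) => [//|m l]; case: (p0 m _).
  by rewrite E mem_head.
split=> [ax|[p [Jp ap ->]]].
  have Jx : mono_ideal (exponents J) (val x) by apply/in_ideal_exponents/valP.
  by exists (val x); split=> //; apply: val_inj; rewrite val_to_ideal.
by rewrite /= /sub_hcomp val_to_ideal.
Qed.

Lemma exponents_sum I J m :
  exponents (ideal_sum I J) m <-> exponents I m \/ exponents J m.
Proof.
split=> [/asboolP [q [r [Iq Jr def_m]]]|IJm]; last first.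
  apply/asboolP; case: IJm => Xm; [exists 'X_[m], 0 | exists 0, 'X_[m]];
    by rewrite rpred0 ?addr0 ?add0r.
have nz : q@_m + r@_m != 0 by rewrite -mcoeffD -def_m mcoeffX eqxx oner_eq0.
have [q0|nz_q] := eqVneq q@_m 0.
  right; move/in_ideal_exponents: Jr; apply; rewrite mcoeff_msupp.
  by move: nz; rewrite q0 add0r.
by left; move/in_ideal_exponents: Iq; apply; rewrite mcoeff_msupp.
Qed.

(** [(I + J)/I] is presented as the isomorphic module [J/(I :&: J)], because this
    is what becomes a tensor product when the supports are disjoint. *)
Lemma sum_quot_presents I J :
  presents (sum_quot_grading I J) (exponents J) (fun m => exponents I m /\ exponents J m)
    (fun p => @quotmod_pi _ _ (res_submod (ideal_of (ideal_sum I J)) (ideal_of I))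
                (to_ideal (ideal_sum I J) p)).
Proof.
set IJ := ideal_sum I J; set N := res_submod _ _.
have JIJ p : mono_ideal (exponents J) p -> mono_ideal (exponents IJ) p.
  by move=> Jp m /Jp Jm; apply/exponents_sum; right.
have [lin _ _ _] := ideal_presents IJ.
have valIJ p : mono_ideal (exponents J) p -> val (to_ideal IJ p) = p.
  by move=> /JIJ; apply: val_to_ideal.
split=> [s p q /JIJ Jp /JIJ Jq|x|p Jp|a x].
- by rewrite lin // quotmod_piD quotmod_piZE.
- pose y := repr (x : Quotient.quot (submod_zmod N)).
  have /asboolP [q [r [Iq Jr def_y]]] : val y \in ideal_of IJ by apply: valP.
  have Jr' : mono_ideal (exponents J) r by apply/in_ideal_exponents.
  exists r => //; rewrite -(quotmod_reprK x) -/y; apply/quotmod_piP.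
  by rewrite unfold_in /res_pred raddfB /= valIJ // def_y addrK.
- rewrite -(quotmod_pi0 N) (quotmod_piP N) subr0 unfold_in /res_pred valIJ //.
  rewrite in_ideal_exponents; split=> [Ip m pm|IJp m pm].
    by split; [apply: Ip | apply: Jp].
  by have [] := IJp m pm.
split=> [[y ay ->]|[p [Jp ap ->]]]; last first.
  by exists (to_ideal IJ p) => //; rewrite /= /sub_hcomp valIJ.
rewrite /= /sub_hcomp in ay.
have IJy : mono_ideal (exponents IJ) (val y) by apply/in_ideal_exponents/valP.
have J0 : mono_ideal (exponents J) (0 : S) by move=> m; rewrite msupp0.
case: (pselect (val y \in ideal_of I)) => Iy.
  exists 0; split=> //; first exact: poly_hcomp0.
  by apply/quotmod_piP; rewrite unfold_in /res_pred raddfB /= valIJ // subr0.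
have Jy : mono_ideal (exponents J) (val y).
  move=> m ym; have /exponents_sum [Im|//] := IJy m ym.
  case: Iy; apply/in_ideal_exponents => m' ym'.
  have -> // : m' = m by apply: (@mdegZ_inj n); rewrite (ay m ym) (ay m' ym').
exists (val y); split=> //; congr quotmod_pi.
by apply: val_inj; rewrite val_to_ideal.
Qed.

(** ** Monomial ideals from up-sets *)

Section FromUpset.
Variables (U : 'X_{1..n} -> Prop) (upU : upset U).

Definition upset_pred (_ : upset U) : {pred (S^o : lmodType S)} :=
  fun p => `[< mono_ideal U (p : S) >].

Fact upset_submod_closed : submod_closed (upset_pred upU).
Proof.
have [U0 UD UM] := mono_ideal_ideal K upU.
split=> [|a x y /asboolP Ux /asboolP Uy]; apply/asboolP; first exact: U0.
by apply: UD => //; apply: UM.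
Qed.

HB.instance Definition _ := GRing.isSubmodClosed.Build S (S^o : lmodType S)
  (upset_pred upU) upset_submod_closed.

Fact upset_monomial : generated_by_monomials (upset_pred upU).
Proof.
exists U => p; split=> [/asboolP Up|[l [lU ->]]].
  exists [seq ((p@_m)%:MP, m) | m <- msupp p]; split=> [_ /mapP[m /Up Um ->] //|].
  rewrite big_map [LHS]mpolyE; apply: eq_bigr => m _.
  by rewrite mul_mpolyC.
apply/asboolP; apply: (subspace_sum (mono_ideal_subspace K U)) => t /lU Ut.
have [_ _ UM] := mono_ideal_ideal K upU.
exact/UM/mono_idealX.
Qed.

Definition upset_ideal : monomial_ideal n K :=
  @MonomialIdeal n K (upset_pred upU : submodClosed (S^o : lmodType S)) upset_monomial.

Lemma exponents_upset_ideal : exponents upset_ideal = U.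
Proof.
apply/predeqP => m; rewrite /exponents; split=> [/asboolP/mono_idealX //|Um].
exact/asboolP/mono_idealX.
Qed.

End FromUpset.

(** ** Numerical invariants *)

Definition mono_depth (U V : 'X_{1..n} -> Prop) : nat :=
  nat_max (has_depth (@mono_ideal n K U) (mono_ideal V)).

Definition mono_sdepth (U V : 'X_{1..n} -> Prop) : nat :=
  nat_max (has_sdepth (fun v => U v /\ ~ V v)).

Lemma mono_depthE U V d : mono_module U V ->
  has_depth (@mono_ideal n K U) (mono_ideal V) d -> mono_depth U V = d.
Proof.
move=> mUV hd; apply: nat_maxP; split=> // e he.
by rewrite (mono_depth_inj mUV he hd).
Qed.

Lemma mono_depthP U V : mono_module U V ->
  has_depth (@mono_ideal n K U) (mono_ideal V) (mono_depth U V).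
Proof.
by move=> mUV; have [d hd] := mono_depth_exists K mUV; rewrite (mono_depthE mUV hd).
Qed.

Lemma mono_sdepthP U V : mono_module U V ->
  is_nat_max (has_sdepth (fun v => U v /\ ~ V v)) (mono_sdepth U V).
Proof.
by move=> /has_sdepth_max [d hd]; rewrite /mono_sdepth (nat_maxP hd).
Qed.

Lemma presents_invariants (M : lmodType S) (G : Zn_grading M) U V phi :
  mono_module U V -> presents G U V phi ->
  depth M = mono_depth U V /\ sdepth G = mono_sdepth U V.
Proof.
move=> mUV MP; split.
  exact: (depth_presents mUV MP (mono_depthP mUV)).
exact: (sdepth_presents mUV MP (mono_sdepthP mUV)).
Qed.

Lemma quot_mono_module I : ideal_proper I -> mono_module (fun=> True) (exponents I).
Proof.
move/ideal_properP => nI0; split=> //; first exact: exponents_upset.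
by exists 0%MM.
Qed.

Lemma ideal_mono_module I : ideal_nonzero I -> mono_module (exponents I) (fun=> False).
Proof.
move=> /ideal_nonzeroP [m Im]; split=> //; first exact: exponents_upset.
by exists m.
Qed.

End IdealModules.

Arguments mono_depth {n} K U V.
Arguments mono_sdepth {n} U V.

(** * Comparing the two assertions *)

Section Tensor.
Variables (K : fieldType) (n a b : nat) (s : splitting n a b).
Local Notation full := (fun=> True).
Local Notation empty := (fun=> False).

Lemma ideal_mono_module_upset c (W : 'X_{1..c} -> Prop) :
  upset W -> (exists m, W m) -> mono_module W empty.
Proof. by move=> upW [m Wm]; split=> //; exists m. Qed.

Lemma quot_mono_module_upset c (U : 'X_{1..c} -> Prop) :
  upset U -> ~ U 0%MM -> mono_module full U.
Proof. by move=> upU nU0; split=> //; exists 0%MM. Qed.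

Section Modules.
Variables (U1 V1 : 'X_{1..a} -> Prop) (U2 V2 : 'X_{1..b} -> Prop).
Hypotheses (m1 : mono_module U1 V1) (m2 : mono_module U2 V2).

Lemma mono_depth_tensor :
  mono_depth K (tensorU s U1 U2) (tensorV s U1 V1 U2 V2) =
  (mono_depth K U1 V1 + mono_depth K U2 V2)%N.
Proof.
apply: mono_depthE; first exact: tensor_mono_module.
by apply: tensor_depth => //; apply: mono_depthP.
Qed.

Lemma mono_sdepth_tensor :
  (mono_sdepth U1 V1 + mono_sdepth U2 V2 <=
    mono_sdepth (tensorU s U1 U2) (tensorV s U1 V1 U2 V2))%N.
Proof.
have [_] := mono_sdepthP (tensor_mono_module s m1 m2); apply.
have [h1 _] := mono_sdepthP m1; have [h2 _] := mono_sdepthP m2.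
by apply: eq_has_sdepth (has_sdepth_tensor s h1 h2) => v; rewrite tensor_diff.
Qed.

Lemma mono_sdepth_sliceL :
  (mono_sdepth (tensorU s U1 U2) (tensorV s U1 V1 U2 V2) <= mono_sdepth U1 V1 + b)%N.
Proof.
have [h _] := mono_sdepthP (tensor_mono_module s m1 m2).
have [_ _ _ [be Ube nVbe]] := m2; have [_ max1] := mono_sdepthP m1.
rewrite addnC -leq_subLR; apply: max1.
apply: eq_has_sdepth (has_sdepth_slice s be h) => al.
by rewrite tensor_diff /tensorU joinKL joinKR; split=> [[]|].
Qed.

End Modules.

Lemma mono_sdepth_sliceR U1 V1 U2 V2 : mono_module U1 V1 -> mono_module U2 V2 ->
  (mono_sdepth (tensorU s U1 U2) (tensorV s U1 V1 U2 V2) <= mono_sdepth U2 V2 + a)%N.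
Proof.
move=> m1 m2; have [h _] := mono_sdepthP (tensor_mono_module s m1 m2).
have [_ _ _ [al Ual nVal]] := m1; have [_ max2] := mono_sdepthP m2.
rewrite addnC -leq_subLR; apply: max2.
apply: eq_has_sdepth (has_sdepth_slice (swap_splitting s) al h) => be.
rewrite tensor_diff /tensorU -/(resR (swap_splitting s) _).
have -> : resL s (join (swap_splitting s) be al) = al.
  exact: (joinKR (swap_splitting s)).
have -> : resR s (join (swap_splitting s) be al) = be.
  exact: (joinKL (swap_splitting s)).
by split=> [[]|].
Qed.

End Tensor.

Lemma ring_invariants (K : fieldType) n :
  mono_depth K (fun _ : 'X_{1..n} => True) (fun=> False) = n /\
  mono_sdepth (fun _ : 'X_{1..n} => True) (fun=> False) = n.
Proof.
split; first by apply: mono_depthE; [exact: ring_mono_module | exact: depth_ring].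
have [h max_h] := mono_sdepthP (ring_mono_module n).
apply/eqP; rewrite eqn_leq; apply/andP; split.
  exact: (@has_sdepth_bound n _ _ 0%MM (conj I id) h).
by apply: max_h; apply: eq_has_sdepth (has_sdepth_full n) => v; tauto.
Qed.

Definition stanley_inequality (K : fieldType) : Prop :=
  forall (n : nat) (I : monomial_ideal n K),
     (1 <= n)%N -> ideal_nonzero I -> ideal_proper I ->
     (depth (quot_ideal I) <= sdepth (quot_ideal_grading I))%N /\
     (depth (ideal_mod I) <= sdepth (ideal_mod_grading I))%N.

Definition disjoint_stanley_equality (K : fieldType) : Prop :=
  forall (n : nat) (I J : monomial_ideal n K),
     (1 <= n)%N ->
     ideal_nonzero I -> ideal_proper I ->
     ideal_nonzero J -> ideal_proper J ->
     ideal_supp I :&: ideal_supp J = set0 ->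
     sdepth (sum_quot_grading I J) = depth (sum_quot I J) ->
     sdepth (quot_ideal_grading I) = depth (quot_ideal I) /\
     (depth (ideal_mod J) <= sdepth (ideal_mod_grading J))%N.

Section Assertions.
Variable K : fieldType.
Local Notation full := (fun=> True).
Local Notation empty := (fun=> False).

(** Ideals in disjoint sets of variables, extended to the ring in all of them: the
    modules they define are tensor products. *)
Section Extended.
Variables (n a b : nat) (s : splitting n a b).
Variables (U : 'X_{1..a} -> Prop) (W : 'X_{1..b} -> Prop).
Hypotheses (upU : upset U) (upW : upset W).

Lemma ext_upset : upset (fun m => U (resL s m)).
Proof. by move=> u v uv; apply: upU; apply: resL_le. Qed.

Lemma ext_tensorV : (fun m => U (resL s m)) = tensorV s full U full empty.
Proof. by apply/predeqP => m; rewrite /tensorV /tensorU; tauto. Qed.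

Lemma ext_tensorU : (fun m => W (resR s m)) = tensorU s full W.
Proof. by apply/predeqP => m; rewrite /tensorU; tauto. Qed.

Lemma tensorV_ideal : (fun=> False) = tensorV s full empty W empty.
Proof. by apply/predeqP => m; rewrite /tensorV /tensorU; tauto. Qed.

Lemma tensorU_full : (fun=> True) = tensorU s full full.
Proof. by apply/predeqP => m; rewrite /tensorU; tauto. Qed.

Lemma ext_sum_quot : (fun m => U (resL s m) /\ W (resR s m)) = tensorV s full U W empty.
Proof. by apply/predeqP => m; rewrite /tensorV /tensorU; tauto. Qed.

End Extended.

Lemma ext_supp n a b (s : splitting n a b) U (upU : upset U) k :
  k \in ideal_supp (upset_ideal K (ext_upset (s := s) upU)) -> exists i, k = inL s i.
Proof.
rewrite inE => /asboolP [u [Iu min_u]]; rewrite inE => uk.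
rewrite -/(exponents _ u) exponents_upset_ideal in Iu.
case side_k: (side s k) => [i|j]; first by exists i; rewrite -(sideK s k) side_k.
have e : join s (resL s u) 0 = u.
  apply: min_u.
    by rewrite -/(exponents _ _) exponents_upset_ideal joinKL.
  apply/mnm_lepP => l; rewrite -{2}(resK s u) !mnmE.
  by case: (side s l) => l'; rewrite ?mnm0E.
by move: uk; rewrite -e mnmE side_k mnm0E.
Qed.

(** What the second assertion says about ideals in disjoint sets of variables,
    each considered in its own variables only. *)
Lemma assertion_transfer n a b (s : splitting n a b)
  (U : 'X_{1..a} -> Prop) (W : 'X_{1..b} -> Prop) : disjoint_stanley_equality K ->
  (1 <= n)%N -> upset U -> (exists m, U m) -> ~ U 0%MM ->
  upset W -> (exists m, W m) -> ~ W 0%MM ->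
  mono_sdepth (tensorU s full W) (tensorV s full U W empty) =
    (mono_depth K full U + mono_depth K W empty)%N ->
  (mono_depth K full U <= mono_sdepth full U)%N /\
  (mono_depth K W empty <= mono_sdepth W empty)%N.
Proof.
move=> H2 n_gt0 upU [mU UmU] nU0 upW [mW WmW] nW0 eq_dep.
have mmU : mono_module full U by apply: quot_mono_module_upset.
have mmW : mono_module W empty by apply: ideal_mono_module_upset => //; exists mW.
have [resL0 resR0] := (res_eq0 s 0%MM).1 erefl.
pose I := upset_ideal K (ext_upset (s := s) upU).
pose J := upset_ideal K (ext_upset (s := swap_splitting s) upW).
have expI : exponents I = (fun m => U (resL s m)) by apply: exponents_upset_ideal.
have expJ : exponents J = (fun m => W (resR s m)) by apply: exponents_upset_ideal.
have nzI : ideal_nonzero I.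
  by apply/ideal_nonzeroP; rewrite expI; exists (join s mU 0); rewrite joinKL.
have nzJ : ideal_nonzero J.
  by apply/ideal_nonzeroP; rewrite expJ; exists (join s 0 mW); rewrite joinKR.
have prI : ideal_proper I by apply/ideal_properP; rewrite expI resL0.
have prJ : ideal_proper J.
  by apply/ideal_properP; rewrite expJ resR0.
have disj : ideal_supp I :&: ideal_supp J = set0.
  apply/setP => k; rewrite [in RHS]inE; apply/negbTE/setIP => -[/ext_supp [i ->] /ext_supp [j /= e]].
  by have := side_inR s j; rewrite -e side_inL.
have := sum_quot_presents I J; rewrite expI expJ ext_sum_quot (ext_tensorU s) => pIJ.
have [dIJ sIJ] := presents_invariants (tensor_mono_module s mmU mmW) pIJ.
have [|eq_I le_J] := H2 n I J n_gt0 nzI prI nzJ prJ disj.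
  by rewrite sIJ eq_dep dIJ mono_depth_tensor.
have mb := ring_mono_module b; have ma := ring_mono_module a.
have [db sb] := ring_invariants K b; have [da sa] := ring_invariants K a.
have := quot_presents I; rewrite expI ext_tensorV (tensorU_full s) => pI.
have := ideal_presents J; rewrite expJ (ext_tensorU s) (tensorV_ideal s W) => pJ.
have [dI sI] := presents_invariants (tensor_mono_module s mmU mb) pI.
have [dJ sJ] := presents_invariants (tensor_mono_module s ma mmW) pJ.
split.
  rewrite -(leq_add2r b); apply: leq_trans (mono_sdepth_sliceL s mmU mb).
  by rewrite -sI eq_I dI mono_depth_tensor // db.
rewrite -(leq_add2r a); apply: leq_trans (mono_sdepth_sliceR s ma mmW).
by rewrite -sJ; apply: leq_trans le_J; rewrite dJ mono_depth_tensor // da addnC.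
Qed.

End Assertions.

Section Final.
Variable K : fieldType.
Local Notation full := (fun=> True).
Local Notation empty := (fun=> False).

(** ** The inequalities imply the statement on disjoint supports *)

Lemma inequality_upset a (U : 'X_{1..a} -> Prop) : stanley_inequality K ->
  upset U -> (exists m, U m) -> ~ U 0%MM ->
  (mono_depth K full U <= mono_sdepth full U)%N /\
  (mono_depth K U empty <= mono_sdepth U empty)%N.
Proof.
move=> H1 upU [m Um] nU0; pose I := upset_ideal K upU.
have expI : exponents I = U by apply: exponents_upset_ideal.
have nzI : ideal_nonzero I by apply/ideal_nonzeroP; rewrite expI; exists m.
have prI : ideal_proper I by apply/ideal_properP; rewrite expI.
have a_gt0 : (0 < a)%N.
  case: (posnP a) => // a0; case: nU0; suff <- : m = 0%MM by [].
  by apply/mnmP => i; have := ltn_ord i; rewrite {2}a0.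
have [d1 s1] := presents_invariants (quot_mono_module prI) (quot_presents I).
have [d2 s2] := presents_invariants (ideal_mono_module nzI) (ideal_presents I).
have := H1 a I a_gt0 nzI prI.
by rewrite d1 s1 d2 s2 expI.
Qed.

(** [I] is extended from the variables that meet its support: a minimal generator
    below [m] involves no others. *)
Lemma exponents_supp n a b (s : splitting n a b) (I : monomial_ideal n K) :
  (forall j, inR s j \notin ideal_supp I) ->
  exponents I = (fun m => exponents I (join s (resL s m) 0)).
Proof.
move=> suppI; apply/predeqP => m; split=> [/exponents_min [u min_u um]|].
  apply: exponents_upset min_u.1; apply/mnm_lepP => k; rewrite mnmE -{1}(sideK s k).
  case: (side s k) => i; rewrite ?mnmE ?mnm0E ?(mnm_lepP um) //.
  rewrite leqn0; apply/negPn/negP => ui; move/negP: (suppI i); apply.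
  by rewrite inE; apply/asboolP; exists u => //; rewrite inE lt0n.
apply: exponents_upset; apply/mnm_lepP => k; rewrite mnmE -{2}(sideK s k).
by case: (side s k) => i; rewrite ?mnmE // mnm0E.
Qed.

Lemma inequality_disjoint : stanley_inequality K -> disjoint_stanley_equality K.
Proof.
move=> H1 n I J n_gt0 nzI prI nzJ prJ disj eq_dep.
split; last by have [] := H1 n J n_gt0 nzJ prJ.
have [s [sL sR]] := set_splitting (ideal_supp I).
have expI := exponents_supp sR.
have sJ j : inR (swap_splitting s) j \notin ideal_supp J.
  apply/negP => Jj; have : inR (swap_splitting s) j \in ideal_supp I :&: ideal_supp J.
    by rewrite inE Jj sL.
  by rewrite disj inE.
have expJ := exponents_supp sJ.
pose U al := exponents I (join s al 0).
pose W be := exponents J (join (swap_splitting s) be 0).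
have upU : upset U.
  move=> u v /mnm_lepP uv; apply: exponents_upset; apply/mnm_lepP => k; rewrite !mnmE.
  by case: (side s k).
have upW : upset W.
  move=> u v /mnm_lepP uv; apply: exponents_upset; apply/mnm_lepP => k; rewrite !mnmE.
  by case: (side _ k).
have {}expI : exponents I = fun m => U (resL s m) by [].
have {}expJ : exponents J = fun m => W (resR s m) by [].
have [resL0 resR0] := (res_eq0 s 0%MM).1 erefl.
have exU : exists m, U m.
  by have /ideal_nonzeroP [m] := nzI; rewrite expI => Um; exists (resL s m).
have exW : exists m, W m.
  by have /ideal_nonzeroP [m] := nzJ; rewrite expJ => Wm; exists (resR s m).
have nU0 : ~ U 0%MM by have /ideal_properP := prI; rewrite expI resL0.
have nW0 : ~ W 0%MM by have /ideal_properP := prJ; rewrite expJ resR0.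
have mmU : mono_module full U by apply: quot_mono_module_upset.
have mmW : mono_module W empty by apply: ideal_mono_module_upset.
have [leU _] := inequality_upset H1 upU exU nU0.
have [_ leW] := inequality_upset H1 upW exW nW0.
have := sum_quot_presents I J; rewrite expI expJ ext_sum_quot (ext_tensorU s) => pIJ.
have [dIJ sIJ] := presents_invariants (tensor_mono_module s mmU mmW) pIJ.
have mb := ring_mono_module #|~: ideal_supp I|.
have [db sb] := ring_invariants K #|~: ideal_supp I|.
have := quot_presents I; rewrite expI ext_tensorV (tensorU_full s) => pI.
have [dI sI] := presents_invariants (tensor_mono_module s mmU mb) pI.
have := mono_sdepth_tensor s mmU mmW; rewrite -sIJ eq_dep dIJ mono_depth_tensor // => le_UW.
have [le1 _] := H1 n I n_gt0 nzI prI.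
apply/eqP; rewrite eqn_leq le1 andbT sI dI mono_depth_tensor // db.
apply: leq_trans (mono_sdepth_sliceL s mmU mb) _; rewrite leq_add2r.
by move: le_UW leW; lia.
Qed.

(** ** The converse *)

Lemma zero_at_resR n a b (s : splitting n a b) j v :
  resR s (zero_at (inR s j) v) = zero_at j (resR s v) /\
  resL s (zero_at (inR s j) v) = resL s v.
Proof.
split; apply/mnmP => i; rewrite !mnmE; last first.
  by case: eqP => // /(congr1 (side s)); rewrite side_inL side_inR.
by rewrite (inj_eq (@inR_inj _ _ _ s)).
Qed.

Lemma occurs_zero_at n (Q : {set 'I_n}) i (v : 'X_{1..n}) : i \notin Q ->
  occurs Q (zero_at i v) <-> occurs Q v.
Proof.
move=> iQ; split=> -[k kQ vk]; exists k => //; move: vk; rewrite mnmE.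
  by case: eqP.
by case: eqP => // ki; rewrite -ki kQ in iQ.
Qed.

Lemma occurs_add n (Q : {set 'I_n}) i (v : 'X_{1..n}) :
  v i = 0%N -> occurs Q v <-> occurs (Q :\ i) v.
Proof.
move=> vi; split=> -[k kQ vk]; exists k => //; last by move: kQ; rewrite inE => /andP[].
by rewrite !inE kQ andbT; apply/eqP => ki; rewrite ki vi in vk.
Qed.

Section Converse.
Hypothesis H2 : disjoint_stanley_equality K.

(** If [S/I] violates the inequality, tensor it with the ideal of a growing set
    [Q] of new variables: one more variable lowers the depth by one and does not
    raise the Stanley depth, so the deficit cannot jump over 0; it cannot reach 0
    either, since that would be an equality forbidden by the second assertion. *)
Lemma converse_quot n (U : 'X_{1..n} -> Prop) :
  upset U -> (exists m, U m) -> ~ U 0%MM ->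
  (mono_depth K full U <= mono_sdepth full U)%N.
Proof.
move=> upU exU nU0; rewrite leqNgt; apply/negP => deficit.
have mmU : mono_module full U by apply: quot_mono_module_upset.
have [c c_gt0 cd] := has_sdepth_all_variables (mono_depth K full U).+1.
pose s := ord_splitting n c.
have mmQ (Q : {set 'I_c}) i : i \in Q -> mono_module (occurs Q) empty.
  by move=> iQ; apply: occurs_mono_module iQ.
pose F (Q : {set 'I_c}) :=
  mono_sdepth (tensorU s full (occurs Q)) (tensorV s full U (occurs Q) empty).
have dQ (Q : {set 'I_c}) i : i \in Q -> mono_depth K (occurs Q) empty = (c - #|Q|).+1.
  by move=> iQ; apply: mono_depthE; [apply: mmQ iQ | apply: depth_variables_ideal iQ].
have cardQ (Q : {set 'I_c}) : (#|Q| <= c)%N by have := max_card (mem Q); rewrite card_ord.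
have below (Q : {set 'I_c}) i : i \in Q -> (F Q < mono_depth K full U + (c - #|Q|).+1)%N.
  have [k] := ubnP #|Q|; elim: k Q i => // k IH Q i Qk iQ.
  have le_F : (F Q <= mono_depth K full U + (c - #|Q|).+1)%N.
    case: (set_0Vmem (Q :\ i)) => [Q0|[j jQ]].
      have Q1 : #|Q| = 1%N by rewrite (cardsD1 i) iQ Q0 cards0.
      rewrite Q1; apply: leq_trans (mono_sdepth_sliceL s mmU (mmQ _ _ iQ)) _.
      by move: deficit c_gt0; lia.
    have card_Q : #|Q| = #|Q :\ i|.+1 by rewrite (cardsD1 i) iQ.
    have lt_F : (F (Q :\ i) < mono_depth K full U + (c - #|Q :\ i|).+1)%N.
      by apply: IH jQ; rewrite -ltnS -card_Q.
    have FQ : (F Q <= F (Q :\ i))%N.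
      apply: sdepth_max_le (mono_sdepthP (tensor_mono_module s mmU (mmQ _ _ iQ)))
        (mono_sdepthP (tensor_mono_module s mmU (mmQ _ _ jQ))) _ => d.
      apply: (has_sdepth_cylinder (i := inR s i)) => v.
        move=> vi; rewrite !tensor_diff /tensorU.
        by rewrite (occurs_add Q (i := i) (v := resR s v)) // mnmE.
      rewrite !tensor_diff /tensorU; have [-> ->] := zero_at_resR s i v.
      by rewrite occurs_zero_at // !inE eqxx.
    by move: FQ lt_F (cardQ Q); rewrite card_Q; lia.
  rewrite ltn_neqAle le_F andbT; apply/eqP => eq_F.
  have [] := assertion_transfer (s := s) H2 _ upU exU nU0 (occurs_upset (Q := Q)) _ _ _.
  - by rewrite addn_gt0 c_gt0 orbT.
  - by have [_ _ _ [m Qm _]] := mmQ Q i iQ; exists m.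
  - by case=> j _; rewrite mnm0E.
  - by rewrite -/(F Q) eq_F (dQ Q i iQ).
  by move=> le_U _; move: deficit; rewrite ltnNge le_U.
have i0 : 'I_c := Ordinal c_gt0.
have := below setT i0 (in_setT _).
have := mono_sdepth_tensor s mmU (mmQ setT i0 (in_setT _)); rewrite -/(F setT).
have [_ max_c] := mono_sdepthP (mmQ setT i0 (in_setT _)).
have : ((mono_depth K full U).+1 <= mono_sdepth (occurs [set: 'I_c]) empty)%N.
  by apply: max_c; apply: eq_has_sdepth cd => v; tauto.
by rewrite cardsT card_ord; lia.
Qed.

(** The same argument with the quotient of the ring in the new variables by the
    product of the ideals of two growing disjoint sets [P] and [Q] of them. *)
Lemma converse_ideal n (W : 'X_{1..n} -> Prop) :
  upset W -> (exists m, W m) -> ~ W 0%MM ->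
  (mono_depth K W empty <= mono_sdepth W empty)%N.
Proof.
move=> upW exW nW0; rewrite leqNgt; apply/negP => deficit.
have mmW : mono_module W empty by apply: ideal_mono_module_upset.
have [m m_gt0 md] := has_sdepth_two_subspaces (mono_depth K W empty).+1.
pose c := (m + m)%N; pose s := ord_splitting c n.
have mmPQ (P Q : {set 'I_c}) := occurs_both_mono_module P Q.
pose F (P Q : {set 'I_c}) :=
  mono_sdepth (tensorU s full W) (tensorV s full (occurs_both P Q) W empty).
have FC P Q : F P Q = F Q P.
  by rewrite /F (_ : occurs_both P Q = occurs_both Q P) //; apply/predeqP => v; split=> -[].
have dPQ (P Q : {set 'I_c}) i j : [disjoint P & Q] -> i \in P -> j \in Q ->
    mono_depth K full (occurs_both P Q) = (c - #|P :|: Q|).+1.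
  move=> dis iP jQ; apply: mono_depthE; first exact: mmPQ.
  exact: depth_product_of_variables dis iP jQ.
have card_c (P : {set 'I_c}) : (#|P| <= c)%N by have := max_card (mem P); rewrite card_ord.
have FS (P Q : {set 'I_c}) i : i \notin Q -> (F P Q <= F (P :\ i) Q)%N.
  move=> iQ; apply: sdepth_max_le (mono_sdepthP (tensor_mono_module s (mmPQ P Q) mmW))
    (mono_sdepthP (tensor_mono_module s (mmPQ (P :\ i) Q) mmW)) _ => d.
  apply: (has_sdepth_cylinder (i := inL s i)) => v.
    move=> vi; rewrite !tensor_diff /tensorU /occurs_both.
    by rewrite (occurs_add P (i := i) (v := resL s v)) // mnmE.
  rewrite !tensor_diff /tensorU /occurs_both.
  have [eL eR] := zero_at_resR (swap_splitting s) i v.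
  have -> : resL s (zero_at (inL s i) v) = zero_at i (resL s v) := eL.
  have -> : resR s (zero_at (inL s i) v) = resR s v := eR.
  by rewrite !occurs_zero_at // !inE eqxx.
have below (P Q : {set 'I_c}) i j : [disjoint P & Q] -> i \in P -> j \in Q ->
    (F P Q < mono_depth K W empty + (c - #|P :|: Q|).+1)%N.
  have [k] := ubnP #|P :|: Q|; elim: k P Q i j => // k IH P Q i j PQk dis iP jQ.
  have le_F : (F P Q <= mono_depth K W empty + (c - #|P :|: Q|).+1)%N.
    have step (P' Q' : {set 'I_c}) i' j' l : [disjoint P' & Q'] -> i' \in P' -> j' \in Q' ->
        l \in P' :\ i' -> (#|P' :|: Q'| < k.+1)%N ->
        (F P' Q' <= mono_depth K W empty + (c - #|P' :|: Q'|).+1)%N.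
      move=> dis' iP' jQ' lP' PQ'k; have iQ' : i' \notin Q' by rewrite (disjointFr dis').
      have card_PQ : #|P' :|: Q'| = #|P' :\ i' :|: Q'|.+1.
        rewrite (cardsD1 i') inE iP' /=; congr (_ + _)%N; apply: eq_card => x.
        by rewrite !inE; case: eqP => // ->; rewrite (negPf iQ').
      have := FS P' Q' i' iQ'; have := IH (P' :\ i') Q' l j' _ _ lP' jQ'.
      have -> : [disjoint P' :\ i' & Q'].
        by apply: disjointWl dis'; apply: subD1set.
      move: PQ'k (card_c (P' :|: Q')); rewrite card_PQ ltnS => h1 h2 /(_ h1 isT); lia.
    have [Pi|[l lP]] := set_0Vmem (P :\ i); last exact: step iP jQ lP PQk.
    have [Qj|[l lQ]] := set_0Vmem (Q :\ j); last first.
      by rewrite FC setUC; apply: step jQ iP lQ _; rewrite 1?disjoint_sym 1?setUC.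
    have eqP1 : P = [set i] by rewrite -(setD1K iP) Pi setU0.
    have eqQ1 : Q = [set j] by rewrite -(setD1K jQ) Qj setU0.
    have neq_ij : i != j.
      by apply/eqP => ij; have := disjointFr dis iP; rewrite ij jQ.
    have card2 : #|P :|: Q| = 2%N by rewrite eqP1 eqQ1 cards2 neq_ij.
    have := mono_sdepth_sliceR s (mmPQ P Q) mmW; rewrite -/(F P Q).
    move: (card_c (P :|: Q)) deficit; rewrite card2; lia.
  rewrite ltn_neqAle le_F andbT; apply/eqP => eq_F.
  have [] := assertion_transfer (s := s) H2 _ (occurs_both_upset (P := P) (Q := Q)) _ _ upW exW nW0.
  - by rewrite addn_gt0 /c addn_gt0 m_gt0.
  - exists (U_(i) + U_(j))%MM; split; [exists i | exists j] => //;
      by rewrite mnmDE !mnm1E eqxx // addnC.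
  - by case=> -[l _]; rewrite mnm0E.
  - by rewrite -/(F P Q) eq_F (dPQ P Q i j) // addnC.
  by move=> _ le_W; move: deficit; rewrite ltnNge le_W.
pose t := ord_splitting m m; pose P := inL t @: setT; pose Q := inR t @: setT.
pose i0 := Ordinal m_gt0.
have iP : inL t i0 \in P by rewrite imset_f.
have jQ : inR t i0 \in Q by rewrite imset_f.
have dis : [disjoint P & Q].
  apply/pred0P => x /=; apply/negP => /andP[/imsetP[i _ ->] /imsetP[j _]].
  by move/(congr1 (side t)); rewrite side_inL side_inR.
have full_PQ : #|P :|: Q| = c.
  rewrite -[RHS](card_ord c) -cardsT; congr #|pred_of_set _|; apply/setP => x; rewrite !inE.
  by rewrite -(sideK t x); case: (side t x) => y; rewrite imset_f ?orbT.
have := below P Q _ _ dis iP jQ.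
have := mono_sdepth_tensor s (mmPQ P Q) mmW; rewrite -/(F P Q).
have [_ max_c] := mono_sdepthP (mmPQ P Q).
have := max_c _ md.
by rewrite full_PQ; lia.
Qed.

Lemma disjoint_inequality : stanley_inequality K.
Proof.
move=> n I n_gt0 nzI prI.
have upI := exponents_upset (I := I).
have exI := (ideal_nonzeroP I).1 nzI; have nI0 := (ideal_properP I).1 prI.
have [d1 s1] := presents_invariants (quot_mono_module prI) (quot_presents I).
have [d2 s2] := presents_invariants (ideal_mono_module nzI) (ideal_presents I).
by rewrite d1 s1 d2 s2; split; [apply: converse_quot | apply: converse_ideal].
Qed.

End Converse.

End Final.

Theorem proposition3p8 (K : fieldType) :
  (forall (n : nat) (I : monomial_ideal n K),
     (1 <= n)%N -> ideal_nonzero I -> ideal_proper I ->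
     (depth (quot_ideal I) <= sdepth (quot_ideal_grading I))%N /\
     (depth (ideal_mod I) <= sdepth (ideal_mod_grading I))%N)
  <->
  (forall (n : nat) (I J : monomial_ideal n K),
     (1 <= n)%N ->
     ideal_nonzero I -> ideal_proper I ->
     ideal_nonzero J -> ideal_proper J ->
     ideal_supp I :&: ideal_supp J = set0 ->
     sdepth (sum_quot_grading I J) = depth (sum_quot I J) ->
     sdepth (quot_ideal_grading I) = depth (quot_ideal I) /\
     (depth (ideal_mod J) <= sdepth (ideal_mod_grading J))%N).
Proof. split; [exact: inequality_disjoint | exact: disjoint_inequality]. Qed.
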